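(* For all $\alpha\in[0,\overline{\alpha})$ and $T\in(0,\infty)$, there exists $C_{\alpha,T}\in(0,\infty)$ such that for any initial condition $u_0\in H$ and all $h\in(0,1]$, $\tau\in(0,1]$ and $s\ge 1$ such that the stability condition $\tau\lambda_{N_h,h}\le L_s$ holds, one has, for all integers $n\ge 1$ with $t_n=n\tau\le T$, $$\bigl(\mathbb{E}|u^h(t_n)-u_n^h|^2\bigr)^{\frac12}\le C_{\alpha,T}\bigl(1+|u_0|\,t_n^{-\frac{\alpha}{2}}\bigr)\tau^{\frac{\alpha}{2}}.$$ Here $u^h$ is the mild solution of the spatially semi-discrete problem and $(u_n^h)_{n\ge0}$ is the fully discrete scheme.
   Context: Spatial setting. Let $d\in\{1,2,3\}$, let $\mathcal{D}\subset\mathbb{R}^d$ be an open, convex, polyhedral bounded domain, and $H=L^2(\mathcal{D})$ with inner product $\langle\cdot,\cdot\rangle$ and norm $|\cdot|$. $\|\cdot\|_{\mathcal{L}(H)}$ and $\|\cdot\|_{\mathcal{L}_2(H)}$ are the operator norm and the Hilbert-Schmidt norm. Let $\Lambda u=\mathrm{div}(a\nabla u)$ with domain $D(\Lambda)=H^2(\mathcal{D})\cap H^1_0(\mathcal{D})$, where $a:\overline{\mathcal{D}}\to\mathbb{R}$ is continuous, $\mathcal{C}^\infty$ on $\mathcal{D}$, and $\min_{\overline{\mathcal{D}}}a>0$. $\Lambda$ is self-adjoint with a complete orthonormal eigensystem $\Lambda e_m=-\lambda_m e_m$, $0<\lambda_1\le\lambda_2\le\cdots$, $\lim_m m^{-2/d}\lambda_m\in(0,\infty)$;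 for $\alpha\in[-1,1]$, $(-\Lambda)^\alpha u=\sum_{m\ge1}\lambda_m^\alpha\langle u,e_m\rangle e_m$. Nonlinearity. $F:H\to H$ is globally Lipschitz continuous. Noise. $(\epsilon_m)_{m\ge1}$ is a complete orthonormal system of $H$, $(q_m)_{m\ge1}$ a bounded sequence of nonnegative reals, $Qu=\sum_m q_m\langle u,\epsilon_m\rangle\epsilon_m$, $Q^{1/2}u=\sum_m\sqrt{q_m}\langle u,\epsilon_m\rangle\epsilon_m$. With $(\beta_m)_{m\ge1}$ independent standard real Wiener processes on a probability space satisfying the usual conditions, $W^Q(t)=\sum_m\sqrt{q_m}\beta_m(t)\epsilon_m$. Assume there exists $\alpha>0$ with $\|(-\Lambda)^{\frac{\alpha-1}{2}}Q^{1/2}\|_{\mathcal{L}_2(H)}<\infty$, and set $\overline{\alpha}=\sup\{\alpha\in[0,1]:\|(-\Lambda)^{\frac{\alpha-1}{2}}Q^{1/2}\|_{\mathcal{L}_2(H)}<\infty\}$. Let $\sigma>0$. Finite elements. For $h\in(0,1]$, $\mathcal{T}_h$ is a (quasi-uniform) triangulation of $\mathcal{D}$ of mesh size $h$, $V_h\subset H^1_0(\mathcal{D})$ is the space of continuous functions on $\overline{\mathcal{D}}$, piecewise linear on $\mathcal{T}_h$, zero on $\partial\mathcal{D}$, $N_h=\dim V_h$, equipped with the inner product of $H$. $P_h:H\to V_h$ is the $L^2$-orthogonal projection, and $\Lambda_h:V_h\to V_h$ is defined by $\langle\Lambda_hu_h,v_h\rangle=-\int_{\mathcal{D}}a\nabla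 u_h\cdot\nabla v_h\,dx$. $\Lambda_h$ is self-adjoint negative, with orthonormal eigenbasis $\Lambda_he_{m,h}=-\lambda_{m,h}e_{m,h}$, $0<\lambda_{1,h}\le\cdots\le\lambda_{N_h,h}$. For real functions $\phi$ on $(-\infty,0]$, $\phi(\Lambda_h)u_h=\sum_{m=1}^{N_h}\phi(-\lambda_{m,h})\langle u_h,e_{m,h}\rangle e_{m,h}$; this defines $(-\Lambda_h)^\alpha$ and $e^{t\Lambda_h}$. Standing assumption: (i) for all $\alpha\in[-\frac12,\frac12]$ there is $C_\alpha\in(0,\infty)$ such that for all $h$, $C_\alpha^{-1}|(-\Lambda_h)^\alpha u_h|\le|(-\Lambda)^\alpha u_h|\le C_\alpha|(-\Lambda_h)^\alpha u_h|$ for $u_h\in V_h$, and $|(-\Lambda_h)^\alpha P_hu|\le C_\alpha|(-\Lambda)^\alpha u|$ for $u\in D((-\Lambda)^\alpha)$; (ii) for all $\alpha_1\in[0,1]$, $\alpha_2\in[\alpha_1,2]$ there is $C_{\alpha_1,\alpha_2}$ with $\|(-\Lambda)^{\frac{\alpha_1}{2}}(I-P_h)(-\Lambda)^{-\frac{\alpha_2}{2}}\|_{\mathcal{L}(H)}\le C_{\alpha_1,\alpha_2}h^{\alpha_2-\alpha_1}$ for all $h$. Semi-discrete problem. $u^h$ is the $V_h$-valued solution of $du^h=\Lambda_hu^hdt+P_hF(u^h)dt+\sigma P_hdW^Q$, $u^h(0)=P_hu_0$, i.e. $u^h(t)=e^{t\Lambda_h}P_hu_0+\int_0^te^{(t-r)\Lambda_h}P_hF(u^h(r))dr+\sigma\int_0^te^{(t-r)\Lambda_h}P_hdW^Q(r)$.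 Integrator. $(\mathcal{A}_s)_{s\ge1}$, $(\mathcal{B}_s)_{s\ge1}$ are families of meromorphic functions, real-valued on $[-L_s,0]$, and $L_s\in(0,\infty]$ (with $[-L_s,\cdot]$ read as $(-\infty,\cdot]$ if $L_s=\infty$), such that: (a) $\mathcal{A}_s(0)=\mathcal{A}_s'(0)=\mathcal{B}_s(0)=1$ for all $s\ge1$; (b) $\sup_{s\ge1,z\in[-L_s,0]}(1+|z|)|\mathcal{B}_s(z)|^2<\infty$; (c) for all $\delta\in(0,1]$, $\sup_{s\ge1,z\in[-L_s,-\delta]}|\mathcal{A}_s(z)|<1$; (d) there is $\delta\in(0,1]$ with $\sup_{s\ge1,z\in\mathbb{C},|z|<\delta}(|\mathcal{A}_s(z)|+|\mathcal{B}_s(z)|)<\infty$. Scheme. For time step $\tau\in(0,1]$, $t_n=n\tau$, $u_0^h=P_hu_0$ and $u_{n+1}^h=\mathcal{A}_s(\tau\Lambda_h)u_n^h+\mathcal{B}_s(\tau\Lambda_h)P_h\bigl(\tau F(u_n^h)+\sigma\Delta W_n^Q\bigr)$, $\Delta W_n^Q=W^Q(t_{n+1})-W^Q(t_n)$, where $\mathcal{A}_s(\tau\Lambda_h)=\sum_m\mathcal{A}_s(-\tau\lambda_{m,h})\langle\cdot,e_{m,h}\rangle e_{m,h}$ and likewise for $\mathcal{B}_s(\tau\Lambda_h)$. *)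

(* Defs.v *)
From HB Require Import structures.
From mathcomp Require Import all_boot all_order all_algebra complex.
From mathcomp Require Import all_classical all_reals all_analysis.

Set Implicit Arguments.
Unset Strict Implicit.
Unset Printing Implicit Defensive.

Import Order.TTheory GRing.Theory Num.Theory.
Import numFieldNormedType.Exports.

Local Open Scope classical_set_scope.
Local Open Scope ring_scope.

(* Infimum of the volumes of the boxes [a, b] that contain A.  The empty set
   gets 0 separately because for d = 0 every box has volume 1. *)
Definition box_gauge {R : realType} {d : nat} (A : set 'rV[R]_d) : \bar R :=
  ereal_inf ([set 0%E | _ in [set _ : unit | A = set0]] `|`
    [set (\prod_(i < d) (p.2 0 i - p.1 0 i))%:E
      | p in [set p : 'rV[R]_d * 'rV[R]_d |
          (forall i, p.1 0 i <= p.2 0 i) /\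
          A `<=` [set x | forall i, p.1 0 i <= x 0 i <= p.2 0 i]]]).

(* Lebesgue outer measure on R^d: [mu_ext] takes the infimum of
   \sum_k box_gauge (A k) over the countable covers (A k) of a set; every set is
   allowed in a cover, whence the full power set as semiring. *)
Definition lebesgue_outer {R : realType} {d : nat} (X : set 'rV[R]_d) : \bar R :=
  @mu_ext _ (g_sigma_algebraType [set: set 'rV[R]_d]) R box_gauge X.

(* Lebesgue outer measure restricted to D.  Its Caratheodory measure is Lebesgue
   measure on D, with every subset of the complement of D a null set; a
   function is measurable for it iff its restriction to D is Lebesgue
   measurable (D open). *)
Definition lebesgue_on {R : realType} {d : nat} (D X : set 'rV[R]_d) : \bar R :=
  lebesgue_outer (X `&` D).

Section lebesgue_on_outer_measure.
Context {R : realType} {d : nat}.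
Implicit Types (D A : set 'rV[R]_d).
Local Open Scope ereal_scope.

Lemma box_gauge0 : box_gauge (set0 : set 'rV[R]_d) = 0.
Proof.
apply/eqP; rewrite eq_le; apply/andP; split.
  by apply: ereal_inf_lbound; left; exists tt.
apply: le_ereal_inf_tmp => _ [[_ _ <-]//|[[a b] [/= ab _] <-]].
by rewrite lee_fin; apply: prodr_ge0 => i _; rewrite subr_ge0.
Qed.

Lemma box_gauge_ge0 A : 0 <= box_gauge A.
Proof.
apply: le_ereal_inf_tmp => _ [[_ _ <-]//|[[a b] [/= ab _] <-]].
by rewrite lee_fin; apply: prodr_ge0 => i _; rewrite subr_ge0.
Qed.

Let T := g_sigma_algebraType [set: set 'rV[R]_d].

Lemma lebesgue_on0 D : lebesgue_on D set0 = 0.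
Proof.
rewrite /lebesgue_on set0I.
exact: (@mu_ext0 _ T R box_gauge box_gauge0 box_gauge_ge0).
Qed.

Lemma lebesgue_on_ge0 D A : 0 <= lebesgue_on D A.
Proof. exact: (@mu_ext_ge0 _ T R box_gauge box_gauge_ge0). Qed.

Lemma le_lebesgue_on D : {homo lebesgue_on D : A B / A `<=` B >-> A <= B}.
Proof.
by move=> A B AB; apply: (@le_mu_ext _ T R box_gauge); exact: setSI.
Qed.

Lemma lebesgue_on_sigma_subadditive D : sigma_subadditive (lebesgue_on D).
Proof.
move=> A; rewrite /lebesgue_on setI_bigcupl.
exact: (@mu_ext_sigma_subadditive _ T R box_gauge box_gauge_ge0).
Qed.

HB.instance Definition _ D := isOuterMeasure.Build R _ (lebesgue_on D)
  (lebesgue_on0 D) (lebesgue_on_ge0 D) (@le_lebesgue_on D)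
  (@lebesgue_on_sigma_subadditive D).

End lebesgue_on_outer_measure.

Definition caratheodory_measure_of {R : realType} {T : pointedType}
    (mu : {outer_measure set T -> \bar R}) :
    {measure set (caratheodory_type mu) -> \bar R} :=
  [the {measure set (caratheodory_type mu) -> \bar R} of
     (mu : set (caratheodory_type mu) -> \bar R)].

Definition lebesgueD {R : realType} {d : nat} (D : set 'rV[R]_d) :=
  caratheodory_measure_of
    [the {outer_measure set 'rV[R]_d -> \bar R} of lebesgue_on D].

(* Square integrable functions.  As in the library, they are not quotiented:
   equality in H = L^2(D) is [eqH] below, and a Lipschitz map for [hnorm] is the
   same as a Lipschitz map between the classes. *)
Definition L2 {R : realType} {d : nat} (D : set 'rV[R]_d) :=
  LfunType (lebesgueD D) (lee1n 2).

Section hilbert.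
Context {R : realType} {d : nat} {D : set 'rV[R]_d}.
Local Notation H := (L2 D).
Implicit Types (u v : H) (x b : nat -> H) (S : H -> H).

Definition dot u v : R := \int[lebesgueD D]_y (u y * v y).

Definition hnorm u : R := Num.sqrt (dot u u).

Definition eqH u v : Prop := hnorm (u - v) = 0.

Definition is_hsum x v : Prop :=
  hnorm (\sum_(m < n) x m - v) @[n --> \oo] --> (0 : R).

(* Sum of a series that converges in H (0 if it diverges). *)
Definition hsum x : H := xget 0 (is_hsum x).

Definition complete_orthonormal b : Prop :=
  (forall m n, dot (b m) (b n) = (m == n)%:R) /\
  (forall u, is_hsum (fun m => dot u (b m) *: b m) u).

(* The value does not depend on the complete orthonormal system b. *)
Definition hs_norm b S : \bar R :=
  ((\sum_(m <oo) ((hnorm (S (b m))) ^+ 2)%:E) `^ 2^-1)%E.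

Definition globally_lipschitz S : Prop :=
  exists K : R, forall u v, hnorm (S u - S v) <= K * hnorm (u - v).

(* Orthogonal projection of u onto the subspace V. *)
Definition hproj (V : set H) u : H :=
  xget 0 [set p | V p /\ forall w, V w -> dot (u - p) w = 0].

(* For an operator with e_m |-> - lam_m e_m: domain and value of its opposite
   to the power al. *)
Definition frac_dom (e : nat -> H) (lam : nat -> R) (al : R) : set H :=
  [set u | exists v, is_hsum (fun m => (lam m `^ al * dot u (e m)) *: e m) v].

Definition frac_pow (e : nat -> H) (lam : nat -> R) (al : R) u : H :=
  hsum (fun m => (lam m `^ al * dot u (e m)) *: e m).

Definition Qhalf (eps : nat -> H) (q : nat -> R) u : H :=
  hsum (fun m => (Num.sqrt (q m) * dot u (eps m)) *: eps m).

(* ||(-Lambda)^((al - 1) / 2) Q^(1/2)||_{L_2(H)} < oo *)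
Definition noise_regular (e : nat -> H) (lam : nat -> R) (eps : nat -> H)
    (q : nat -> R) (al : R) : Prop :=
  (forall u, frac_dom e lam ((al - 1) / 2) (Qhalf eps q u)) /\
  (hs_norm eps (fun u => frac_pow e lam ((al - 1) / 2) (Qhalf eps q u)) < +oo)%E.

Definition alphabar (e : nat -> H) (lam : nat -> R) (eps : nat -> H)
    (q : nat -> R) : R :=
  sup [set al | 0 <= al <= 1 /\ noise_regular e lam eps q al].

(* phi(Lambda_h), for Lambda_h with orthonormal eigenbasis (e m)_(m < N) and
   eigenvalues - lam m. *)
Definition fcalc (N : nat) (lam : nat -> R) (e : nat -> H) (phi : R -> R) u : H :=
  \sum_(m < N) (phi (- lam m) * dot u (e m)) *: e m.

End hilbert.

Section domain.
Context {R : realType} {d : nat}.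
Local Notation E := 'rV[R]_d.

Definition euclid_dot (x y : E) : R := \sum_(i < d) x 0 i * y 0 i.

Definition euclid_norm (x : E) : R := Num.sqrt (euclid_dot x x).

Definition convex_polyhedral_domain (D : set E) : Prop :=
  [/\ D !=set0, open D, convex_set D, bounded_set D &
      exists s : seq (E * R),
        D = [set x | forall p, p \in s -> euclid_dot p.1 x < p.2]].

Definition partial (i : 'I_d) (f : E -> R) (x : E) : R :=
  'D_(delta_mx 0 i : E) f x.

Definition smooth_on (D : set E) (f : E -> R) : Prop :=
  forall (s : seq 'I_d) (x : E), D x ->
    {for x, continuous (foldr partial f s)} /\
    forall i, derivable (foldr partial f s) x (delta_mx 0 i : E).

Definition test_function (D : set E) (f : E -> R) : Prop :=
  smooth_on setT f /\
  exists K : set E, [/\ compact K, K `<=` D & forall x, ~ K x -> f x = 0].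

Definition diffusion_coefficient (D : set E) (a : E -> R) : Prop :=
  [/\ {within closure D, continuous a}, smooth_on D a &
      exists2 a0 : R, 0 < a0 & forall x, closure D x -> a0 <= a x].

Section sobolev.
Context {D : set E}.
Local Notation H := (L2 D).

Definition is_weak_partial (i : 'I_d) (u g : H) : Prop :=
  forall phi, test_function D phi ->
    \int[lebesgueD D]_x (u x * partial i phi x) =
    - \int[lebesgueD D]_x (g x * phi x).

Definition weak_partial (i : 'I_d) (u : H) : H := xget 0 (is_weak_partial i u).

Definition H2 : set H :=
  [set u | forall i, exists2 g, is_weak_partial i u g &
     forall j, exists g', is_weak_partial j g g'].

(* Closure of the test functions for the norm of H^1. *)
Definition H10 : set H :=
  [set u | exists (phi : nat -> E -> R) (g : 'I_d -> H),
     [/\ forall n, test_function D (phi n),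
         (\int[lebesgueD D]_x (((phi n x - u x) ^+ 2)%:E))%E @[n --> \oo]
           --> 0%E &
         forall i, (\int[lebesgueD D]_x (((partial i (phi n) x - g i x) ^+ 2)%:E))%E
           @[n --> \oo] --> 0%E]].

(* v = Lambda u = div(a grad u), for u in D(Lambda), in the sense of weak
   divergence. *)
Definition is_Lambda (a : E -> R) (u v : H) : Prop :=
  [/\ H2 u, H10 u &
      forall phi, test_function D phi ->
        \int[lebesgueD D]_x (v x * phi x) =
        - \int[lebesgueD D]_x
            (a x * \sum_(i < d) weak_partial i u x * partial i phi x)].

(* Eigensystem of Lambda, numbered from 0. *)
Definition eigensystem (a : E -> R) (e : nat -> H) (lam : nat -> R) : Prop :=
  [/\ complete_orthonormal e,
      forall m, is_Lambda a (e m) (- lam m *: e m),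
      0 < lam 0%N,
      {homo lam : m n / (m <= n)%N >-> m <= n} &
      exists2 c : R, 0 < c &
        (m.+1%:R `^ (- 2 / d%:R) * lam m) @[m --> \oo] --> c].

Definition energy (a : E -> R) (u v : H) : R :=
  \int[lebesgueD D]_x
    (a x * \sum_(i < d) weak_partial i u x * weak_partial i v x).

Definition Lambda_h (a : E -> R) (V : set H) (u : H) : H :=
  xget 0 [set w | V w /\ forall v, V v -> dot w v = - energy a u v].

(* Eigensystem of Lambda_h, numbered from 0; only the indices m < N matter, and
   N = dim V. *)
Definition discrete_eigensystem (a : E -> R) (V : set H) (N : nat)
    (e : nat -> H) (lam : nat -> R) : Prop :=
  [/\ forall m, (m < N)%N -> V (e m),
      forall m n, (m < N)%N -> (n < N)%N -> dot (e m) (e n) = (m == n)%:R,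
      forall u, V u -> eqH u (\sum_(m < N) dot u (e m) *: e m),
      forall m, (m < N)%N -> eqH (Lambda_h a V (e m)) (- lam m *: e m) &
      (forall m, (m < N)%N -> 0 < lam m) /\
      (forall m n, (m <= n)%N -> (n < N)%N -> lam m <= lam n)].

End sobolev.

(* The rows of K are the vertices of a simplex. *)
Definition barycentric (w : 'rV[R]_d.+1) : Prop :=
  (forall i, 0 <= w 0 i) /\ \sum_i w 0 i = 1.

Definition simplex (K : 'M[R]_(d.+1, d)) : set E :=
  [set w *m K | w in barycentric].

Definition nondegenerate (K : 'M[R]_(d.+1, d)) : Prop :=
  row_free (\matrix_(i < d) (row (lift ord0 i) K - row ord0 K)).

(* Convex hull of the vertices that K and K' share. *)
Definition common_face (K K' : 'M[R]_(d.+1, d)) : set E :=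
  [set w *m K | w in [set w | barycentric w /\
     forall i, w 0 i != 0 -> exists j, row i K = row j K']].

Definition triangulation (D : set E) (T : seq 'M[R]_(d.+1, d)) : Prop :=
  [/\ forall K, K \in T -> nondegenerate K,
      \bigcup_(K in [set` T]) simplex K = closure D &
      forall K K', K \in T -> K' \in T ->
        simplex K `&` simplex K' = common_face K K'].

Definition quasi_uniform (T : R -> seq 'M[R]_(d.+1, d)) : Prop :=
  exists2 rho : R, 0 < rho &
    forall (h : R) K, 0 < h <= 1 -> K \in T h ->
      (forall x y, simplex K x -> simplex K y -> euclid_norm (x - y) <= h) /\
      (exists x, [set y | euclid_norm (y - x) <= rho * h] `<=` simplex K).

Definition fe_function (D : set E) (T : seq 'M[R]_(d.+1, d)) (f : E -> R) : Prop :=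
  [/\ {within closure D, continuous f},
      forall K, K \in T -> exists (g : E) (c : R),
        forall x, simplex K x -> f x = euclid_dot g x + c &
      forall x, (closure D `\` D) x -> f x = 0].

Definition fe_space (D : set E) (T : seq 'M[R]_(d.+1, d)) : set (L2 D) :=
  [set u | exists2 f, fe_function D T f &
     {ae lebesgueD D, forall x, u x = f x}].

End domain.

Arguments fe_space {R d} D T.

Section standing_assumption.
Context {R : realType} {d : nat} {D : set 'rV[R]_d}.
Local Notation H := (L2 D).
Variables (e : nat -> H) (lam : nat -> R).
Variables (V : R -> set H) (N : R -> nat) (eh : R -> nat -> H).
Variable (lamh : R -> nat -> R).

Definition discrete_pow (h al : R) : H -> H :=
  fcalc (N h) (lamh h) (eh h) (fun z => (- z) `^ al).

Definition norm_equivalence : Prop :=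
  forall al : R, - (1 / 2) <= al <= 1 / 2 -> exists2 C : R, 0 < C &
    forall h : R, 0 < h <= 1 ->
      (forall u, V h u ->
        [/\ frac_dom e lam al u,
            C^-1 * hnorm (discrete_pow h al u) <= hnorm (frac_pow e lam al u) &
            hnorm (frac_pow e lam al u) <= C * hnorm (discrete_pow h al u)]) /\
      (forall u, frac_dom e lam al u ->
        hnorm (discrete_pow h al (hproj (V h) u)) <=
        C * hnorm (frac_pow e lam al u)).

Definition projection_error : Prop :=
  forall al1 al2 : R, 0 <= al1 <= 1 -> al1 <= al2 <= 2 ->
    exists2 C : R, 0 < C & forall h : R, 0 < h <= 1 -> forall u,
      let v := frac_pow e lam (- (al2 / 2)) u in
      frac_dom e lam (al1 / 2) (v - hproj (V h) v) /\
      hnorm (frac_pow e lam (al1 / 2) (v - hproj (V h) v)) <=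
      C * h `^ (al2 - al1) * hnorm u.

End standing_assumption.

Section probability.
Context {R : realType} {dO : measure_display} {O : measurableType dO}.
Variable P : probability O R.

Definition usual_filtration (Filt : R -> set_system O) : Prop :=
  [/\ forall t : R, 0 <= t -> sigma_algebra setT (Filt t) /\ Filt t `<=` measurable,
      forall s t : R, 0 <= s -> s <= t -> Filt s `<=` Filt t,
      forall t : R, 0 <= t -> Filt t = \bigcap_(s in [set s | t < s]) Filt s &
      forall A, P.-negligible A -> Filt 0 A].

Definition adapted (Filt : R -> set_system O) (X : R -> O -> R) : Prop :=
  forall t : R, 0 <= t -> forall B, measurable B -> Filt t (X t @^-1` B).

Definition increment (b : R -> O -> R) (s t : R) (w : O) : R := b t w - b s w.

(* The second parameter of [normal_prob] is the standard deviation. *)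
Definition standard_wiener (Filt : R -> set_system O) (b : R -> O -> R) : Prop :=
  [/\ {ae P, forall w, b 0 w = 0},
      {ae P, forall w, {within `[0, +oo[, continuous (b ^~ w)}},
      adapted Filt b,
      forall s t : R, 0 <= s -> s < t -> forall B, measurable B ->
        P (increment b s t @^-1` B) =
        normal_prob 0 (Num.sqrt (t - s)) B &
      forall s t : R, 0 <= s -> s < t -> forall A B, Filt s A -> measurable B ->
        P (A `&` increment b s t @^-1` B) =
        (P A * P (increment b s t @^-1` B))%E].

Definition process_sigma (X : R -> O -> R) : set_system O :=
  <<s [set A | exists t B, [/\ 0 <= t, measurable B & A = X t @^-1` B] ] >>.

Definition independent_processes (X : nat -> R -> O -> R) : Prop :=
  forall (J : seq nat) (A : nat -> set O), uniq J ->
    (forall j, j \in J -> process_sigma (X j) (A j)) ->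
    P (\big[setI/setT]_(j <- J) A j) = (\prod_(j <- J) P (A j))%E.

End probability.

Section spde.
Context {R : realType} {d : nat} {D : set 'rV[R]_d}.
Context {dO : measure_display} {O : measurableType dO}.
Local Notation H := (L2 D).
Variables (P : probability O R) (Filt : R -> set_system O).
Variables (V : set H) (N : nat) (e : nat -> H) (lam : nat -> R).

Definition V_random_variable (X : O -> H) : Prop :=
  (forall w, V (X w)) /\
  (forall v, measurable_fun setT (fun w => dot (X w) v)).

Definition L2_cvg (X : nat -> O -> H) (Y : O -> H) : Prop :=
  'E_P[fun w => (hnorm (X n w - Y w) ^+ 2)%R]%E @[n --> \oo] --> 0%E.

(* W = P_h W^Q.  The series of W^Q itself need not converge in H (Q is not
   assumed to be trace class), but that of its projection does. *)
Definition projected_noise (eps : nat -> H) (q : nat -> R)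
    (beta : nat -> R -> O -> R) (W : R -> O -> H) : Prop :=
  forall t : R, 0 <= t -> V_random_variable (W t) /\
    L2_cvg (fun n w => \sum_(m < n) (Num.sqrt (q m) * beta m t w) *:
                         hproj V (eps m)) (W t).

(* I = \int_0^t G(r) dW(r).  The integrands below are deterministic and
   continuous in r, so this is the mean square limit of Riemann sums. *)
Definition is_stochastic_integral (W : R -> O -> H) (t : R) (G : R -> H -> H)
    (I : O -> H) : Prop :=
  V_random_variable I /\
  L2_cvg (fun n w => \sum_(i < n)
    G (i%:R / n%:R * t) (W (i.+1%:R / n%:R * t) w - W (i%:R / n%:R * t) w)) I.

(* \int_0^t f(r) dr for V-valued f, coordinatewise in the basis e. *)
Definition time_integral (t : R) (f : R -> H) : H :=
  \sum_(m < N) (\int[lebesgue_measure]_(r in `[0, t]) dot (f r) (e m)) *: e m.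

Definition semigroup (t : R) : H -> H := fcalc N lam e (fun z => expR (t * z)).

Definition mild_solution (F : H -> H) (sigma : R) (W : R -> O -> H) (u0 : H)
    (u : R -> O -> H) : Prop :=
  [/\ forall t w, 0 <= t -> V (u t w),
      forall v, adapted Filt (fun t w => dot (u t w) v),
      {ae P, forall w, forall v,
        {within `[0, +oo[, continuous (fun t => dot (u t w) v)}} &
      forall t : R, 0 <= t -> exists2 I : O -> H,
        is_stochastic_integral W t (fun r => semigroup (t - r)) I &
        {ae P, forall w, eqH (u t w)
          (semigroup t (hproj V u0)
           + time_integral t (fun r => semigroup (t - r) (hproj V (F (u r w))))
           + sigma *: I w)}].

(* Ah and Bh stand for A_s(tau Lambda_h) and B_s(tau Lambda_h). *)
Fixpoint scheme (F : H -> H) (sigma : R) (W : R -> O -> H) (u0 : H)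
    (tau : R) (Ah Bh : H -> H) (n : nat) (w : O) : H :=
  match n with
  | 0%N => hproj V u0
  | k.+1 => let u := scheme F sigma W u0 tau Ah Bh k w in
      Ah u + Bh (tau *: hproj V (F u)
                 + sigma *: (W (k.+1%:R * tau) w - W (k%:R * tau) w))
  end.

End spde.

(* Holomorphic except at isolated poles; the value of f at a pole is
   arbitrary. *)
Definition meromorphic (K : numClosedFieldType) (f : K -> K) : Prop :=
  forall z0 : K, (\forall z \near z0^', derivable f z 1) /\
    (derivable f z0 1 \/ `|f z| @[z --> z0^'] --> +oo).

Definition complex_derive (K : numClosedFieldType) (f : K -> K) (z l : K) : Prop :=
  is_derive z 1 f l.

Section integrator.
Context {R : realType}.
Implicit Types (f : R[i] -> R[i]) (A B : nat -> R[i] -> R[i]) (L : nat -> \bar R).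
Local Open Scope complex_scope.
Local Notation cabs := ComplexField.Normc.normc.

Definition stability_interval (L : \bar R) : set R :=
  [set z | (- L <= z%:E)%E /\ z <= 0].

Definition restrict_real f (z : R) : R := complex.Re (f z%:C).

Definition admissible_integrator A B L : Prop :=
  [/\ forall s, (1 <= s)%N -> [/\ (0 < L s)%E,
        meromorphic (A s), meromorphic (B s) &
        forall z, stability_interval (L s) z ->
          complex.Im (A s z%:C) = 0 /\ complex.Im (B s z%:C) = 0],
      forall s, (1 <= s)%N ->
        [/\ A s 0 = 1, complex_derive (A s) 0 1 & B s 0 = 1],
      (ereal_sup [set x | exists s z, [/\ (1 <= s)%N, stability_interval (L s) z &
         x = ((1 + `|z|) * cabs (B s z%:C) ^+ 2)%:E]] < +oo)%E,
      forall delta : R, 0 < delta <= 1 ->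
        (ereal_sup [set x | exists s z, [/\ (1 <= s)%N,
           stability_interval (L s) z, (z <= - delta)%R &
           x = (cabs (A s z%:C))%:E]] < 1)%E &
      exists2 delta : R, 0 < delta <= 1 &
        (ereal_sup [set x | exists s (z : R[i]), [/\ (1 <= s)%N, (cabs z < delta)%R &
           x = (cabs (A s z) + cabs (B s z))%:E]] < +oo)%E].

End integrator.

(* Main.v *)
(* In the eigenbasis of the discrete operator the integrator acts through the scalars
   a = A_s(-x) and b = B_s(-x), x = tau lambda.  Cauchy's formula on a fixed disc turns
   the uniform bound on A_s, B_s near 0 into |a - (1 - x)| <= M x^2 and |b - 1| <= M x,
   uniformly in s; away from 0 one has |a| <= rho < 1 and b^2 (1 + x) <= M.  This gives
   |exp(-k x) - a^k| <= C / k and bounds the squared L^2(0, k tau) norm of the kernel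
   exp(-(k tau - r) lambda) - a^(k-1-floor(r/tau)) b by C min(tau, 1/lambda), hence by
   C tau^be lambda^(be-1) for every be in [0,1].  If the noise is regular with exponent
   be in (al, alphabar), Ito's isometry absorbs the factor lambda^(be-1), so that the
   stochastic convolution error is O(tau^(be/2)).  The drift error is controlled by the
   same kernel estimate, by the mean square time increments of u^h and by a discrete
   Gronwall inequality, while the linear part contributes |u_0|/n <= |u_0| n^(-al/2).
   Wiener and Lebesgue integrals are both handled as limits of Riemann sums: every
   estimate is made on a grid and passed to the limit with Fatou's lemma. *)
Require Import Defs.
From HB Require Import structures.
From mathcomp Require Import all_boot all_order all_algebra complex.
From mathcomp Require Import all_classical all_reals all_analysis.
From mathcomp Require Import measurable_realfun.
From mathcomp Require Import ring lra.
From mathcomp Require Import zify.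

Set Implicit Arguments.
Unset Strict Implicit.
Unset Printing Implicit Defensive.

Import Order.TTheory GRing.Theory Num.Theory.
Import numFieldNormedType.Exports.

Local Open Scope classical_set_scope.
Local Open Scope ring_scope.

(** * Riemann integrals and Cauchy's formula *)

(** The integrator hypotheses bound near 0 only the values of A_s and B_s, and there the functions
    are known to be complex derivable point by point. Their Taylor remainders therefore come from
    Goursat and Cauchy, with constants that depend on the radius and the bound alone. Square
    contours suffice, and only real parts of integrals are formed: a rotation makes the relevant
    integral real, and the lower bound 4 replaces 2 pi. A mild solution is adapted with continuous
    coordinates, but finite second moments are not part of its definition. They are gained by
    truncating to paths that are bounded on a countable time grid, iterating the mild formula under
    an exponential weight, and removing the truncation. The constants are uniform in h because
    assumption (i), at the exponent (be - 1) / 2, bounds the weighted noise coefficients by a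
    multiple of the squared Hilbert-Schmidt norm. The exponent be exceeds al strictly since the
    supremum alphabar need not be attained. A nonsmooth initial value x costs |x| / (k + 1) in the
    increments of the path during step k; the squares are summable, so it enters the drift error
    only as |x|^2 tau. *)

Section interval_integral.
Context {R : realType}.
Implicit Types (f g : R -> R) (a b m : R).

Definition iint a b f : R := \int[lebesgue_measure]_(x in `[a, b]) f x.

Local Notation cont a b f := {within `[a, b], continuous (f : R -> R)}.

Lemma cont_integrable a b f : cont a b f ->
  (@lebesgue_measure R).-integrable `[a, b] (EFin \o f).
Proof. by move=> cf; apply: continuous_compact_integrable => //; exact: segment_compact. Qed.

Lemma iintB a b f g : cont a b f -> cont a b g ->
  iint a b (fun x => f x - g x) = iint a b f - iint a b g.
Proof. by move=> cf cg; apply: RintegralB => //; exact: cont_integrable. Qed.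

Lemma iint_cst a b (c : R) : a <= b -> iint a b (fun=> c) = c * (b - a).
Proof.
move=> ab; rewrite /iint Rintegral_cst//= lebesgue_measure_itv/= lte_fin.
rewrite le_eqVlt in ab; case/orP: ab => [/eqP->|->//]; by rewrite ltxx subrr.
Qed.

Lemma le_iint a b f g : cont a b f -> cont a b g ->
  (forall x, a <= x <= b -> f x <= g x) -> iint a b f <= iint a b g.
Proof.
by move=> cf cg fg; apply: le_Rintegral => //; exact: cont_integrable.
Qed.

Lemma eq_iint a b f g : (forall x, a <= x <= b -> f x = g x) ->
  iint a b f = iint a b g.
Proof.
by move=> fg; apply: eq_Rintegral => x; rewrite inE/= in_itv/=; exact: fg.
Qed.

Lemma cont_cst a b (c : R) : cont a b (fun=> c).
Proof. by move=> x; exact: cvg_cst. Qed.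

Lemma iint_bound a b f (B : R) : a <= b -> cont a b f ->
  (forall x, a <= x <= b -> `|f x| <= B) -> `|iint a b f| <= B * (b - a).
Proof.
move=> ab cf fB; rewrite ler_norml -mulNr -!iint_cst//; apply/andP; split;
  apply: le_iint => //; try exact: cont_cst.
  by move=> x /fB; rewrite ler_norml => /andP[].
by move=> x /fB; rewrite ler_norml => /andP[].
Qed.

Lemma iint_split a m b f : a <= m -> m <= b -> cont a b f ->
  iint a b f = iint a m f + iint m b f.
Proof.
move=> am mb cf; have If := cont_integrable cf.
apply/eqP; rewrite addrC -subr_eq /iint; apply/eqP.
rewrite Rintegral_itvB// ?bnd_simp// Rintegral_itv_obnd_cbnd//.
apply: integrableS If => //=; apply: subset_itvr.
by rewrite bnd_simp.
Qed.

Lemma sub_cont a b f (a' b' : R) : a <= a' -> b' <= b -> cont a b f -> cont a' b' f.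
Proof.
move=> aa bb; apply: continuous_subspaceW => x /=; rewrite !in_itv/= => /andP[? ?].
by apply/andP; split; lra.
Qed.

Lemma pt_cont a b f :
  (forall x, a <= x <= b -> forall e, 0 < e ->
     exists2 r, 0 < r & forall y, `|y - x| < r -> `|f y - f x| < e) ->
  cont a b f.
Proof.
move=> H; apply: continuous_in_subspaceT => x; rewrite inE/= in_itv/= => /H {}H.
apply/cvgrPdist_lt => e /H[r r0 rP]; near=> y.
rewrite distrC; apply: rP; rewrite distrC; near: y.
by apply: cvgr_dist_lt.
Unshelve. all: by end_near.
Qed.

End interval_integral.

(** [K] is viewed as a normed space over itself, so derivability in the direction 1 is complex
    differentiability. *)
Definition cderivable (K : numClosedFieldType) (f : K -> K) (z : K) : Prop := derivable f z 1.

Definition cderiv (K : numClosedFieldType) (f : K -> K) (z : K) : K := 'D_1 f z.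

Lemma cderivable_ball (K : numClosedFieldType) (f : K -> K) (z : K) : cderivable f z ->
  forall e : K, 0 < e -> exists2 r : K, 0 < r &
    forall h : K, `|h| < r -> h != 0 -> `|cderiv f z - h^-1 * (f (h + z) - f z)| < e.
Proof.
move=> df e e0; have : h^-1 *: (f (h *: 1 + z) - f z) @[h --> (0 : K)^'] --> cderiv f z by exact: df.
move/cvgrPdist_lt => /(_ _ e0) [r /= r0 H]; exists r => // h hr h0.
have := H h; rewrite /ball_ /= sub0r normrN => /(_ hr h0).
by rewrite /GRing.scale /= mulr1.
Qed.

Section cderivable_rules.
Variable K : numClosedFieldType.
Implicit Types (f g : K -> K) (z : K).

Lemma cderivable_cst (k : K) z : cderivable (fun=> k) z.
Proof. exact: derivable_cst. Qed.

Lemma cderivable_id z : cderivable (fun z => z) z.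
Proof. exact: derivable_id. Qed.

Lemma cderivableD f g z : cderivable f z -> cderivable g z -> cderivable (fun z => f z + g z) z.
Proof. exact: derivableD. Qed.

Lemma cderivableB f g z : cderivable f z -> cderivable g z -> cderivable (fun z => f z - g z) z.
Proof. exact: derivableB. Qed.

Lemma cderivableM f g z : cderivable f z -> cderivable g z -> cderivable (fun z => f z * g z) z.
Proof. exact: derivableM. Qed.

Lemma cderivableV f z : f z != 0 -> cderivable f z -> cderivable (fun z => (f z)^-1) z.
Proof. exact: derivableV. Qed.

End cderivable_rules.

(** * Complex functions in the l^1 norm and their rectangle integrals *)

Section complex_l1.
Context {R : realType}.
Local Notation C := R[i].
Local Notation normc := ComplexField.Normc.normc.
Implicit Types (z w : C) (f g : C -> C).

(* An l^1 norm is used instead of the modulus so that estimates stay polynomial in the coordinates. *)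
Definition n1 z : R := `|complex.Re z| + `|complex.Im z|.

Lemma n1_ge0 z : 0 <= n1 z. Proof. by rewrite addr_ge0. Qed.

Lemma n1D z w : n1 (z + w) <= n1 z + n1 w.
Proof.
case: z w => [a b] [c d]; rewrite /n1 /=.
by have := ler_normD a c; have := ler_normD b d; lra.
Qed.

Lemma n1N z : n1 (- z) = n1 z.
Proof. by case: z => a b; rewrite /n1 /= !normrN. Qed.

Lemma n1B z w : n1 (z - w) <= n1 z + n1 w.
Proof. by rewrite -(n1N w); exact: n1D. Qed.

Lemma n1M z w : n1 (z * w) <= n1 z * n1 w.
Proof.
case: z w => [a b] [c d]; rewrite /n1 /=.
have := ler_normB (a * c) (b * d); have := ler_normD (a * d) (b * c).
by rewrite !normrM; nra.
Qed.

Lemma n1_0 : n1 0 = 0. Proof. by rewrite /n1 /= normr0 addr0. Qed.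

Lemma n1_eq0 z : (n1 z == 0) = (z == 0).
Proof.
case: z => a b; rewrite /n1 /= paddr_eq0// !normr_eq0.
by rewrite eq_complex.
Qed.

Lemma n1_gt0 z : (0 < n1 z) = (z != 0).
Proof. by rewrite lt_def n1_ge0 andbT n1_eq0. Qed.

Lemma normc_sqr z : normc z ^+ 2 = complex.Re z ^+ 2 + complex.Im z ^+ 2.
Proof. by case: z => a b; rewrite /= sqr_sqrtr// addr_ge0// sqr_ge0. Qed.

Lemma sqrt_normc z : Num.sqrt (complex.Re z ^+ 2 + complex.Im z ^+ 2) = normc z.
Proof. by case: z. Qed.

Lemma normc_ge0 z : 0 <= normc z.
Proof. by case: z => a b; exact: sqrtr_ge0. Qed.

Lemma normc_le_n1 z : normc z <= n1 z.
Proof.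
rewrite -(@ler_pXn2r _ 2)// ?nnegrE ?normc_ge0 ?n1_ge0// normc_sqr /n1.
rewrite -(real_normK (num_real (complex.Re z))) -(real_normK (num_real (complex.Im z))).
by have := normr_ge0 (complex.Re z); have := normr_ge0 (complex.Im z); nra.
Qed.

Lemma n1_le_normc z : n1 z <= 2 * normc z.
Proof.
rewrite -(@ler_pXn2r _ 2)// ?nnegrE ?n1_ge0 ?mulr_ge0 ?normc_ge0//.
rewrite exprMn normc_sqr /n1.
rewrite -(real_normK (num_real (complex.Re z))) -(real_normK (num_real (complex.Im z))).
by have := normr_ge0 (complex.Re z); have := normr_ge0 (complex.Im z); nra.
Qed.

(** [n1] is at most twice the modulus; used for z and for its inverse, this gives the 4, here and in
    [n1_le_div]. *)
Lemma n1V z : z != 0 -> n1 z^-1 <= 4 / n1 z.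
Proof.
move=> z0; rewrite ler_pdivlMr ?n1_gt0//.
have := n1_le_normc z; have := n1_le_normc z^-1.
rewrite ComplexField.Normc.normcV => h1 h2.
apply: (@le_trans _ _ ((2 * (normc z)^-1) * (2 * normc z))).
  by apply: ler_pM => //; exact: n1_ge0.
have : normc z != 0 by apply: contra z0 => /eqP/ComplexField.Normc.eq0_normc/eqP.
by move=> nz; rewrite mulrACA mulVf// mulr1; lra.
Qed.

Lemma n1_le_div z w (A r : R) : n1 z <= A -> 0 < r -> r <= n1 w -> n1 (z / w) <= 4 * A / r.
Proof.
move=> zA r0 rw; have w0 : w != 0 by rewrite -n1_gt0; lra.
apply: (le_trans (n1M _ _)); rewrite (mulrC 4) -mulrA; apply: ler_pM => //; rewrite ?n1_ge0//.
apply: (le_trans (n1V w0)); rewrite ler_pM2l// lef_pV2// posrE; lra.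
Qed.

(** Increment form of differentiability: free of division, it also covers [w = z]. *)
Lemma cderivable_n1 f z : cderivable f z ->
  forall e : R, 0 < e -> exists2 r : R, 0 < r &
    forall w, n1 (w - z) < r -> n1 (f w - f z - cderiv f z * (w - z)) <= e * n1 (w - z).
Proof.
move=> /cderivable_ball H e e0; set l := cderiv f z in H *.
have [|r r0 {}H] := H ((e / 2)%:C)%C.
  by rewrite ltcR divr_gt0.
have r_re : r = ((complex.Re r)%:C)%C.
  by move: r0; case: (r) => a b; rewrite ltcE /= => /andP[/eqP -> _].
have rr0 : 0 < complex.Re r by move: r0; rewrite r_re ltcR.
exists (complex.Re r) => // w wr.
have [->|wz] := eqVneq w z; first by rewrite !subrr mulr0 subrr n1_0 mulr0.
have wz0 : w - z != 0 by rewrite subr_eq0.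
have := H (w - z) _ wz0.
rewrite !normc_def r_re !ltcR subrK => /(_ _)/ltW lw.
have -> : f w - f z - l * (w - z) = - ((l - (w - z)^-1 * (f w - f z)) * (w - z)).
  by field.
rewrite n1N; apply: (le_trans (n1M _ _)); rewrite ler_wpM2r ?n1_ge0//.
apply: (le_trans (n1_le_normc _)).
have lw' := lw (le_lt_trans _ wr); rewrite !sqrt_normc in lw'.
by have := lw' (normc_le_n1 _); lra.
Qed.

Definition ccont f z := forall e : R, 0 < e -> exists2 r : R, 0 < r &
  forall w, n1 (w - z) < r -> n1 (f w - f z) < e.

Lemma cderivable_ccont f z : cderivable f z -> ccont f z.
Proof.
move=> /cderivable_n1/(_ 1 ltr01) [r r0 H] e e0; set l := cderiv f z in H.
have k0 : 0 < 1 + n1 l by have := n1_ge0 l; lra.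
exists (Num.min r (e / (1 + n1 l))); first by rewrite lt_min r0 divr_gt0.
move=> w; rewrite lt_min ltr_pdivlMr// => /andP[/H wr we].
rewrite -[f w - f z](subrK (l * (w - z))); apply: le_lt_trans we.
apply: (le_trans (n1D _ _)); have := n1M l (w - z); lra.
Qed.

Definition onh f (a b c : R) := forall x, a <= x <= b -> ccont f (x +i* c)%C.
Definition onv f (c d a : R) := forall y, c <= y <= d -> ccont f (a +i* y)%C.

Local Notation cont a b f := {within `[a, b], continuous (f : R -> R)}.

Lemma onh_cont f a b c : onh f a b c ->
  cont a b (fun x => complex.Re (f (x +i* c)%C)).
Proof.
move=> H; apply: pt_cont => x /H{}H e /H[r r0 {}H]; exists r => // y yx.
have := H (y +i* c)%C; rewrite /n1 /= subrr normr0 addr0 => /(_ yx).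
by case: (f _) => p q; case: (f _) => p' q' /=; have := normr_ge0 (q - q'); lra.
Qed.

Lemma onv_cont f c d a : onv f c d a ->
  cont c d (fun y => complex.Im (f (a +i* y)%C)).
Proof.
move=> H; apply: pt_cont => x /H{}H e /H[r r0 {}H]; exists r => // y yx.
have := H (a +i* y)%C; rewrite /n1 /= subrr normr0 add0r => /(_ yx).
by case: (f _) => p q; case: (f _) => p' q' /=; have := normr_ge0 (p - p'); lra.
Qed.

Lemma contB a b (f g : R -> R) : cont a b f -> cont a b g -> cont a b (fun x => f x - g x).
Proof. by move=> cf cg x; apply: cvgB; [exact: cf|exact: cg]. Qed.

(* Real part of the integral of f along the boundary of [a, b] + i [c, d]. *)
Definition rect_int f (a b c d : R) : R :=
  iint a b (fun x => complex.Re (f (x +i* c)%C) - complex.Re (f (x +i* d)%C))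
  - iint c d (fun y => complex.Im (f (b +i* y)%C) - complex.Im (f (a +i* y)%C)).

Definition bdry f a b c d := [/\ onh f a b c, onh f a b d, onv f c d a & onv f c d b].

Lemma rect_int_splith f a m b c d : a <= m -> m <= b ->
  bdry f a b c d -> onv f c d m ->
  rect_int f a b c d = rect_int f a m c d + rect_int f m b c d.
Proof.
move=> am mb [/onh_cont hc /onh_cont hd /onv_cont ha /onv_cont hb] /onv_cont hm.
rewrite /rect_int (iint_split am mb); last exact: contB.
rewrite !(iintB (a := c))//; ring.
Qed.

Lemma rect_int_splitv f a b c m d : c <= m -> m <= d ->
  bdry f a b c d -> onh f a b m ->
  rect_int f a b c d = rect_int f a b c m + rect_int f a b m d.
Proof.
move=> cm md [/onh_cont hc /onh_cont hd /onv_cont ha /onv_cont hb] /onh_cont hm.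
rewrite /rect_int (iint_split cm md); last exact: contB.
rewrite !(iintB (a := a))//; ring.
Qed.

Lemma rect_int_bound f a b c d (B : R) : a <= b -> c <= d -> bdry f a b c d ->
  (forall x, a <= x <= b -> n1 (f (x +i* c)%C) <= B /\ n1 (f (x +i* d)%C) <= B) ->
  (forall y, c <= y <= d -> n1 (f (a +i* y)%C) <= B /\ n1 (f (b +i* y)%C) <= B) ->
  `|rect_int f a b c d| <= 2 * B * ((b - a) + (d - c)).
Proof.
move=> ab cd [/onh_cont hc /onh_cont hd /onv_cont ha /onv_cont hb] Bh Bv.
rewrite /rect_int mulrDr; apply: (le_trans (ler_normB _ _)); apply: lerD.
  apply: iint_bound => //; first exact: contB.
  move=> x /Bh[]; rewrite /n1; case: (f _) => p q; case: (f _) => p' q' /=.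
  have := ler_normB p p'; have := normr_ge0 q; have := normr_ge0 q'; lra.
apply: iint_bound => //; first exact: contB.
move=> x /Bv[]; rewrite /n1; case: (f _) => p q; case: (f _) => p' q' /=.
have := ler_normB q' q; have := normr_ge0 p; have := normr_ge0 p'; lra.
Qed.

(** For an affine function the differences of opposite sides are constant and the two integrals
    cancel; this takes the place of a primitive in [goursat]. *)
Lemma rect_int_affine f (u v : C) a b c d : a <= b -> c <= d -> bdry f a b c d ->
  rect_int (fun z => f z - (u + v * z)) a b c d = rect_int f a b c d.
Proof.
move=> ab cd [/onh_cont hc /onh_cont hd /onv_cont ha /onv_cont hb].
case: u v => [u1 u2] [v1 v2]; rewrite /rect_int.
rewrite (@eq_iint _ a b _ (fun x => (complex.Re (f (x +i* c)%C) - complex.Re (f (x +i* d)%C))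
   - v2 * (d - c))); last first.
  by move=> x _; case: (f _) => p q; case: (f _) => p' q' /=; ring.
rewrite [X in _ - X](@eq_iint _ c d _ (fun y => (complex.Im (f (b +i* y)%C) - complex.Im (f (a +i* y)%C))
   - v2 * (b - a))); last first.
  by move=> x _; case: (f _) => p q; case: (f _) => p' q' /=; ring.
rewrite iintB; [|exact: contB|exact: cont_cst].
rewrite (iintB (a := c)); [|exact: contB|exact: cont_cst].
by rewrite !iint_cst//; ring.
Qed.

End complex_l1.

(** * Goursat's theorem on rectangles *)

Section goursat.
Context {R : realType}.
Local Notation C := R[i].
Local Notation normc := ComplexField.Normc.normc.
Implicit Types (z w : C) (f g : C -> C).

Definition holo_on f (a b c d : R) := forall x y, a <= x <= b -> c <= y <= d ->
  cderivable f (x +i* y)%C.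

Lemma holo_bdry f a b c d (a' b' c' d' : R) : holo_on f a b c d ->
  a <= a' -> a' <= b' -> b' <= b -> c <= c' -> c' <= d' -> d' <= d -> bdry f a' b' c' d'.
Proof.
move=> H aa ab bb cc cd dd; split=> t /andP[t1 t2]; apply: cderivable_ccont; apply: H; lra.
Qed.

(** The threshold is quadratic in the half-perimeter, so halving both sides divides it by 4 and one
    of the four quarters of a bad rectangle is bad again. *)
Definition bad_rect f e (Q : (R * R) * (R * R)) :=
  e * ((Q.1.2 - Q.1.1) + (Q.2.2 - Q.2.1)) ^+ 2 < `|rect_int f Q.1.1 Q.1.2 Q.2.1 Q.2.2|.

Definition sub_rect (Q' Q : (R * R) * (R * R)) :=
  [/\ Q.1.1 <= Q'.1.1, Q'.1.1 <= Q'.1.2, Q'.1.2 <= Q.1.2 &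
   [/\ Q.2.1 <= Q'.2.1, Q'.2.1 <= Q'.2.2 & Q'.2.2 <= Q.2.2]].

Lemma sub_rect_trans Q1 Q2 Q3 : sub_rect Q1 Q2 -> sub_rect Q2 Q3 -> sub_rect Q1 Q3.
Proof.
move=> [h1 h2 h3 [h4 h5 h6]] [k1 k2 k3 [k4 k5 k6]].
split; [exact: le_trans k1 h1|by []|exact: le_trans h3 k3|].
by split; [exact: le_trans k4 h4|by []|exact: le_trans h6 k6].
Qed.

Definition half_rect (Q' Q : (R * R) * (R * R)) :=
  Q'.1.2 - Q'.1.1 = (Q.1.2 - Q.1.1) / 2 /\ Q'.2.2 - Q'.2.1 = (Q.2.2 - Q.2.1) / 2.

Lemma bad_quarter f e (Q : (R * R) * (R * R)) :
  Q.1.1 <= Q.1.2 -> Q.2.1 <= Q.2.2 -> holo_on f Q.1.1 Q.1.2 Q.2.1 Q.2.2 -> bad_rect f e Q ->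
  exists Q', [/\ sub_rect Q' Q, half_rect Q' Q & bad_rect f e Q'].
Proof.
case: Q => [[a b] [c d]] /= ab cd H; rewrite /bad_rect /=.
set m := (a + b) / 2; set k := (c + d) / 2 => Hbad.
have am : a <= m by rewrite /m; lra.
have mb : m <= b by rewrite /m; lra.
have ck : c <= k by rewrite /k; lra.
have kd : k <= d by rewrite /k; lra.
have B := holo_bdry H.
have [_ _ _ vm] := B a m c d (lexx _) am mb (lexx _) cd (lexx _).
have [_ h1 _ _] := B a m c k (lexx _) am mb (lexx _) ck kd.
have [_ h2 _ _] := B m b c k am mb (lexx _) (lexx _) ck kd.
have Bam : bdry f a m c d by apply: B; lra.
have Bmb : bdry f m b c d by apply: B; lra.
have Bab : bdry f a b c d by apply: B; lra.
move: Hbad; rewrite (rect_int_splith am mb Bab vm).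
rewrite (rect_int_splitv ck kd Bam h1) (rect_int_splitv ck kd Bmb h2).
set q1 := rect_int f a m c k; set q2 := rect_int f a m k d.
set q3 := rect_int f m b c k; set q4 := rect_int f m b k d => Hbad.
set t := e * _ in Hbad.
have t4 : t / 4 = e * (((b - a) / 2) + ((d - c) / 2)) ^+ 2 by rewrite /t; field.
have : [\/ t / 4 < `|q1|, t / 4 < `|q2|, t / 4 < `|q3| | t / 4 < `|q4|].
  have := ler_normD (q1 + q2) (q3 + q4); have := ler_normD q1 q2; have := ler_normD q3 q4 => H3 H2 H1.
  case: (ltP (t / 4) `|q1|) => [|l1]; first by constructor 1.
  case: (ltP (t / 4) `|q2|) => [|l2]; first by constructor 2.
  case: (ltP (t / 4) `|q3|) => [|l3]; first by constructor 3.
  case: (ltP (t / 4) `|q4|) => [|l4]; first by constructor 4.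
  lra.
have e1 : m - a = (b - a) / 2 by rewrite /m; field.
have e2 : b - m = (b - a) / 2 by rewrite /m; field.
have e3 : k - c = (d - c) / 2 by rewrite /k; field.
have e4 : d - k = (d - c) / 2 by rewrite /k; field.
rewrite t4; case=> Hq; [exists ((a, m), (c, k))|exists ((a, m), (k, d))|
  exists ((m, b), (c, k))|exists ((m, b), (k, d))]; rewrite /half_rect /sub_rect /=;
 rewrite ?e1 ?e2 ?e3 ?e4; split => //; split => //; split; lra.
Qed.

Lemma half_pow_small (L e : R) : 0 < e -> exists n, L / 2 ^+ n < e.
Proof.
move=> e0; have [n Hn] : exists n, L / e < n%:R.
  exists (Num.bound `|L / e|); exact: le_lt_trans (ler_norm _) (archi_boundP (normr_ge0 _)).
exists n; rewrite ltr_pdivrMr ?exprn_gt0// mulrC -ltr_pdivrMr//; apply: lt_le_trans Hn _.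
by rewrite -natrX ler_nat ltnW// ltn_expl.
Qed.

(** Repeated quartering of a bad rectangle gives nested rectangles shrinking to a point. Near that
    point the function differs from an affine one by little compared with the diameter, and the
    affine part does not change the integral, so small rectangles around it cannot be bad. *)
Theorem goursat f a b c d : a <= b -> c <= d -> holo_on f a b c d -> rect_int f a b c d = 0.
Proof.
move=> ab cd H; apply/eqP; rewrite -normr_le0; apply/ler_addgt0Pr => e0 e0_gt0.
rewrite add0r leNgt; apply/negP => Hb.
pose p := (b - a) + (d - c).
(* The denominator [1 + p ^+ 2] ensures e p^2 < e0, which makes the initial rectangle bad. *)
pose e := e0 / (1 + p ^+ 2).
have p2 : 0 <= p ^+ 2 by rewrite sqr_ge0.
have e_gt0 : 0 < e by rewrite divr_gt0//; lra.
pose Q0 := ((a, b), (c, d)).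
have Hbad0 : bad_rect f e Q0.
  rewrite /bad_rect /=; apply: le_lt_trans Hb; rewrite -/p /e.
  by rewrite mulrAC ler_pdivrMr; [nra|lra].
(* The premises sit inside [P], so that the choice function is total and can be iterated. *)
pose P (Q Q' : (R * R) * (R * R)) := sub_rect Q Q0 -> bad_rect f e Q ->
  [/\ sub_rect Q' Q, half_rect Q' Q & bad_rect f e Q'].
have [F HF] : {F & forall Q, P Q (F Q)}.
  apply: choice => Q; have [[sQ bQ]|N] := pselect (sub_rect Q Q0 /\ bad_rect f e Q); last first.
    by exists Q => ? ?; case: N.
  case: (sQ) => /= h1 h2 h3 [h4 h5 h6].
  have [|Q' HQ'] := bad_quarter h2 h5 _ bQ; last by exists Q'.
  by move=> x y /andP[? ?] /andP[? ?]; apply: H; lra.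
pose S n := iter n F Q0.
have S0 : sub_rect Q0 Q0 by split => //; split.
have SP n : [/\ sub_rect (S n) Q0, bad_rect f e (S n) &
    (S n).1.2 - (S n).1.1 = (b - a) / 2 ^+ n /\ (S n).2.2 - (S n).2.1 = (d - c) / 2 ^+ n].
  elim: n => [|n [s1 s2 [s3 s4]]]; first by rewrite !expr0 !divr1.
  have [t1 [t2 t3] t4] := HF _ s1 s2; split => //; first exact: sub_rect_trans t1 s1.
  have n2 : (2 : R) ^+ n != 0 by rewrite expf_neq0.
  by rewrite /S /= in t2 t3 *; rewrite t2 t3 s3 s4 exprS; split; field.
have mono n m : (n <= m)%N -> sub_rect (S m) (S n).
  move=> /subnK <-; elim: (m - n)%N => [|k IH].
    by have [[h1 h2 h3 [h4 h5 h6]] _ _] := SP n; split => //; split.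
  rewrite addSn; apply: sub_rect_trans IH.
  by have [s1 s2 _] := SP (k + n)%N; have [] := HF _ s1 s2.
(* Lower left corners stay below all upper right corners, so their suprema lie in every
   rectangle. *)
pose x0 := sup (range (fun n => (S n).1.1)); pose y0 := sup (range (fun n => (S n).2.1)).
have cross n m : (S n).1.1 <= (S m).1.2 /\ (S n).2.1 <= (S m).2.2.
  have [h1 h2 h3 [h4 h5 h6]] := mono _ _ (leq_maxl n m).
  have [k1 k2 k3 [k4 k5 k6]] := mono _ _ (leq_maxr n m).
  by split; [exact: le_trans h1 (le_trans h2 k3)|exact: le_trans h4 (le_trans h5 k6)].
have hx n : (S n).1.1 <= x0 <= (S n).1.2.
  apply/andP; split.
    apply: sup_upper_bound; last by exists n.
    by split; [exists (S 0).1.1; exists 0%N|exists (S 0).1.2 => _ [m _ <-]; have [] := cross m 0%N].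
  by apply: ge_sup; [exists (S 0).1.1; exists 0%N|move=> _ [m _ <-]; have [] := cross m n].
have hy n : (S n).2.1 <= y0 <= (S n).2.2.
  apply/andP; split.
    apply: sup_upper_bound; last by exists n.
    by split; [exists (S 0).2.1; exists 0%N|exists (S 0).2.2 => _ [m _ <-]; have [] := cross m 0%N].
  by apply: ge_sup; [exists (S 0).2.1; exists 0%N|move=> _ [m _ <-]; have [] := cross m n].
have := H x0 y0 (hx 0%N) (hy 0%N).
(* The accuracy e / 2 offsets the factor 2 of [rect_int_bound]. *)
move=> /cderivable_n1/(_ (e / 2) (divr_gt0 e_gt0 (ltr0Sn _ 1)))[r r0 Hl].
set l := cderiv _ _ in Hl.
have [n Hn] := half_pow_small p r0.
have [[h1 h2 h3 [h4 h5 h6]] sbad [sx sy]] := SP n.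
have /andP[x1 x2] := hx n; have /andP[y1 y2] := hy n.
set z0 := (x0 +i* y0)%C in Hl.
have pn : p / 2 ^+ n = ((S n).1.2 - (S n).1.1) + ((S n).2.2 - (S n).2.1).
  by rewrite sx sy -mulrDl.
set pn' := p / 2 ^+ n in pn Hn.
have near x y : (S n).1.1 <= x <= (S n).1.2 -> (S n).2.1 <= y <= (S n).2.2 ->
   n1 (f (x +i* y)%C - ((f z0 - l * z0) + l * (x +i* y)%C)) <= e / 2 * pn'.
  move=> /andP[v1 v2] /andP[v3 v4].
  have zz : n1 ((x +i* y)%C - z0) <= pn'.
    by clear -x1 x2 y1 y2 pn h1 h2 v1 v2 v3 v4; rewrite pn /n1 /=; apply: lerD; rewrite ler_norml; apply/andP; split; lra.
  have := Hl (x +i* y)%C (le_lt_trans zz Hn).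
  rewrite (_ : f _ - (_ + _) = f (x +i* y)%C - f z0 - l * ((x +i* y)%C - z0)); last by ring.
  by move/le_trans; apply; rewrite ler_wpM2l// divr_ge0// ltW.
have ccf : bdry f (S n).1.1 (S n).1.2 (S n).2.1 (S n).2.2 by apply: (holo_bdry H).
move: sbad; rewrite /bad_rect -(rect_int_affine (f z0 - l * z0) l h2 h5 ccf).
rewrite -pn ltNge => /negP; apply.
have caff : bdry (fun z => f z - (f z0 - l * z0 + l * z)) (S n).1.1 (S n).1.2 (S n).2.1 (S n).2.2.
  have Haff : holo_on (fun z => f z - (f z0 - l * z0 + l * z)) a b c d.
    move=> x y hx' hy'; apply: cderivableB; first exact: H.
    apply: cderivableD; first exact: cderivable_cst.
    by apply: cderivableM; [exact: cderivable_cst|exact: cderivable_id].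
  exact: (holo_bdry Haff h1 h2 h3 h4 h5 h6).
apply: (le_trans (rect_int_bound h2 h5 caff (B := e / 2 * pn') _ _)).
- by move=> x ?; split; apply: near => //; apply/andP; split.
- by move=> y ?; split; apply: near => //; apply/andP; split.
- by rewrite -pn; nra.
Qed.

End goursat.

(** * Removable singularities and Cauchy's formula on a square *)

Section cauchy.
Context {R : realType}.
Local Notation C := R[i].
Local Notation normc := ComplexField.Normc.normc.
Implicit Types (z w : C) (f g : C -> C).

Lemma window_bounds (a b x s : R) : 0 < s -> s <= x - a -> s <= b - x ->
  [/\ [/\ a <= x - s, x - s < x, x < x + s, x + s <= b & x - s <= x + s], a <= x + s & x - s <= b].
Proof. by move=> s0 s1 s2; split; [split|..]; lra. Qed.

(** Goursat removes the strips left, right, below and above a small square of half-side s around the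
    point. On the boundary of that square f is o(1 / s), while the perimeter is O(s). *)
Lemma rect_int_sing f (a b c d x0 y0 : R) : a < x0 < b -> c < y0 < d ->
  (forall x y, a <= x <= b -> c <= y <= d -> [|| x < x0, x0 < x, y < y0 | y0 < y] ->
     cderivable f (x +i* y)%C) ->
  (forall e : R, 0 < e -> exists2 r : R, 0 < r & forall z, 0 < n1 (z - (x0 +i* y0)%C) < r ->
     n1 (z - (x0 +i* y0)%C) * n1 (f z) <= e) ->
  rect_int f a b c d = 0.
Proof.
move=> /andP[ax xb] /andP[cy yd] hd hs.
apply/eqP; rewrite -normr_le0; apply/ler_addgt0Pr => e0 e0_gt0; rewrite add0r.
(* The 8 is the 2 of [rect_int_bound] times the factor 4 in the half-perimeter 4 s. The bound r / 4
   on s below keeps the square at [n1] distance between s and 2 s < r from the point. *)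
have [r r0 Hr] := hs (e0 / 8) (divr_gt0 e0_gt0 (ltr0Sn _ _)).
pose s := Num.min (Num.min (x0 - a) (b - x0)) (Num.min (Num.min (y0 - c) (d - y0)) (r / 4)).
have : s <= s by [].
rewrite {2}/s !le_min => /andP[/andP[s1 s2] /andP[/andP[s3 s4] s5]].
have s0 : 0 < s by rewrite /s !lt_min !subr_gt0 ax xb cy yd /=; lra.
have [[axs p1 p2 xsb xx] axr xlb] := window_bounds s0 s1 s2.
have [[cys p3 p4 ysd yy] cyr yld] := window_bounds s0 s3 s4.
have bd (a' b' c' d' : R) : a <= a' -> b' <= b -> c <= c' -> d' <= d ->
    a' < x0 -> x0 < b' -> c' < y0 -> y0 < d' -> bdry f a' b' c' d'.
  move=> k1 k2 k3 k4 h1 h2 h3 h4.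
  have ax' : a <= a' <= b by rewrite k1 (le_trans (ltW (lt_trans h1 h2)) k2).
  have bx' : a <= b' <= b by rewrite k2 andbT (le_trans k1 (ltW (lt_trans h1 h2))).
  have cy' : c <= c' <= d by rewrite k3 (le_trans (ltW (lt_trans h3 h4)) k4).
  have dy' : c <= d' <= d by rewrite k4 andbT (le_trans k3 (ltW (lt_trans h3 h4))).
  have tx t : a' <= t <= b' -> a <= t <= b by case/andP=> t1 t2; rewrite (le_trans k1 t1) (le_trans t2 k2).
  have ty t : c' <= t <= d' -> c <= t <= d by case/andP=> t1 t2; rewrite (le_trans k3 t1) (le_trans t2 k4).
  split=> t ht; apply: cderivable_ccont; apply: hd; rewrite ?h1 ?h2 ?h3 ?h4 ?orbT//;
    by [exact: tx|exact: ty].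
have hl (a' b' c' d' : R) : a <= a' -> b' <= b -> c <= c' -> d' <= d ->
    [|| b' < x0, x0 < a', d' < y0 | y0 < c'] -> holo_on f a' b' c' d'.
  move=> k1 k2 k3 k4 out x y /andP[x1 x2] /andP[y1 y2]; apply: hd.
  - by rewrite (le_trans k1 x1) (le_trans x2 k2).
  - by rewrite (le_trans k3 y1) (le_trans y2 k4).
  case/or4P: out => h; apply/or4P.
  - by constructor 1; exact: le_lt_trans x2 h.
  - by constructor 2; exact: lt_le_trans h x1.
  - by constructor 3; exact: le_lt_trans y2 h.
  - by constructor 4; exact: lt_le_trans h y1.
have vc (t c' d' : R) : a <= t <= b -> c <= c' -> d' <= d -> (t < x0) || (x0 < t) -> onv f c' d' t.
  move=> tb k1 k2 /orP out y /andP[y1 y2]; apply: cderivable_ccont; apply: hd => //.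
    by rewrite (le_trans k1 y1) (le_trans y2 k2).
  by case: out => ->; rewrite ?orbT.
have hc (t a' b' : R) : c <= t <= d -> a <= a' -> b' <= b -> (t < y0) || (y0 < t) -> onh f a' b' t.
  move=> tb k1 k2 /orP out x /andP[x1 x2]; apply: cderivable_ccont; apply: hd => //.
    by rewrite (le_trans k1 x1) (le_trans x2 k2).
  by case: out => ->; rewrite ?orbT.
have cd : c <= d by exact: le_trans cyr ysd.
have xl : a <= x0 - s <= b by rewrite axs.
have xr : a <= x0 + s <= b by rewrite axr.
have yl : c <= y0 - s <= d by rewrite cys.
have yr : c <= y0 + s <= d by rewrite cyr.
rewrite (rect_int_splith axs xlb (bd _ _ _ _ (lexx _) (lexx _) (lexx _) (lexx _) ax xb cy yd)
  (vc _ _ _ xl (lexx _) (lexx _) _)); last by rewrite p1.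
rewrite (goursat axs cd (hl _ _ _ _ (lexx _) xlb (lexx _) (lexx _) _)); last by rewrite p1.
rewrite add0r (rect_int_splith xx xsb (bd _ _ _ _ axs (lexx _) (lexx _) (lexx _) p1 xb cy yd)
  (vc _ _ _ xr (lexx _) (lexx _) _)); last by rewrite p2 orbT.
rewrite (goursat xsb cd (hl _ _ _ _ axr (lexx _) (lexx _) (lexx _) _)); last by rewrite p2 orbT.
rewrite addr0 (rect_int_splitv cys yld (bd _ _ _ _ axs xsb (lexx _) (lexx _) p1 p2 cy yd)
  (hc _ _ _ yl axs xsb _)); last by rewrite p3.
rewrite (goursat xx cys (hl _ _ _ _ axs xsb (lexx _) yld _)); last by rewrite p3 !orbT.
rewrite add0r (rect_int_splitv yy ysd (bd _ _ _ _ axs xsb cys (lexx _) p1 p2 p3 yd)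
  (hc _ _ _ yr axs xsb _)); last by rewrite p4 orbT.
rewrite (goursat xx ysd (hl _ _ _ _ axs xsb cyr (lexx _) _)); last by rewrite p4 !orbT.
rewrite addr0.
have B4 := bd _ _ _ _ axs xsb cys ysd p1 p2 p3 p4.
have s2r : 2 * s < r by clear -s0 s5; lra.
clear bd hl vc hc hd hs.
have near z : s <= n1 (z - (x0 +i* y0)%C) -> n1 (z - (x0 +i* y0)%C) <= 2 * s -> n1 (f z) <= e0 / 8 / s.
  move=> z1 z2; rewrite ler_pdivlMr// mulrC.
  apply: (@le_trans _ _ (n1 (z - (x0 +i* y0)%C) * n1 (f z))); first by rewrite ler_wpM2r ?n1_ge0.
  by apply: Hr; rewrite (lt_le_trans s0 z1) (le_lt_trans z2 s2r).
apply: (le_trans (rect_int_bound xx yy B4 (B := e0 / 8 / s) _ _)).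
- move=> x /andP[v1 v2]; have hx : `|x - x0| <= s by rewrite ler_norml; clear -v1 v2; lra.
  have hx0 := normr_ge0 (x - x0).
  split; apply: near; rewrite /n1 /= addrAC subrr add0r ?normrN (gtr0_norm s0); clear -hx hx0 s0; lra.
- move=> x /andP[v1 v2]; have hx : `|x - y0| <= s by rewrite ler_norml; clear -v1 v2; lra.
  have hx0 := normr_ge0 (x - y0).
  split; apply: near; rewrite /n1 /= (addrAC x0) subrr add0r ?normrN (gtr0_norm s0); clear -hx hx0 s0; lra.
- rewrite le_eqVlt; apply/orP; left; apply/eqP; field; exact: lt0r_neq0.
Qed.

Lemma Re_div_im (m x y : R) : complex.Re ((0 +i* (- m)) / (x +i* y))%C = - m * y / (x ^+ 2 + y ^+ 2).
Proof. by rewrite /= mul0r sub0r; ring. Qed.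

Lemma Im_div_im (m x y : R) : complex.Im ((0 +i* (- m)) / (x +i* y))%C = - m * x / (x ^+ 2 + y ^+ 2).
Proof. by rewrite /= mul0r add0r; ring. Qed.

Lemma rect_intB f g a b c d : bdry f a b c d -> bdry g a b c d ->
  rect_int (fun z => f z - g z) a b c d = rect_int f a b c d - rect_int g a b c d.
Proof.
move=> [/onh_cont fc /onh_cont fd /onv_cont fa /onv_cont fb].
move=> [/onh_cont gc /onh_cont gd /onv_cont ga /onv_cont gb].
rewrite /rect_int.
rewrite (@eq_iint _ a b _ (fun x => (complex.Re (f (x +i* c)%C) - complex.Re (f (x +i* d)%C))
   - (complex.Re (g (x +i* c)%C) - complex.Re (g (x +i* d)%C)))); last first.
  by move=> x _; case: (f _) => p q; case: (f _) => p' q'; case: (g _) => r s; case: (g _) => r' s' /=; ring.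
rewrite [X in _ - X = _](@eq_iint _ c d _ (fun y => (complex.Im (f (b +i* y)%C) - complex.Im (f (a +i* y)%C))
   - (complex.Im (g (b +i* y)%C) - complex.Im (g (a +i* y)%C)))); last first.
  by move=> x _; case: (f _) => p q; case: (f _) => p' q'; case: (g _) => r s; case: (g _) => r' s' /=; ring.
rewrite iintB; [|exact: contB|exact: contB].
rewrite (iintB (a := c)); [|exact: contB|exact: contB].
by ring.
Qed.

(** The exact value is 2 pi m. Bounding the integrands below by constants gives 2 m for each pair of
    opposite sides and avoids the arctangent. *)
Lemma rect_int_inv (m r : R) : 0 < r -> 0 <= m ->
  bdry (fun z => (0 +i* (- m))%C / z) (- r) r (- r) r ->
  4 * m <= rect_int (fun z => (0 +i* (- m))%C / z) (- r) r (- r) r.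
Proof.
move=> r0 m0 [/onh_cont fc /onh_cont fd /onv_cont fa /onv_cont fb].
have rr : - r <= r by lra.
have key x : - r <= x <= r -> m / r <= 2 * (m * r / (x ^+ 2 + r ^+ 2)).
  move=> /andP[x1 x2]; have h1 : 0 < x ^+ 2 + r ^+ 2 by nra.
  have h2 : x ^+ 2 + r ^+ 2 <= 2 * r ^+ 2 by nra.
  rewrite mulrA ler_pdivlMr// mulrAC ler_pdivrMr//.
  by have := ler_wpM2l m0 h2; nra.
have H1 : m / r * (r - - r) <= iint (- r) r (fun x => complex.Re ((0 +i* (- m)) / (x +i* (- r)))%C - complex.Re ((0 +i* (- m)) / (x +i* r))%C).
  rewrite -iint_cst//; apply: le_iint => //; [exact: cont_cst|exact: contB|].
  by move=> x /key; rewrite !Re_div_im sqrrN; lra.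
have H2 : iint (- r) r (fun y => complex.Im ((0 +i* (- m)) / (r +i* y))%C - complex.Im ((0 +i* (- m)) / (- r +i* y))%C) <= - (m / r) * (r - - r).
  rewrite -iint_cst//; apply: le_iint => //; [exact: contB|exact: cont_cst|].
  by move=> y /key; rewrite !Im_div_im sqrrN (addrC (r ^+ 2)); lra.
rewrite /rect_int.
have e1 : m / r * (r - - r) = 2 * m by field; lra.
rewrite mulNr in H2; lra.
Qed.

End cauchy.

Section cauchy_formula.
Context {R : realType}.
Local Notation C := R[i].
Local Notation normc := ComplexField.Normc.normc.
Implicit Types (z w : C) (f g : C -> C).

(** The second exceptional point [w] is there because f will be a divided difference with a node at
    w. For a suitable k, the function (k f - k f0) / z has only removable singularities, so k f / z
    and k f0 / z have the same integral; the second is at least 4 |f0|^2 and the first at most 64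
    |f0| B. *)
Lemma cauchy_center f (f0 : C) (r w B : R) : 0 < r -> - r < w -> w < 0 ->
  (forall x y : R, - r <= x <= r -> - r <= y <= r -> (x +i* y)%C != 0 ->
     (x +i* y)%C != (w +i* 0)%C -> cderivable f (x +i* y)%C) ->
  (forall e : R, 0 < e -> exists2 s : R, 0 < s & forall z, 0 < n1 z < s -> n1 (f z - f0) <= e) ->
  (forall e : R, 0 < e -> exists2 s : R, 0 < s & forall z, 0 < n1 (z - (w +i* 0)%C) < s ->
     n1 (z - (w +i* 0)%C) * n1 (f z) <= e) ->
  (forall x y : R, - r <= x <= r -> - r <= y <= r -> (`|x| = r \/ `|y| = r) -> n1 (f (x +i* y)%C) <= B) ->
  normc f0 <= 16 * B.
Proof.
move=> r0 rw w0.
have [rr wr] : - r <= r /\ w < r by split; lra.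
have [[rw2 w2r ww2 w20] oN] : [/\ - r <= w / 2, w / 2 <= r, w < w / 2 & w / 2 < 0] /\ - r < 0.
  by split; [split|]; lra.
have eN : - r <= - r <= r by rewrite lexx.
have eP : - r <= r <= r by rewrite lexx andbT.
have sub_r (x : R) : - r <= x <= w / 2 -> - r <= x <= r by case/andP=> -> /le_trans; exact.
have sub_l (x : R) : w / 2 <= x <= r -> - r <= x <= r.
  by case/andP=> h ->; rewrite andbT; exact: le_trans rw2 h.
move=> hd h0 hw hB.
pose m := normc f0 ^+ 2.
have m0 : 0 <= m by rewrite sqr_ge0.
(* This is -i conj(f0): it turns k f0 into -i |f0|^2, whose quotient by z has a real nonnegative
   integral around 0. *)
pose k : C := (- complex.Im f0 +i* (- complex.Re f0))%C.
have kf0 : k * f0 = (0 +i* (- m))%C.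
  rewrite /k /m normc_sqr; case: (f0) => p q /=; apply/eqP; rewrite eq_complex /=.
  by apply/andP; split; apply/eqP; ring.
have nk : n1 k <= 2 * normc f0.
  by apply: le_trans (n1_le_normc _); rewrite /k /n1 /= !normrN addrC.
pose g1 z := k * f z / z; pose g2 z := (0 +i* (- m))%C / z.
have dg1 x y : - r <= x <= r -> - r <= y <= r -> (x +i* y)%C != 0 ->
     (x +i* y)%C != (w +i* 0)%C -> cderivable g1 (x +i* y)%C.
  move=> hx hy z0 zw; apply: cderivableM.
    by apply: cderivableM; [exact: cderivable_cst|exact: hd].
  by apply: cderivableV => //; exact: cderivable_id.
have dg2 x y : (x +i* y)%C != 0 -> cderivable g2 (x +i* y)%C.
  move=> z0; apply: cderivableM; first exact: cderivable_cst.
  by apply: cderivableV => //; exact: cderivable_id.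
pose p z := g1 z - g2 z.
have dp x y : - r <= x <= r -> - r <= y <= r -> (x +i* y)%C != 0 ->
     (x +i* y)%C != (w +i* 0)%C -> cderivable p (x +i* y)%C.
  by move=> hx hy z0 zw; apply: cderivableB; [exact: dg1|exact: dg2].
have neq0 (x y : R) : [|| x < 0, 0 < x, y < 0 | 0 < y] -> (x +i* y)%C != 0.
  by rewrite eq_complex /= negb_and !neq_lt -!orbA.
have neqw (x y : R) : [|| x < w, w < x, y < 0 | 0 < y] -> (x +i* y)%C != (w +i* 0)%C.
  by rewrite eq_complex /= negb_and !neq_lt -!orbA.
have bd1 : bdry g1 (- r) r (- r) r.
  by split=> t ht; apply: cderivable_ccont; (apply: dg1 => //; [apply: neq0|apply: neqw]);
    rewrite ?oN ?r0 ?rw ?wr ?orbT.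
have bd2 : bdry g2 (- r) r (- r) r.
  by split=> t ht; apply: cderivable_ccont; apply: dg2; apply: neq0; rewrite ?oN ?r0 ?orbT.
have p_sing : rect_int p (- r) r (- r) r = 0.
  have bdp : bdry p (- r) r (- r) r.
    by split=> t ht; apply: cderivable_ccont; (apply: dp => //; [apply: neq0|apply: neqw]);
      rewrite ?oN ?r0 ?rw ?wr ?orbT.
  (* The line Re z = w / 2 separates the two singular points, and [rect_int_sing] treats each
     half. *)
  have vp : onv p (- r) r (w / 2).
    move=> t ht; apply: cderivable_ccont; apply: dp => //; first by rewrite rw2.
      by apply: neq0; rewrite w20.
    by apply: neqw; rewrite ww2 orbT.
  have h_0 : - r < 0 < r by rewrite oN.
  rewrite (rect_int_splith rw2 w2r bdp vp).
  rewrite (@rect_int_sing _ p (- r) (w / 2) (- r) r w 0) ?rw ?add0r//; last 2 first.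
  - move=> x y hx hy hxy; apply: dp => //; [exact: sub_r| |exact: neqw].
    by apply: neq0; case/andP: hx => _ hx; rewrite (le_lt_trans hx w20).
  - move=> e e0; have K0 : 0 < 1 + n1 k by have := n1_ge0 k; lra.
    have w2 : 0 < - w / 2 by lra.
    have [|s s0 Hs] := hw (e * (- w / 2) / (8 * (1 + n1 k))).
      by apply: divr_gt0; apply: mulr_gt0.
    pose t := e * (- w / 2) / (8 * (1 + n1 (0 +i* (- m))%C)).
    have m1 : 0 < 1 + n1 (0 +i* (- m))%C by have := n1_ge0 (0 +i* (- m))%C; lra.
    have t0 : 0 < t by apply: divr_gt0; apply: mulr_gt0.
    exists (Num.min s (Num.min (- w / 2) t)); first by rewrite !lt_min s0 w2 t0.
    move=> z /andP[z0]; rewrite !lt_min => /andP[zs /andP[zw zt]].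
    have nz : - w / 2 <= n1 z.
      have := n1D z (- (z - (w +i* 0)%C)); rewrite n1N opprB addrCA subrr addr0.
      by rewrite [n1 (w +i* 0)%C]/n1 /= normr0 addr0 ltr0_norm//; lra.
    set u := z - _ in z0 zs zw zt *.
    have := Hs z; rewrite -/u z0 zs => /(_ isT) H1.
    apply: (@le_trans _ _ (n1 u * (4 * (n1 k * n1 (f z)) / (- w / 2) + 4 * n1 (0 +i* (- m))%C / (- w / 2)))).
      rewrite ler_wpM2l ?n1_ge0//; apply: (le_trans (n1B _ _)); apply: lerD.
        by apply: n1_le_div => //; exact: n1M.
      exact: n1_le_div.
    rewrite -mulrDl mulrA ler_pdivrMr// mulrDr.
    have H2 : n1 u * n1 (f z) * (8 * (1 + n1 k)) <= e * (- w / 2).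
      by rewrite -ler_pdivlMr// mulr_gt0.
    have H3 : n1 u * (8 * (1 + n1 (0 +i* (- m))%C)) <= e * (- w / 2).
      by rewrite -ler_pdivlMr ?mulr_gt0// ltW.
    have uf : 0 <= n1 u * n1 (f z) by rewrite mulr_ge0 ?n1_ge0.
    have := n1_ge0 u; move: H2 H3 uf; set A := n1 u * n1 (f z).
    rewrite [n1 u * (4 * (n1 k * n1 (f z)))](_ : _ = 4 * (A * n1 k)); last by rewrite /A; ring.
    by nra.
  rewrite (@rect_int_sing _ p (w / 2) r (- r) r 0 0) ?w20//.
  - move=> x y hx hy hxy; apply: dp => //; [exact: sub_l|exact: neq0|].
    by apply: neqw; case/andP: hx => hx _; rewrite (lt_le_trans ww2 hx) orbT.
  - move=> e e0; have K0 : 0 < 1 + n1 k by have := n1_ge0 k; lra.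
    have [|s s0 Hs] := h0 (e / (4 * (1 + n1 k))); first by apply: divr_gt0 => //; rewrite pmulr_rgt0.
    have -> : (0 +i* 0)%C = 0 :> C by [].
    exists s => // z; rewrite subr0 => /[dup]/Hs H1 /andP[z0 _].
    have z0' : z != 0 by rewrite -n1_gt0.
    have -> : p z = k * (f z - f0) / z by rewrite /p /g1 /g2 -kf0; field.
    have H2 := n1_le_div (n1M k (f z - f0)) z0 (lexx _).
    apply: (@le_trans _ _ (n1 z * (4 * (n1 k * n1 (f z - f0)) / n1 z))).
      by rewrite ler_wpM2l ?n1_ge0.
    rewrite mulrCA divff ?gt_eqF// mulr1.
    move: H1; rewrite ler_pdivlMr ?mulr_gt0//.
    by have := n1_ge0 (f z - f0); nra.
have H4 := rect_int_inv r0 m0 bd2.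
move: p_sing; rewrite rect_intB// => /eqP; rewrite subr_eq0 => /eqP E.
clear hw h0 hd dp dg1 dg2 neq0 neqw sub_r sub_l.
have B0 : 0 <= B.
  apply: le_trans (hB r r _ _ _); rewrite ?n1_ge0//; try lra.
  by left; rewrite gtr0_norm.
have edge x y : - r <= x <= r -> - r <= y <= r -> (`|x| = r \/ `|y| = r) ->
    n1 (g1 (x +i* y)%C) <= 4 * (2 * normc f0 * B) / r.
  move=> hx hy hxy; apply: n1_le_div => //.
    apply: (le_trans (n1M _ _)); apply: ler_pM; rewrite ?n1_ge0//; exact: hB.
  by rewrite /n1 /=; have := normr_ge0 x; have := normr_ge0 y; case: hxy => ->; lra.
have nr : `|r| = r by rewrite gtr0_norm.
have nNr : `|- r| = r by rewrite normrN.
have H5 : `|rect_int g1 (- r) r (- r) r| <= 2 * (4 * (2 * normc f0 * B) / r) * ((r - - r) + (r - - r)).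
  by apply: rect_int_bound => // t ht; split; apply: edge => //; rewrite ?nr ?nNr; auto.
have H6 : 4 * m <= 64 * (normc f0 * B).
  rewrite -E in H4; have := ler_norm (rect_int g1 (- r) r (- r) r).
  have -> : 64 * (normc f0 * B) = 2 * (4 * (2 * normc f0 * B) / r) * ((r - - r) + (r - - r)) by field; lra.
  lra.
have := normc_ge0 f0; rewrite le_eqVlt => /predU1P[<-|n0]; first lra.
by move: H6; rewrite /m expr2 mulrCA [64 * _]mulrCA ler_pM2l//; lra.
Qed.

End cauchy_formula.

(** * Taylor estimates at 0 with uniform constants *)

Section taylor.
Context {R : realType}.
Local Notation C := R[i].
Local Notation normc := ComplexField.Normc.normc.
Implicit Types (z w : C) (f g : C -> C).

(** At each point the definition of meromorphic leaves the alternative between derivability and a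
    pole; a bound nearby excludes the pole. *)
Lemma meromorphic_bounded (K : numClosedFieldType) (f : K -> K) (z0 r M : K) :
  meromorphic f -> 0 < r -> M \is Num.real -> (forall z : K, `|z - z0| < r -> `|f z| <= M) ->
  cderivable f z0.
Proof.
move=> mf r0 Mr fM; have [_ [//|foo]] := mf z0.
exfalso.
have h1 : \forall z \near z0^', M < `|f z|.
  by apply: (foo [set x | M < x]); exists M; split.
have h2 : \forall z \near z0^', `|z - z0| < r.
  by apply: cvg_within; exists r => //= z; rewrite /ball_ /= distrC.
have [z [Mz zr]] := @filter_ex _ _ (Proper_dnbhs_numFieldType z0) _ (filterI h1 h2).
by have := fM _ zr; move/(lt_le_trans Mz); rewrite ltxx.
Qed.

Variables (f : C -> C) (de M : R).
Hypotheses (de0 : 0 < de) (df : forall z, normc z < de -> cderivable f z)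
  (fM : forall z, normc z < de -> normc (f z) <= M).
Let r := de / 4.

Let r0 : 0 < r. Proof. by rewrite divr_gt0. Qed.

Let insq (x y : R) : - r <= x <= r -> - r <= y <= r -> normc (x +i* y)%C < de.
Proof.
move=> hx hy; apply: (le_lt_trans (normc_le_n1 _)); rewrite /n1 /=.
have h1 : `|x| <= r by rewrite ler_norml.
have h2 : `|y| <= r by rewrite ler_norml.
have := r0; rewrite (_ : de = 4 * r); last by rewrite /r; field.
lra.
Qed.

Let in0 : normc (0 : C) < de. Proof. by rewrite ComplexField.Normc.normc0. Qed.

Let M0 : 0 <= M. Proof. exact: le_trans (normc_ge0 _) (fM in0). Qed.

Let inw (w : R) : - (r / 2) < w < 0 -> normc (w +i* 0)%C < de.
Proof. by move=> hw; have hr := r0; apply: insq; lra. Qed.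

Let fdiff z z' : normc z < de -> normc z' < de -> n1 (f z - f z') <= 4 * M.
Proof.
move=> /fM hz /fM hz'; apply: (le_trans (n1B _ _)).
have := n1_le_normc (f z); have := n1_le_normc (f z'); lra.
Qed.

Let far (x y w : R) : - (r / 2) < w < 0 -> - r <= x <= r -> - r <= y <= r -> (`|x| = r \/ `|y| = r) ->
  r / 2 <= n1 ((x +i* y)%C - (w +i* 0)%C) /\ r <= n1 (x +i* y)%C.
Proof.
move=> hw hx hy hxy; rewrite /n1 /= subr0.
have := ler_normD (x - w) w; rewrite subrK (ltr0_norm (x := w)); last by lra.
have := normr_ge0 (x - w); have := normr_ge0 y; have := normr_ge0 x.
by case: hxy => ->; lra.
Qed.

Let quot w z := (f z - f w) / (z - w).

Let dquot w z : normc z < de -> z != w -> cderivable (quot w) z.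
Proof.
move=> hz zw; apply: cderivableM.
  by apply: cderivableB; [exact: df|exact: cderivable_cst].
apply: cderivableV; first by rewrite subr_eq0.
by apply: cderivableB; [exact: cderivable_id|exact: cderivable_cst].
Qed.

Let quot_sing (w : C) (e : R) : normc w < de -> 0 < e -> exists2 s : R, 0 < s &
   forall z, 0 < n1 (z - w) < s -> n1 (z - w) * n1 (quot w z) <= e.
Proof.
move=> hw e0; have := cderivable_ccont (df hw) => /(_ (e / 4)) [|s s0 Hs]; first by lra.
exists s => // z /andP[zw /Hs H].
apply: (@le_trans _ _ (n1 (z - w) * (4 * (e / 4) / n1 (z - w)))).
  by rewrite ler_wpM2l ?n1_ge0//; apply: n1_le_div => //; exact: ltW.
by rewrite mulrCA divff ?gt_eqF//; lra.
Qed.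

Let quot_bound (w x y : R) : - (r / 2) < w < 0 -> - r <= x <= r -> - r <= y <= r ->
  (`|x| = r \/ `|y| = r) -> n1 (quot (w +i* 0)%C (x +i* y)%C) <= 4 * (4 * M) / (r / 2).
Proof.
move=> hw hx hy hxy; have [f1 f2] := far hw hx hy hxy.
apply: n1_le_div => //; last by have := r0; lra.
by apply: fdiff; [exact: insq|exact: inw].
Qed.

Lemma normcB_real (w : R) (u : C) : w < 0 -> normc (u * (w +i* 0)%C) = normc u * `|w|.
Proof.
move=> w0; rewrite ComplexField.Normc.normcM; congr (_ * _).
by rewrite /= expr0n /= addr0 sqrtr_sqr.
Qed.

(** The 16 of [cauchy_center] times a bound of the divided difference at w on the boundary of the
    square of half-side r = de / 4: increments of f have [n1] at most 4 M there, and w is at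
    distance at least r / 2. Only de and M enter. *)
Definition lip_cst := 16 * (4 * (4 * M) / (r / 2)).

(** Cauchy's estimate for the divided difference [quot w] at 0, where its value is (f(w) - f(0)) /
    w. *)
Lemma taylor1 (w : R) : - (r / 2) < w < 0 -> normc (f (w +i* 0)%C - f 0) <= lip_cst * `|w|.
Proof.
move=> hw; have [wr w0] := andP hw; have hr := r0; have rw : - r < w by lra.
have w_neq0 : 0 != (w +i* 0)%C :> C by rewrite eq_sym eq_complex /= lt_eqF.
have H : normc (quot (w +i* 0)%C 0) <= lip_cst.
  apply: (@cauchy_center _ (quot (w +i* 0)%C) _ r w) => //.
  - by move=> x y hx hy _ zw; apply: dquot => //; exact: insq.
  - move=> e e0; have := cderivable_ccont (dquot in0 w_neq0) => /(_ _ e0)[s s0 Hs].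
    by exists s => // z /andP[_ zs]; apply/ltW/Hs; rewrite subr0.
  - by move=> e e0; apply: quot_sing => //; exact: inw.
  - by move=> x y hx hy hxy; exact: quot_bound.
have -> : f (w +i* 0)%C - f 0 = quot (w +i* 0)%C 0 * (w +i* 0)%C.
  by rewrite /quot; field; rewrite ?sub0r ?oppr_eq0 eq_sym.
by rewrite normcB_real// ler_wpM2r.
Qed.

Definition quad_cst := 16 * (4 * (4 * (4 * r * lip_cst + 4 * M) / r) / (r / 2)).

(** Cauchy's estimate for the difference [h] of the divided differences at w and at 0. Its limit at
    0 is [quot W 0 - l], and both 0 and w are now exceptional points. A further factor |w| comes
    from the size of h on the boundary. *)
Lemma taylor2 (w : R) : - (r / 2) < w < 0 ->
  normc (f (w +i* 0)%C - f 0 - cderiv f 0 * (w +i* 0)%C) <= quad_cst * w ^+ 2.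
Proof.
move=> hw; have [wr w0] := andP hw; have hr := r0; have rw : - r < w by lra.
set W := (w +i* 0)%C; set l := cderiv f 0.
have w_neq0 : 0 != W :> C by rewrite eq_sym eq_complex /= lt_eqF.
have nw : n1 W = `|w| by rewrite /n1 /= normr0 addr0.
have nwE : `|w| = - w by rewrite ltr0_norm.
pose h z := quot W z - quot 0 z.
have H : normc (quot W 0 - l) <= quad_cst * `|w|.
  have -> : quad_cst * `|w| = 16 * (4 * (4 * ((4 * r * lip_cst + 4 * M) * `|w|) / r) / (r / 2)).
    by rewrite /quad_cst; field; lra.
  apply: (@cauchy_center _ h _ r w) => //.
  - move=> x y hx hy z0 zw; apply: cderivableB; apply: dquot => //; exact: insq.
  - move=> e e0; have e2 : 0 < e / 2 by lra.
    have [s s0 Hs] := cderivable_ccont (dquot in0 w_neq0) e2.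
    have [|s' s0' Hs'] := @cderivable_n1 _ f 0 (df in0) (e / 8); first by lra.
    exists (Num.min s s'); first by rewrite lt_min s0 s0'.
    move=> z; rewrite lt_min => /andP[z0 /andP[zs zs']].
    have zn : z != 0 by rewrite -n1_gt0.
    have -> : h z - (quot W 0 - l) = (quot W z - quot W 0) - (quot 0 z - l) by rewrite /h; ring.
    apply: (le_trans (n1B _ _)).
    have := Hs z; rewrite subr0 => /(_ zs) H1.
    have := Hs' z; rewrite subr0 => /(_ zs') H2.
    have : n1 (quot 0 z - l) <= 4 * (e / 8 * n1 z) / n1 z.
      have -> : quot 0 z - l = (f z - f 0 - l * z) / z by rewrite /quot subr0; field.
      exact: n1_le_div.
    have -> : 4 * (e / 8 * n1 z) / n1 z = e / 2 by field; rewrite gt_eqF.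
    lra.
  - move=> e e0; have e2 : 0 < e / 2 by lra.
    have inW := inw hw.
    have [s s0 Hs] := quot_sing inW e2.
    pose K := 4 * (4 * M + 1) / (- w / 2).
    have K0 : 0 < K by rewrite divr_gt0//; have := M0; lra.
    pose s2 := (de - normc W) / 2.
    have s20 : 0 < s2 by rewrite /s2; have := inW; rewrite -/W; lra.
    exists (Num.min s (Num.min (- w / 2) (Num.min s2 (e / 2 / K)))).
      have wp : 0 < - w / 2 by lra.
      have ek : 0 < e / 2 / K by exact: divr_gt0.
      by rewrite !lt_min s0 s20 wp ek.
    move=> z; rewrite !lt_min => /andP[z0 /andP[zs /andP[zw /andP[z2 zK]]]].
    have hz : normc z < de.
      have := @le_normcD _ (z - W) W; rewrite subrK; have := normc_le_n1 (z - W).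
      by move: z2; rewrite /s2; lra.
    have nz : - w / 2 <= n1 z.
      by have := n1D z (- (z - W)); rewrite n1N opprB addrCA subrr addr0 nw nwE; lra.
    have H2 : n1 (quot 0 z) <= K.
      rewrite /quot /K subr0; apply: n1_le_div => //; last by lra.
      by have := fdiff hz in0; lra.
    rewrite /h; apply: (@le_trans _ _ (n1 (z - W) * (n1 (quot W z) + n1 (quot 0 z)))).
      by rewrite ler_wpM2l ?n1_ge0// n1B.
    have := Hs z; rewrite z0 zs => /(_ isT) H1.
    have H3 : n1 (z - W) * n1 (quot 0 z) <= e / 2.
      apply: (@le_trans _ _ (n1 (z - W) * K)); first by rewrite ler_wpM2l ?n1_ge0.
      by rewrite -ler_pdivlMr// ltW.
    by rewrite mulrDr; lra.
  - move=> x y hx hy hxy; have [f1 f2] := far hw hx hy hxy; rewrite -/W in f1.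
    set z := (x +i* y)%C in f1 f2 *.
    have zn : z != 0 by rewrite -n1_gt0; lra.
    have zw : z - W != 0 by rewrite -n1_gt0; lra.
    (* Over a common denominator each term carries w or f(0) - f(w), hence is O(|w|) on the
       boundary. *)
    have -> : h z = ((f 0 - f W) * z + (f z - f 0) * W) / z / (z - W).
      by rewrite /h /quot subr0; field; rewrite zn zw.
    apply: n1_le_div => //; last by lra.
    apply: n1_le_div => //.
    rewrite [leRHS]mulrDl; apply: (le_trans (n1D _ _)); apply: lerD.
      apply: (le_trans (n1M _ _)).
      have t1 : n1 (f 0 - f W) <= 2 * (lip_cst * `|w|).
        rewrite -n1N opprB; apply: (le_trans (n1_le_normc _)).
        by rewrite ler_pM2l//; exact: taylor1.
      have t2 : n1 z <= 2 * r.
        have h1 : `|x| <= r by rewrite ler_norml.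
        have h2 : `|y| <= r by rewrite ler_norml.
        by rewrite /z /n1 /=; lra.
      have := ler_pM (n1_ge0 _) (n1_ge0 _) t1 t2; lra.
    apply: (le_trans (n1M _ _)); rewrite nw ler_wpM2r//.
    by apply: fdiff => //; exact: insq.
have -> : f W - f 0 - l * W = (quot W 0 - l) * W.
  by rewrite /quot; field; rewrite ?sub0r ?oppr_eq0 eq_sym.
have -> : quad_cst * w ^+ 2 = quad_cst * `|w| * `|w| by rewrite nwE; ring.
by rewrite /W normcB_real// ler_wpM2r.
Qed.

End taylor.

(** * The integrator on the spectrum *)

Section integrator_bounds.
Context {R : realType}.
Local Notation C := R[i].
Local Notation normc := ComplexField.Normc.normc.

Lemma ereal_sup_lty (S : set (\bar R)) : (ereal_sup S < +oo)%E ->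
  exists2 M : R, 0 < M & forall x, S x -> (x <= M%:E)%E.
Proof.
move=> Sy; exists (`|fine (ereal_sup S)| + 1); first by have := normr_ge0 (fine (ereal_sup S)); lra.
move=> x Sx; have xs := ereal_sup_ubound Sx.
case: (ereal_sup S) Sy xs => [r _ /le_trans| //|_]; last by rewrite leeNy_eq => /eqP ->; exact: leNye.
by apply; rewrite lee_fin /= (le_trans (ler_norm _))// lerDl.
Qed.

Lemma ereal_sup_lt1 (S : set (\bar R)) : (ereal_sup S < 1)%E ->
  exists2 M : R, 0 <= M < 1 & forall x, S x -> (x <= M%:E)%E.
Proof.
move=> S1; exists (Num.max 0 (fine (ereal_sup S))).
  rewrite le_max lexx /= gt_max ltr01 /=.
  by case: (ereal_sup S) S1 => [r|//|_]; rewrite ?lte_fin//= ltr01.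
move=> x Sx; have xs := ereal_sup_ubound Sx.
case: (ereal_sup S) S1 xs => [r _ /le_trans| //|_]; last by rewrite leeNy_eq => /eqP ->; exact: leNye.
by apply; rewrite lee_fin le_max lexx orbT.
Qed.

Lemma Re_le_normc (z : C) : `|complex.Re z| <= normc z.
Proof.
rewrite -(@ler_pXn2r _ 2)// ?nnegrE ?normc_ge0// normc_sqr real_normK ?num_real//.
by rewrite lerDl sqr_ge0.
Qed.

Lemma meromorphic_disc (f : C -> C) (de M : R) : meromorphic f ->
  (forall z, normc z < de -> normc (f z) <= M) -> forall z, normc z < de -> cderivable f z.
Proof.
move=> mf fM z hz.
apply: (@meromorphic_bounded _ f z ((de - normc z)%:C)%C (M%:C)%C mf).
- by rewrite ltcR subr_gt0.
- by rewrite complex_real.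
- move=> w; rewrite !normc_def !sqrt_normc ltcR lecR => hw; apply: fM.
  by have := @le_normcD _ (w - z) z; rewrite subrK; lra.
Qed.

(** Everything that the error analysis uses of A_s and B_s, at the eigenvalue x / tau. *)
Definition scalar_bounds (de M rho x a b : R) :=
  [/\ `|a| <= 1, x < de -> `|a - (1 - x)| <= M * x ^+ 2 /\ `|b - 1| <= M * x,
      de <= x -> `|a| <= rho & b ^+ 2 * (1 + x) <= M].

Lemma integrator_bounds (A B : nat -> C -> C) (L : nat -> \bar R) : admissible_integrator A B L ->
  exists de M rho : R, [/\ 0 < de <= 1, 0 < M, 0 <= rho < 1 & M * de <= 1 / 2] /\
    forall s x, (1 <= s)%N -> 0 < x -> (x%:E <= L s)%E ->
    scalar_bounds de M rho x (restrict_real (A s) (- x)) (restrict_real (B s) (- x)).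
Proof.
move=> [H1 H2 /ereal_sup_lty[M1 M10 HM1] H4 [de0 /andP[de00 de01] /ereal_sup_lty[M2 M20 HM2]]].
have bAB s z : (1 <= s)%N -> normc z < de0 -> normc (A s z) <= M2 /\ normc (B s z) <= M2.
  move=> s1 hz; have := HM2 (normc (A s z) + normc (B s z))%:E; rewrite lee_fin => H.
  have {}H : normc (A s z) + normc (B s z) <= M2 by apply: H; exists s, z; split.
  by have := normc_ge0 (A s z); have := normc_ge0 (B s z); lra.
have dA s : (1 <= s)%N -> forall z, normc z < de0 -> cderivable (A s) z.
  by move=> s1; have [_ mA _ _] := H1 s s1; apply: (@meromorphic_disc _ de0 M2 mA) => z /(bAB s z s1)[].
have dB s : (1 <= s)%N -> forall z, normc z < de0 -> cderivable (B s) z.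
  by move=> s1; have [_ _ mB _] := H1 s s1; apply: (@meromorphic_disc _ de0 M2 mB) => z /(bAB s z s1)[].
pose M := M1 + `|quad_cst de0 M2| + `|lip_cst de0 M2|.
have M0 : 0 < M by rewrite ltr_wpDr// ltr_wpDr.
have M1M : M1 <= M by rewrite /M -addrA lerDl addr_ge0.
have qM : quad_cst de0 M2 <= M.
  by rewrite (le_trans (ler_norm _))// /M; have := normr_ge0 (lip_cst de0 M2); lra.
have lM : lip_cst de0 M2 <= M.
  by rewrite (le_trans (ler_norm _))// /M; have := normr_ge0 (quad_cst de0 M2); lra.
(* de0 / 8 is the range r / 2 of the Taylor estimates; 1 / (2 M) secures M de <= 1 / 2, which will
   give |a| <= exp(-x / 2) for x < de. *)
pose de := Num.min (de0 / 8) (1 / (2 * M)).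
have de_gt0 : 0 < de by rewrite lt_min; apply/andP; split; apply: divr_gt0 => //; apply: mulr_gt0.
have de8 : de <= de0 / 8 by rewrite /de ge_min lexx.
have de1 : 0 < de <= 1 by lra.
have [rho rho1 Hrho] := ereal_sup_lt1 (H4 de de1).
exists de, M, rho; split.
  split => //; apply: (@le_trans _ _ (M * (1 / (2 * M)))).
    by rewrite ler_pM2l// /de ge_min lexx orbT.
  by rewrite le_eqVlt; apply/orP; left; apply/eqP; field; lra.
move=> s x s1 x0 xL.
have stab : stability_interval (L s) (- x).
  by split; [rewrite EFinN leeN2|lra].
split.
(* The bound on A_s away from 0 is assumed for delta in (0, 1] only, whence the minimum with 1. *)
- have h1 : 0 < Num.min x 1 <= 1 by rewrite lt_min x0 ltr01 ge_min lexx orbT.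
  have [r r1 Hr] := ereal_sup_lt1 (H4 _ h1).
  have := Hr (normc (A s ((- x)%:C)%C))%:E; rewrite lee_fin => /(_ _) Hr'.
  apply: (le_trans (Re_le_normc _)); apply: le_trans (Hr' _) _; last by lra.
  by exists s, (- x); split => //; rewrite lerN2 ge_min lexx.
- move=> xde; have hw : - (de0 / 4 / 2) < - x < 0 by lra.
  have [A0 dA0 B0] := H2 s s1.
  have cA : cderiv (A s) 0 = 1 by case: dA0 => _ <-.
  split.
    have := @taylor2 _ (A s) de0 M2 de00 (dA s s1) (fun z hz => (bAB s z s1 hz).1) _ hw.
    rewrite A0 cA mul1r sqrrN => /(le_trans (Re_le_normc _)) H.
    apply: (@le_trans _ _ (quad_cst de0 M2 * x ^+ 2)); last by rewrite ler_wpM2r// sqr_ge0.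
    rewrite (_ : restrict_real _ _ - _ = complex.Re (A s ((- x) +i* 0)%C - 1 - ((- x) +i* 0)%C))//.
    by rewrite /restrict_real; case: (A s _) => p q /=; ring.
  have := @taylor1 _ (B s) de0 M2 de00 (dB s s1) (fun z hz => (bAB s z s1 hz).2) _ hw.
  rewrite B0 normrN (gtr0_norm x0) => /(le_trans (Re_le_normc _)) H.
  apply: (@le_trans _ _ (lip_cst de0 M2 * x)); last by rewrite ler_wpM2r// ltW.
  rewrite (_ : restrict_real _ _ - _ = complex.Re (B s ((- x) +i* 0)%C - 1))//.
  by rewrite /restrict_real; case: (B s _) => p q /=; ring.
- move=> dex; apply: (le_trans (Re_le_normc _)).
  rewrite -lee_fin; apply: Hrho; exists s, (- x); split => //; lra.
- apply: le_trans M1M; rewrite -lee_fin.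
  apply: (@le_trans _ _ ((1 + `|- x|) * normc (B s ((- x)%:C)%C) ^+ 2)%:E); last first.
    by apply: HM1; exists s, (- x); split.
  rewrite lee_fin mulrC normrN (gtr0_norm x0) ler_wpM2l//; first lra.
  have H := Re_le_normc (B s ((- x)%:C)%C).
  have := ler_pM (normr_ge0 _) (normr_ge0 _) H H.
  by rewrite -!expr2 real_normK ?num_real.
Qed.

End integrator_bounds.

(** * Kernel estimates for a single eigenvalue *)

Section kernels.
Context {R : realType}.
Implicit Types (x y lam tau : R) (n k J l : nat).

(** Time reversal of a grid with J cells per step: the cell at position l from the end lies in the
    step at position l / J from the end. *)
Lemma rev_divn k J l : (0 < J)%N -> (l < k * J)%N -> (k.-1 - (k * J - l.+1) %/ J)%N = (l %/ J)%N.
Proof.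
move=> J0 lk; have q : (l %/ J < k)%N by rewrite ltn_divLR.
have r : (l %% J < J)%N by rewrite ltn_mod.
have -> : (k * J - l.+1 = (k.-1 - l %/ J) * J + (J.-1 - l %% J))%N.
  have lE := divn_eq l J; move: (l %/ J)%N (l %% J)%N q r lE => u v q r ->.
  have [p ->] : exists p, k = (p + u).+1 by exists (k.-1 - u)%N; lia.
  by rewrite /= addnK mulSn mulnDl; lia.
have h1 : (J.-1 - l %% J < J)%N by move: (l %% J)%N => u; lia.
have h2 : (l %/ J <= k.-1)%N by move: (l %/ J)%N q => u; lia.
by rewrite divnMDl// (divn_small h1) addn0 subKn.
Qed.

Lemma geo_sum_le (r : R) n : 0 <= r < 1 -> \sum_(i < n) r ^+ i <= (1 - r)^-1.
Proof.
move=> /andP[r0 r1]; rewrite -[leRHS]mul1r ler_pdivlMr ?subr_gt0// mulrC.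
have : 1 - r ^+ n = (1 - r) * \sum_(i < n) r ^+ i.
  have := subrX1 r n; rewrite -[1 - r]opprB -[1 - r ^+ n]opprB => ->; rewrite mulNr; congr (- (_ * _)).
by move=> <-; have := exprn_ge0 n r0; lra.
Qed.

Lemma expRN_le_inv x : 0 < x -> expR (- x) <= x^-1.
Proof. by move=> x0; rewrite expRN lef_pV2 ?posrE ?expR_gt0//; have := expR_ge1Dx x; lra. Qed.

Lemma mul_expRN_le1 x : 0 <= x -> x * expR (- x) <= 1.
Proof.
rewrite le_eqVlt => /predU1P[<-|x0]; first by rewrite mul0r.
by rewrite mulrC -ler_pdivlMr// mul1r expRN_le_inv.
Qed.

Lemma expRN_le1 x : 0 <= x -> expR (- x) <= 1.
Proof. by move=> x0; rewrite expRN invf_le1 ?expR_gt0//; have := expR_ge1Dx x; lra. Qed.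

Lemma expR_sum_le y n : 0 < y -> \sum_(i < n) expR (- (i.+1%:R * y)) <= y^-1.
Proof.
move=> y0; set r := expR (- y).
have r1 : r < 1 by rewrite /r expRN invf_lt1 ?expR_gt0// expR_gt1.
have -> : \sum_(i < n) expR (- (i.+1%:R * y)) = r * \sum_(i < n) r ^+ i.
  rewrite mulr_sumr; apply: eq_bigr => i _.
  by rewrite -exprS /r -expRM_natl mulrN.
have r0 : 0 < r by exact: expR_gt0.
have := @geo_sum_le r n; rewrite (ltW r0) r1 => /(_ isT) H.
apply: (@le_trans _ _ (r * (1 - r)^-1)); first by rewrite ler_pM2l.
rewrite ler_pdivrMr ?subr_gt0// mulrC ler_pdivlMr//.
have := expR_ge1Dx y; rewrite -[expR y]invrK -expRN -/r => H2.
have : (1 + y) * r <= 1 by rewrite -ler_pdivlMr// mul1r.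
lra.
Qed.

Lemma expRN_taylor x : 0 <= x -> `|expR (- x) - (1 - x)| <= x ^+ 2.
Proof.
move=> x0; rewrite ger0_norm; last by have := expR_ge1Dx (- x); lra.
have h : expR (- x) <= (1 + x)^-1.
  by rewrite expRN lef_pV2 ?posrE ?expR_gt0//; [exact: expR_ge1Dx|lra].
have : (1 + x)^-1 - (1 - x) <= x ^+ 2.
  rewrite (_ : _ - _ = x ^+ 2 / (1 + x)); last by field; lra.
  by rewrite ler_pdivrMr; [have := sqr_ge0 x; nra|lra].
lra.
Qed.

Lemma diffX_le (p a m : R) k : `|p| <= m -> `|a| <= m ->
  `|p ^+ k.+1 - a ^+ k.+1| <= k.+1%:R * `|p - a| * m ^+ k.
Proof.
move=> pm am; have m0 : 0 <= m by exact: le_trans (normr_ge0 p) pm.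
rewrite subrXX normrM mulrAC [leRHS]mulrC ler_wpM2l//.
apply: (le_trans (ler_norm_sum _ _ _)).
have -> : k.+1%:R * m ^+ k = \sum_(i < k.+1) m ^+ k by rewrite sumr_const card_ord mulr_natl.
apply: ler_sum => i _; rewrite normrM !normrX.
have ik : (i <= k)%N by rewrite -ltnS.
by rewrite -[in leRHS](subnK ik) exprD; apply: ler_pM; rewrite ?exprn_ge0//; apply: lerXn2r; rewrite ?nnegrE.
Qed.

Variables (de M rho : R).
Hypotheses (de01 : 0 < de <= 1) (M0 : 0 < M) (rho01 : 0 <= rho < 1) (Mde : M * de <= 1 / 2).

(** As M x <= M de <= 1 / 2, the expansion gives a <= 1 - x / 2 and also -a <= 3 x / 2 - 1, which is
    at most 1 - x / 2 because x < 1. *)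
Let small_a x a b : scalar_bounds de M rho x a b -> 0 < x -> x < de -> `|a| <= expR (- (x / 2)).
Proof.
have := de01 => hde.
move=> [_ H _ _] x0 xd; have [{}H _] := H xd; have := expR_ge1Dx (- (x / 2)).
have : M * x ^+ 2 <= x / 2.
  rewrite expr2 mulrA [leRHS]mulrC ler_wpM2r ?(ltW x0)//.
  by have : M * x <= M * de; [rewrite ler_pM2l// ltW|have := Mde; lra].
by move: H; rewrite ler_norml => /andP[h1 h2]; rewrite ler_norml; lra.
Qed.

(** A consistency error (1 + M) x^2 per step, k steps, and the decay exp(-(k - 1) x / 2). Half of
    the decay absorbs k x through u exp(-u) <= 1 with u = k x / 4. *)
Lemma small_diff x a b k : scalar_bounds de M rho x a b -> 0 < x -> x < de ->
  `|expR (- (k%:R * x)) - a ^+ k| <= 8 * (1 + M) * x * expR (- (k%:R * x / 4)).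
Proof.
move=> sb x0 xd; have sa := small_a sb x0 xd; case: sb => _ /(_ xd)[H _] _ _.
have := de01 => hde; have := M0 => hM; case: k => [|k]; first by rewrite mul0r oppr0 expR0 expr0 subrr normr0 !mulr_ge0 ?expR_ge0//; have := M0; lra.
set u := k.+1%:R * x / 4.
have u0 : 0 <= u by rewrite /u divr_ge0// mulr_ge0// ltW.
have -> : expR (- (k.+1%:R * x)) = expR (- x) ^+ k.+1 by rewrite -expRM_natl mulrN.
have pm : `|expR (- x)| <= expR (- (x / 2)) by rewrite ger0_norm ?expR_ge0// ler_expR; lra.
apply: (le_trans (diffX_le _ pm sa)).
have h1 : `|expR (- x) - a| <= (1 + M) * x ^+ 2.
  rewrite (_ : _ - _ = (expR (- x) - (1 - x)) - (a - (1 - x))); last by ring.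
  apply: (le_trans (ler_normB _ _)); rewrite mulrDl mul1r; apply: lerD => //.
  by apply: expRN_taylor; lra.
have h2 : expR (- (x / 2)) ^+ k <= 2 * (expR (- u) * expR (- u)).
  rewrite -expRM_natl mulrN -expRD.
  have -> : - (k%:R * (x / 2)) = (- u - u) + x / 2 by rewrite /u -natr1; field.
  rewrite [leLHS]expRD [leLHS]mulrC ler_wpM2r ?expR_ge0//.
  rewrite -[x / 2]opprK expRN invf_ple ?posrE ?expR_gt0//.
  by have := expR_ge1Dx (- (x / 2)); lra.
apply: (@le_trans _ _ (k.+1%:R * ((1 + M) * x ^+ 2) * (2 * (expR (- u) * expR (- u))))).
  by apply: ler_pM; rewrite ?exprn_ge0 ?expR_ge0 ?mulr_ge0//; apply: ler_wpM2l.
have -> : k.+1%:R * ((1 + M) * x ^+ 2) * (2 * (expR (- u) * expR (- u))) =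
   8 * (1 + M) * x * expR (- u) * (u * expR (- u)) by rewrite /u; field.
rewrite -[leRHS]mulr1 ler_wpM2l ?mul_expRN_le1// !mulr_ge0 ?expR_ge0//; lra.
Qed.

Let c := 1 - rho.
Let c0 : 0 < c. Proof. by rewrite /c; have := rho01; lra. Qed.
Let rho_exp : rho <= expR (- c).
Proof. by have := expR_ge1Dx (- c); rewrite /c; lra. Qed.

(** 32 (1 + M) serves x < de. For x >= de, the bounds of k exp(-k de) and k rho^k are de^-1 and
    c^-1, since rho <= exp(-c) with c = 1 - rho. *)
Definition lin_cst := 32 * (1 + M) + de^-1 + c^-1.

Lemma lin_bound x a b k : scalar_bounds de M rho x a b -> 0 < x -> (0 < k)%N ->
  `|expR (- (k%:R * x)) - a ^+ k| <= lin_cst / k%:R.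
Proof.
move=> sb x0 k0; have := de01 => hde; have := M0 => hM; have := rho01 => hrho; have := c0 => hc; have kp : 0 < k%:R :> R by rewrite ltr0n.
have d0 : 0 < de^-1 by rewrite invr_gt0; have := de01; lra.
have ci : 0 < c^-1 by rewrite invr_gt0.
rewrite ler_pdivlMr//; have [xd|dx] := ltP x de.
  have H := small_diff k sb x0 xd.
  apply: (@le_trans _ _ (32 * (1 + M))); last by rewrite /lin_cst; lra.
  apply: (@le_trans _ _ (8 * (1 + M) * x * expR (- (k%:R * x / 4)) * k%:R)).
    by rewrite ler_wpM2r// ltW.
  have -> : 8 * (1 + M) * x * expR (- (k%:R * x / 4)) * k%:R =
     32 * (1 + M) * (k%:R * x / 4 * expR (- (k%:R * x / 4))) by field.
  rewrite -[leRHS]mulr1 ler_wpM2l//; first by have := M0; lra.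
  by apply: mul_expRN_le1; rewrite divr_ge0// mulr_ge0// ltW.
case: sb => _ _ /(_ dx) H _.
have h1 : expR (- (k%:R * x)) * k%:R <= de^-1.
  rewrite -ler_pdivlMr// -invfM; apply: (@le_trans _ _ (expR (- (k%:R * de)))).
    by rewrite ler_expR lerN2 ler_pM2l.
  by rewrite mulrC expRN_le_inv// mulr_gt0//; lra.
have h2 : `|a| ^+ k * k%:R <= c^-1.
  rewrite -ler_pdivlMr// -invfM; apply: (@le_trans _ _ (expR (- (k%:R * c)))).
    rewrite -mulrN expRM_natl; apply: lerXn2r; rewrite ?nnegrE ?expR_ge0//.
    exact: le_trans H rho_exp.
  by rewrite mulrC expRN_le_inv// mulr_gt0.
apply: (@le_trans _ _ ((`|expR (- (k%:R * x))| + `|a ^+ k|) * k%:R)).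
  by rewrite ler_wpM2r ?ler_normB// ltW.
rewrite ger0_norm ?expR_ge0// normrX mulrDl /lin_cst; have := M0; lra.
Qed.

(** With th the fine time and j x the coarse time just before it, the kernel is the sum of exp(-th)
    - exp(-j x), exp(-j x) - a^j and a^j (1 - b), each O(x exp(-j x / 4)). *)
Let conv_term x a b J l : scalar_bounds de M rho x a b -> 0 < x -> (0 < J)%N -> x < de ->
  (expR (- (l.+1%:R * (x / J%:R))) - a ^+ (l %/ J) * b) ^+ 2 <=
  (20 * (1 + M)) ^+ 2 * x ^+ 2 * expR (- (l.+1%:R * (x / J%:R / 2))).
Proof.
move=> sb x0 J0 xd; have := de01 => hde; have := M0 => hM; set j := (l %/ J)%N.
have Jp : 0 < J%:R :> R by rewrite ltr0n.
have j1 : (j%:R : R) * J%:R <= l.+1%:R by rewrite -natrM ler_nat ltnW// ltnS leq_divM.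
have j2 : (l.+1%:R : R) <= (j%:R + 1) * J%:R.
  by rewrite natr1 -natrM ler_nat ltn_ceil.
set th := l.+1%:R * (x / J%:R).
have t1 : j%:R * x <= th.
  by rewrite /th mulrCA [leLHS]mulrC ler_wpM2l ?(ltW x0)// ler_pdivlMr.
have t2 : th <= (j%:R + 1) * x.
  by rewrite /th mulrCA [leRHS]mulrC ler_wpM2l ?(ltW x0)// ler_pdivrMr.
have sd := small_diff j sb x0 xd.
have sa := small_a sb x0 xd.
case: sb => a1 /(_ xd)[_ Hb] _ _.
(* Passing from j x to th costs at most exp(x / 4) <= 2. *)
have e8 : expR (- (j%:R * x / 4)) <= 2 * expR (- (th / 4)).
  rewrite (_ : - (j%:R * x / 4) = - (th / 4) + (th - j%:R * x) / 4); last by field.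
  rewrite [leLHS]expRD [leLHS]mulrC ler_wpM2r ?expR_ge0//.
  apply: (@le_trans _ _ (expR (x / 4))); first by rewrite ler_expR; lra.
  rewrite -[x / 4]opprK expRN invf_ple ?posrE ?expR_gt0//.
  by have := expR_ge1Dx (- (x / 4)); lra.
have p1 : `|expR (- th) - expR (- (j%:R * x))| <= x * expR (- (j%:R * x / 4)).
  rewrite (_ : - th = - (j%:R * x) + - (th - j%:R * x)); last by ring.
  rewrite expRD -[X in _ - X]mulr1 -mulrBr normrM ger0_norm ?expR_ge0// mulrC.
  apply: ler_pM; rewrite ?expR_ge0//.
    rewrite distrC ger0_norm; last by rewrite subr_ge0 expRN_le1//; lra.
    by have := expR_ge1Dx (- (th - j%:R * x)); lra.
  by rewrite ler_expR; have : 0 <= j%:R * x; [rewrite mulr_ge0// ltW|lra].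
have p3 : `|a ^+ j * (1 - b)| <= M * x * expR (- (j%:R * x / 4)).
  rewrite normrM mulrC (distrC 1); apply: ler_pM => //.
  rewrite normrX; apply: (@le_trans _ _ (expR (- (x / 2)) ^+ j)).
    by apply: lerXn2r; rewrite ?nnegrE ?expR_ge0.
  by rewrite -expRM_natl ler_expR; have : 0 <= j%:R * x; [rewrite mulr_ge0// ltW|lra].
have tot : `|expR (- th) - a ^+ j * b| <= 20 * (1 + M) * x * expR (- (th / 4)).
  rewrite (_ : _ - _ = (expR (- th) - expR (- (j%:R * x))) + (expR (- (j%:R * x)) - a ^+ j)
    + a ^+ j * (1 - b)); last by ring.
  apply: (le_trans (ler_normD _ _)); apply: (@le_trans _ _ ((10 * (1 + M)) * x * expR (- (j%:R * x / 4)))).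
    have := ler_normD (expR (- th) - expR (- (j%:R * x))) (expR (- (j%:R * x)) - a ^+ j).
    move: p1 p3 sd; set E := expR (- (j%:R * x / 4)).
    have : 0 <= x * E by rewrite mulr_ge0 ?expR_ge0// ltW.
    have : 0 <= M * x * E by rewrite !mulr_ge0 ?expR_ge0// ltW.
    lra.
  rewrite (_ : 20 * (1 + M) * x * _ = 10 * (1 + M) * x * (2 * expR (- (th / 4)))); last by ring.
  by rewrite ler_wpM2l// mulr_ge0 ?(ltW x0)//; have := M0; lra.
rewrite -real_normK ?num_real//.
have -> : expR (- (l.+1%:R * (x / J%:R / 2))) = expR (- (th / 4)) ^+ 2.
  by rewrite -expRM_natl /th; congr expR; field; rewrite gt_eqF.
rewrite -!exprMn; apply: lerXn2r => //; rewrite nnegrE//.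
by rewrite !mulr_ge0 ?expR_ge0 ?(ltW x0)//; have := M0; lra.
Qed.

(** For x >= de no cancellation is used: b^2 <= M / x supplies the decay in lam, and rho <= exp(-c)
    makes the sum over l geometric; rounding times down to the coarse grid costs exp(2 c). *)
Let conv_term_large x a b J l : scalar_bounds de M rho x a b -> 0 < x -> (0 < J)%N -> de <= x ->
  (expR (- (l.+1%:R * (x / J%:R))) - a ^+ (l %/ J) * b) ^+ 2 <=
  2 * expR (- (l.+1%:R * (2 * x / J%:R))) + 2 * M / x * expR (2 * c) * expR (- (l.+1%:R * (2 * c / J%:R))).
Proof.
move=> sb x0 J0 dx; have := de01 => hde; have := M0 => hM; have := c0 => hc; set j := (l %/ J)%N.
have Jp : 0 < J%:R :> R by rewrite ltr0n.
have j2 : (l.+1%:R : R) <= (j%:R + 1) * J%:R.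
  by rewrite natr1 -natrM ler_nat ltn_ceil.
case: sb => _ _ /(_ dx) Ha Hb.
set E := expR (- (l.+1%:R * (x / J%:R))); set A := a ^+ j.
apply: (@le_trans _ _ (2 * E ^+ 2 + 2 * (A * b) ^+ 2)).
  by have := sqr_ge0 (E + A * b); nra.
apply: lerD.
  rewrite ler_pM2l// /E -expRM_natl ler_expR le_eqVlt; apply/orP; left; apply/eqP; field.
  by rewrite gt_eqF.
have b2 : b ^+ 2 <= M / x.
  by rewrite ler_pdivlMr//; have := sqr_ge0 b; nra.
have A2 : A ^+ 2 <= expR (2 * c) * expR (- (l.+1%:R * (2 * c / J%:R))).
  rewrite -real_normK ?num_real// /A normrX -exprM -expRD.
  apply: (@le_trans _ _ (expR (- c) ^+ (j * 2))).
    by apply: lerXn2r; rewrite ?nnegrE ?expR_ge0//; exact: le_trans rho_exp.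
  rewrite -expRM_natl natrM ler_expR.
  have : l.+1%:R * (2 * c / J%:R) <= (j%:R + 1) * (2 * c).
    by rewrite mulrCA [leRHS]mulrC ler_wpM2l ?ler_pdivrMr// mulr_ge0// ltW.
  lra.
by have := ler_pM (sqr_ge0 _) (sqr_ge0 _) A2 b2; rewrite exprMn; lra.
Qed.

(** The first term serves x < de. For x >= de, 1 + M exp(2 c) / c bounds x z / tau, and its quotient
    by de bounds z / tau. *)
Definition conv_cst := 4 * (20 * (1 + M)) ^+ 2 + 1 + M * expR (2 * c) / c + (1 + M * expR (2 * c) / c) / de.

(** z is a left-endpoint Riemann sum, with J cells per step, of the squared L^2 norm of the kernel.
    Uniformity in J lets the grid be refined afterwards. *)
Lemma conv_kernel tau lam a b J k : 0 < tau -> 0 < lam -> (0 < J)%N ->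
  scalar_bounds de M rho (tau * lam) a b ->
  let z := tau / J%:R * \sum_(l < k * J)
    (expR (- ((k * J - l)%:R * (tau / J%:R) * lam)) - a ^+ (k.-1 - l %/ J) * b) ^+ 2 in
  z <= conv_cst * tau /\ z <= conv_cst / lam.
Proof.
move=> t0 l0 J0 sb z; have := de01 => hde; have := M0 => hM; have := c0 => hc; set x := tau * lam in sb.
have x0 : 0 < x by rewrite mulr_gt0.
have Jp : 0 < J%:R :> R by rewrite ltr0n.
have d0 : 0 < de by lra.
have zE : z = tau / J%:R * \sum_(l < k * J) (expR (- (l.+1%:R * (x / J%:R))) - a ^+ (l %/ J) * b) ^+ 2.
  congr (_ * _); rewrite (reindex_inj rev_ord_inj) /=; apply: eq_bigr => l _.
  have lk := ltn_ord l.
  rewrite subKn//; congr ((expR _ - _ ^+ _ * _) ^+ 2); first by rewrite /x; field; rewrite gt_eqF.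
  exact: rev_divn.
(* Multiplying the second bound by x = tau lam gives both bounds the same right-hand side. *)
suff H : z <= conv_cst * tau /\ x * z <= conv_cst * tau.
  case: H => h1 h2; split => //; rewrite ler_pdivlMr//.
  by rewrite -(ler_pM2r t0); move: h2; rewrite /x; lra.
set S := \sum_(l < _) _ in zE.
have [xd|dx] := ltP x de.
  have HS : S <= (20 * (1 + M)) ^+ 2 * x ^+ 2 * (x / J%:R / 2)^-1.
    apply: (@le_trans _ _ ((20 * (1 + M)) ^+ 2 * x ^+ 2 * \sum_(l < k * J) expR (- (l.+1%:R * (x / J%:R / 2))))).
      by rewrite mulr_sumr; apply: ler_sum => l _; exact: conv_term.
    apply: ler_wpM2l; first by rewrite mulr_ge0// sqr_ge0.
    by apply: expR_sum_le; rewrite !divr_gt0.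
  have Hz : z <= 2 * (20 * (1 + M)) ^+ 2 * x * tau.
    rewrite zE; apply: (@le_trans _ _ (tau / J%:R * ((20 * (1 + M)) ^+ 2 * x ^+ 2 * (x / J%:R / 2)^-1))).
      by rewrite ler_pM2l// divr_gt0.
    by rewrite le_eqVlt; apply/orP; left; apply/eqP; field; rewrite !gt_eqF.
  have C1 : 2 * (20 * (1 + M)) ^+ 2 <= conv_cst.
    have k1 : 0 <= M * expR (2 * c) / c by rewrite divr_ge0 ?mulr_ge0 ?expR_ge0// ltW.
    have k2 : 0 <= (1 + M * expR (2 * c) / c) / de by rewrite divr_ge0//; lra.
    by rewrite /conv_cst; have := sqr_ge0 (20 * (1 + M)); lra.
  have q0 : 0 <= 2 * (20 * (1 + M)) ^+ 2 * tau by rewrite mulr_ge0 ?(ltW t0)// mulr_ge0// sqr_ge0.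
  have q1 : 2 * (20 * (1 + M)) ^+ 2 * tau <= conv_cst * tau by rewrite ler_pM2r.
  have x1 : x <= 1 by lra.
  have x2 : x * x <= 1 by nra.
  split; first by have := ler_wpM2r q0 x1; lra.
  apply: (@le_trans _ _ (x * (2 * (20 * (1 + M)) ^+ 2 * x * tau))); first by rewrite ler_pM2l.
  by have := ler_wpM2r q0 x2; lra.
have HS : S <= 2 * (2 * x / J%:R)^-1 + 2 * M / x * expR (2 * c) * (2 * c / J%:R)^-1.
  apply: (@le_trans _ _ (2 * (\sum_(l < k * J) expR (- (l.+1%:R * (2 * x / J%:R)))) +
     2 * M / x * expR (2 * c) * \sum_(l < k * J) expR (- (l.+1%:R * (2 * c / J%:R))))).
    by rewrite !mulr_sumr -big_split; apply: ler_sum => l _; exact: conv_term_large.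
  apply: lerD; first by rewrite ler_pM2l// expR_sum_le// !divr_gt0// mulr_gt0.
  apply: ler_wpM2l; first by rewrite !mulr_ge0 ?expR_ge0 ?invr_ge0// ltW.
  by apply: expR_sum_le; rewrite !divr_gt0// mulr_gt0.
set K := 1 + M * expR (2 * c) / c.
have K0 : 0 <= K by rewrite addr_ge0// divr_ge0 ?mulr_ge0 ?expR_ge0// ltW.
have Hz : x * z <= K * tau.
  rewrite zE; apply: (@le_trans _ _ (x * (tau / J%:R * (2 * (2 * x / J%:R)^-1 + 2 * M / x * expR (2 * c) * (2 * c / J%:R)^-1)))).
    by rewrite ler_pM2l// ler_pM2l// divr_gt0.
  by rewrite /K le_eqVlt; apply/orP; left; apply/eqP; field; rewrite !gt_eqF.
have KC : K + K / de <= conv_cst.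
  rewrite /conv_cst -(addrA _ 1) -/K; have := sqr_ge0 (20 * (1 + M)); lra.
have Kd : 0 <= K / de by rewrite divr_ge0//; lra.
have z0 : 0 <= z.
  by rewrite zE mulr_ge0 ?divr_ge0 ?(ltW t0)// sumr_ge0// => l _; exact: sqr_ge0.
split.
  apply: (@le_trans _ _ (K / de * tau)); last by rewrite ler_pM2r//; lra.
  rewrite mulrAC ler_pdivlMr//; apply: le_trans Hz.
  by rewrite mulrC; exact: ler_wpM2r.
by apply: (le_trans Hz); rewrite ler_pM2r//; lra.
Qed.

End kernels.

Section increments.
Context {R : realType}.
Implicit Types (lam dl t be : R) (i k l : nat).

(** Rests on min(1, y) <= y^be for y = t lam and be in [0, 1]. *)
Lemma interpolate (z A t lam be : R) : 0 < t -> 0 < lam -> 0 <= be <= 1 -> 0 <= A ->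
  z <= A * t -> z <= A / lam -> z <= A * t `^ be * lam `^ (be - 1).
Proof.
move=> t0 l0 /andP[b0 b1] A0 h1 h2.
have -> : A * t `^ be * lam `^ (be - 1) = A / lam * (t * lam) `^ be.
  by rewrite powRM ?ltW// powRB ?(gt_eqF l0) ?implybT// powRr1 ?ltW//; field; rewrite gt_eqF.
have [tl|tl] := leP (t * lam) 1.
  apply: (le_trans h1); rewrite (_ : A * t = A / lam * (t * lam)); last by field; rewrite gt_eqF.
  apply: ler_wpM2l; first by rewrite divr_ge0// ltW.
  rewrite -[leLHS]powRr1; last by rewrite mulr_ge0 ?ltW.
  by rewrite ger_powR// mulr_gt0.
apply: (le_trans h2); rewrite ler_peMr ?divr_ge0 ?(ltW l0)//.
by rewrite -[leLHS](powRr0 (t * lam)) ler_powR// ltW.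
Qed.

(** The kernel of a convolution increment between the times i dl and (i + k) dl; the factor
    [(l < i)%N%:R] extends the earlier kernel by 0. On the first i cells it carries 1 - exp(-y),
    whose square is at most min(1, y); the last k cells are bounded directly. *)
Lemma increment_kernel dl lam i k : 0 < dl -> 0 < lam ->
  let z := dl * \sum_(l < i + k) (expR (- ((i + k - l)%:R * dl * lam))
     - (l < i)%N%:R * expR (- ((i - l)%:R * dl * lam))) ^+ 2 in
  z <= 2 * (k%:R * dl) /\ z <= 2 / lam.
Proof.
move=> d0 l0 z; set y := k%:R * dl * lam.
have y0 : 0 <= y by rewrite !mulr_ge0// ltW.
have dl0 : 0 < dl * lam by rewrite mulr_gt0.
pose S1 n := \sum_(l < n) expR (- (l.+1%:R * (2 * (dl * lam)))).
have S1le n : dl * S1 n <= (2 * lam)^-1.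
  apply: (@le_trans _ _ (dl * (2 * (dl * lam))^-1)).
    by rewrite ler_pM2l// expR_sum_le// mulr_gt0.
  by rewrite le_eqVlt; apply/orP; left; apply/eqP; field; rewrite !gt_eqF.
have S1le' n : S1 n <= n%:R.
  rewrite -[n in leRHS]card_ord -sumr_const; apply: ler_sum => l _.
  by rewrite expRN_le1// !mulr_ge0// ltW.
have zE : z = dl * ((1 - expR (- y)) ^+ 2 * S1 i + S1 k).
  rewrite /z big_split_ord /=; congr (_ * (_ + _)).
    rewrite mulr_sumr (reindex_inj rev_ord_inj) /=; apply: eq_bigr => l _.
    have li := ltn_ord l.
    have -> : (i - l.+1 < i)%N by rewrite ltn_subrL (leq_ltn_trans _ li).
    rewrite mul1r subKn//; have -> : (i + k - (i - l.+1) = k + l.+1)%N by lia.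
    rewrite (_ : - (l.+1%:R * (2 * (dl * lam))) = - (l.+1%:R * dl * lam) + - (l.+1%:R * dl * lam)); last by ring.
    have -> : - ((k + l.+1)%:R * dl * lam) = - y + - (l.+1%:R * dl * lam).
      by rewrite /y natrD; ring.
    by rewrite !expRD; ring.
  rewrite (reindex_inj rev_ord_inj) /=; apply: eq_bigr => l _.
  have lk := ltn_ord l.
  rewrite ltnNge leq_addr mul0r subr0.
  have -> : (i + k - (i + (k - l.+1)) = l.+1)%N by lia.
  rewrite -expRM_natl; congr expR; ring.
set q := 1 - expR (- y) in zE.
have q01 : 0 <= q <= 1 by rewrite /q; have := expRN_le1 y0; have := expR_ge0 (- y); lra.
have qy : q <= y by rewrite /q; have := expR_ge1Dx (- y); lra.
have q2 : q ^+ 2 <= y by nra.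
have q21 : q ^+ 2 <= 1 by nra.
have S10 n : 0 <= S1 n by apply: sumr_ge0 => ? _; exact: expR_ge0.
have P n : 0 <= dl * S1 n by rewrite mulr_ge0// ltW.
have e1 : y * (2 * lam)^-1 = k%:R * dl / 2 by rewrite /y; field; rewrite gt_eqF.
have l2 : 0 <= (2 * lam)^-1 by rewrite invr_ge0 mulr_ge0 ?ltW.
have kd : 0 <= k%:R * dl by rewrite mulr_ge0// ltW.
have e2 : 2 / lam = 4 * (2 * lam)^-1 by field; rewrite gt_eqF.
rewrite zE mulrDr mulrCA; split.
  have a1 : q ^+ 2 * (dl * S1 i) <= y * (2 * lam)^-1 by apply: ler_pM => //; exact: sqr_ge0.
  have a2 : dl * S1 k <= k%:R * dl by rewrite mulrC ler_pM2r.
  lra.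
have a1 : q ^+ 2 * (dl * S1 i) <= 1 * (2 * lam)^-1 by apply: ler_pM => //; exact: sqr_ge0.
have := S1le k; lra.
Qed.

End increments.

(** * Mean square estimates for the noise *)

Section density.
Context d (T : measurableType d) (R : realType).
Variables (mu nu : {measure set T -> \bar R}) (p : T -> R).
Hypotheses (p0 : forall x, 0 <= p x) (mp : measurable_fun setT p)
  (nuE : forall A, measurable A -> nu A = (\int[mu]_(x in A) (p x)%:E)%E).
Import HBNNSimple.
Local Open Scope ereal_scope.

(** True for indicators by [nuE], for simple functions by linearity, in general by monotone
    convergence on both sides. *)
Lemma ge0_integral_density (f : T -> \bar R) : measurable_fun setT f -> (forall x, 0 <= f x) ->
  \int[nu]_x f x = \int[mu]_x (f x * (p x)%:E).
Proof.
move=> mf f0; pose h := nnsfun_approx measurableT mf.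
have mpE : measurable_fun setT (EFin \o p) by exact/measurable_EFinP.
have indich m r : measurable_fun setT (fun x => (r * \1_(h m @^-1` [set r]) x)%:E).
  by apply/measurable_EFinP/measurable_funM.
have indic1 m r : measurable_fun setT (fun x => (\1_(h m @^-1` [set r]) x : R)%:E).
  by apply/measurable_EFinP; exact: measurable_indic.
have -> : \int[nu]_x f x = lim (\int[nu]_x (h n x)%:E @[n --> \oo]).
  have fE x : f x = lim ((h n x)%:E @[n --> \oo]).
    by apply/esym/cvg_lim => //; exact: cvg_nnsfun_approx.
  under eq_integral => x _ do rewrite fE.
  apply: monotone_convergence => //.
  - by move=> n; exact/measurable_EFinP/measurable_funP.
  - by move=> n x _; rewrite lee_fin.
  - by move=> x _ a b ab; rewrite lee_fin; exact/lefP/nd_nnsfun_approx.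
have -> : \int[mu]_x (f x * (p x)%:E) = lim (\int[mu]_x ((h n x)%:E * (p x)%:E) @[n --> \oo]).
  have fE x : f x * (p x)%:E = lim (((h n x)%:E * (p x)%:E) @[n --> \oo]).
    apply/esym/cvg_lim => //; apply: cvgeZr => //.
    exact: cvg_nnsfun_approx.
  under eq_integral => x _ do rewrite fE.
  apply: monotone_convergence => //.
  - move=> n; apply/emeasurable_funM => //.
    exact/measurable_EFinP/measurable_funP.
  - by move=> n x _; rewrite mule_ge0 ?lee_fin.
  - by move=> x _ a b ab; rewrite lee_wpmul2r ?lee_fin//; exact/lefP/nd_nnsfun_approx.
suff -> : (fun n => \int[mu]_x ((h n x)%:E * (p x)%:E)) = (fun n => \int[nu]_x (h n x)%:E) by [].
apply/funext => n; apply/esym.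
under eq_integral do rewrite fimfunE -fsumEFin//.
rewrite ge0_integral_fsum//; last 2 first.
- by move=> r; exact: indich.
- by move=> r x _; exact: nnfun_muleindic_ge0.
under [RHS]eq_integral => x _.
  rewrite fimfunE -fsumEFin// ge0_mule_fsuml; last by move=> r; exact: nnfun_muleindic_ge0.
  over.
rewrite ge0_integral_fsum//; last 2 first.
- by move=> r; apply: emeasurable_funM => //; exact: indich.
- by move=> r x _; rewrite mule_ge0 ?nnfun_muleindic_ge0 ?lee_fin.
apply: eq_fsbigr => r; rewrite inE => -[x _ hx].
have r0 : (0 <= r)%R by rewrite -hx.
under eq_integral do rewrite EFinM.
rewrite ge0_integralZl//; last exact: indic1.
under [RHS]eq_integral do rewrite EFinM -muleA.
rewrite ge0_integralZl//; last 2 first.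
- by apply: emeasurable_funM => //; exact: indic1.
- by move=> y _; rewrite mule_ge0 ?lee_fin.
congr (_ * _); rewrite integral_indic// setIT nuE// integral_mkcond.
apply: eq_integral => y _.
by rewrite patchE indicE; case: ifPn => _; rewrite ?mul1e ?mul0e.
Qed.

End density.

Section normal_moments.
Context {R : realType}.
Local Open Scope ring_scope.
Local Notation mu := (@lebesgue_measure R).

Lemma normal_pdf0E (s x : R) : s != 0 -> normal_pdf 0 s x =
  (Num.sqrt (s ^+ 2 * pi *+ 2))^-1 * expR (- (x ^+ 2) / (s ^+ 2 *+ 2)).
Proof.
by move=> s0; rewrite normal_pdfE// /normal_pdf /normal_peak /normal_fun subr0.
Qed.

(* With y = x^2 / (2 s^2), y exp(-y) <= 2 exp(-y/2), and the right-hand side is the density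
   for the variance 2 s^2 up to a constant. *)
Lemma sqr_normal_pdf_le (s x : R) : 0 < s ->
  x ^+ 2 * normal_pdf 0 s x <= 8 * s ^+ 2 * normal_pdf 0 (Num.sqrt 2 * s) x.
Proof.
move=> s0; have s20 : Num.sqrt 2 * s != 0 by rewrite mulf_neq0 ?gt_eqF ?sqrtr_gt0.
have sN0 : s != 0 by rewrite gt_eqF.
rewrite !normal_pdf0E//.
have e2 : (Num.sqrt 2 * s) ^+ 2 = 2 * s ^+ 2 :> R by rewrite exprMn sqr_sqrtr.
rewrite e2; set q := s ^+ 2; have q0 : 0 < q by rewrite exprn_gt0.
have pi0 := pi_gt0 R.
set u := x ^+ 2 / (q * 4).
have u0 : 0 <= u by rewrite divr_ge0 ?sqr_ge0// mulr_ge0// ltW.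
have x2 : x ^+ 2 = 4 * q * u by rewrite /u; field; rewrite gt_eqF.
have -> : - x ^+ 2 / (q *+ 2) = - u + - u by rewrite /u; field; rewrite gt_eqF.
have -> : - x ^+ 2 / (2 * q *+ 2) = - u by rewrite /u; field; rewrite gt_eqF.
have sq : Num.sqrt (2 * q * pi *+ 2) = Num.sqrt 2 * Num.sqrt (q * pi *+ 2) :> R.
  by rewrite -sqrtrM//; congr Num.sqrt; ring.
set k := Num.sqrt (q * pi *+ 2) in sq *.
have k0 : 0 < k by rewrite sqrtr_gt0 mulrn_wgt0// mulr_gt0.
rewrite sq expRD x2 invfM.
have h1 : u * expR (- u) <= 1.
  have := expR_ge1Dx u; rewrite expRN ler_pdivrMr ?expR_gt0//; lra.
have h2 : 1 / 2 <= (Num.sqrt 2)^-1 :> R.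
  rewrite div1r lef_pV2 ?posrE ?sqrtr_gt0//.
  by rewrite -(@ler_pXn2r _ 2)// ?nnegrE ?sqrtr_ge0// sqr_sqrtr//; lra.
have E0 := expR_ge0 (- u).
have K0 : 0 < k^-1 by rewrite invr_gt0.
apply: (@le_trans _ _ (4 * q * (k^-1 * expR (- u)) * 1)).
  rewrite (_ : 4 * q * u * _ = 4 * q * (k^-1 * expR (- u)) * (u * expR (- u))); last by ring.
  by apply: ler_wpM2l => //; rewrite !mulr_ge0// ltW.
rewrite mulr1 (_ : 8 * q * _ = 4 * q * (k^-1 * expR (- u)) * (2 * (Num.sqrt 2)^-1)); last by ring.
by rewrite ler_peMr ?mulr_ge0 ?(ltW q0) ?(ltW K0)//; lra.
Qed.

Lemma normal_prob_opp (s : R) (A : set R) : 0 < s -> measurable A ->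
  normal_prob 0 s (-%R @^-1` A) = normal_prob 0 s A.
Proof.
move=> s0 mA; rewrite /normal_prob.
under eq_integral => x _.
  have -> : normal_pdf 0 s x = normal_pdf 0 s (- x) by rewrite !normal_pdf0E ?gt_eqF// sqrrN.
  over.
have mf : measurable_fun A (fun x => (normal_pdf 0 s x)%:E).
  by apply/measurable_EFinP/measurable_funTS; exact: measurable_normal_pdf.
transitivity (\int[mu]_(x in (-%R : _ -> measurableTypeR R) @^-1` A)
    ((fun x : R => (normal_pdf 0 s x)%:E) \o (-%R : _ -> measurableTypeR R)) x)%E; first by [].
rewrite -ge0_integral_pushforward//=; last by move=> y _; rewrite lee_fin normal_pdf_ge0.
by apply: eq_measure_integral => B mB _; exact: lebesgue_measureN.
Qed.

(** The exact value is s^2. Domination by the density of variance 2 s^2, of total mass 1, gives the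
    factor 8 that propagates into the noise constants. *)
Lemma normal_second_moment (s : R) : 0 < s ->
  (\int[normal_prob 0 s]_x (x ^+ 2)%:E <= (8 * s ^+ 2)%:E)%E.
Proof.
move=> s0; have ms : measurable_fun setT (fun x : R => (x ^+ 2)%:E).
  by apply/measurable_EFinP; exact: measurable_funX.
rewrite (@ge0_integral_density _ _ R mu (normal_prob 0 s) (normal_pdf 0 s) (normal_pdf_ge0 0 s)
  (measurable_normal_pdf 0 s) (fun _ _ => erefl) _ ms); last by move=> x; rewrite lee_fin sqr_ge0.
have H : (\int[mu]_x ((x ^+ 2)%:E * (normal_pdf 0 s x)%:E) <=
    \int[mu]_x ((8 * s ^+ 2)%:E * (normal_pdf 0 (Num.sqrt 2 * s) x)%:E))%E.
  apply: ge0_le_integral => //.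
  - by move=> x _; rewrite mule_ge0// lee_fin ?sqr_ge0 ?normal_pdf_ge0.
  - by apply: emeasurable_funM => //; apply/measurable_EFinP; exact: measurable_normal_pdf.
  - by apply: emeasurable_funM => //; apply/measurable_EFinP; exact: measurable_normal_pdf.
  - by move=> x _; rewrite -!EFinM lee_fin sqr_normal_pdf_le.
apply: (le_trans H); rewrite ge0_integralZl//; last 3 first.
- by apply/measurable_EFinP; exact: measurable_normal_pdf.
- by move=> x _; rewrite lee_fin normal_pdf_ge0.
- by rewrite lee_fin mulr_ge0// sqr_ge0.
by rewrite integral_normal_pdf mule1.
Qed.

End normal_moments.

Section normal_variables.
Context {R : realType} d {O : measurableType d} (P : probability O R).
Implicit Types X Y : O -> R.

Definition normal_law (s : R) X := measurable_fun setT X /\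
  forall B, measurable B -> P (X @^-1` B) = normal_prob 0 s B.

Definition indep2 X Y := forall A B : set R, measurable A -> measurable B ->
  P (X @^-1` A `&` Y @^-1` B) = (P (X @^-1` A) * P (Y @^-1` B))%E.

Lemma normal_law_moment (s : R) X : 0 < s -> normal_law s X ->
  (\int[P]_w ((X w) ^+ 2)%:E <= (8 * s ^+ 2)%:E)%E.
Proof.
move=> s0 [mX lX]; have ms : measurable_fun setT (fun x : R => (x ^+ 2)%:E).
  by apply/measurable_EFinP; exact: measurable_funX.
apply: le_trans (normal_second_moment s0).
have mX' : measurable_fun setT (X : O -> measurableTypeR R) by exact: mX.
pose Xp : {mfun O >-> measurableTypeR R} := HB.pack (X : O -> measurableTypeR R) (isMeasurableFun.Build _ _ _ _ _ mX').
have -> : (\int[P]_w ((X w) ^+ 2)%:E = \int[distribution P Xp]_x (x ^+ 2)%:E)%E.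
  by rewrite ge0_integral_distribution// => y; rewrite lee_fin sqr_ge0.
rewrite le_eqVlt; apply/orP; left; apply/eqP.
by apply: eq_measure_integral => B mB _; exact: lX.
Qed.

(* A centered normal X has the same law as -X, so independence makes (X, Y) and (-X, Y) equal in law. *)
Lemma indep_normal_mul0 (s : R) X Y : 0 < s -> normal_law s X -> measurable_fun setT Y -> indep2 X Y ->
  P.-integrable setT (fun w => (X w * Y w)%:E) -> (\int[P]_w (X w * Y w)%:E = 0)%E.
Proof.
move=> s0 [mX lX] mY XY iXY.
pose X' := (fun w => - X w).
have mX' : measurable_fun setT X' by exact: measurableT_comp.
have lX' B : measurable B -> P (X' @^-1` B) = normal_prob 0 s B.
  move=> mB; rewrite -normal_prob_opp//.
  have mNB : measurable (-%R @^-1` B : set R).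
    by rewrite -[X in measurable X]setTI; exact: oppr_measurable.
  by rewrite -lX.
have X'Y : forall A B : set R, measurable A -> measurable B ->
    P (X' @^-1` A `&` Y @^-1` B) = (P (X' @^-1` A) * P (Y @^-1` B))%E.
  move=> A B mA mB; have mNA : measurable (-%R @^-1` A : set R).
    by rewrite -[X in measurable X]setTI; exact: oppr_measurable.
  exact: (XY _ _ mNA mB).
have mYr : measurable_fun setT (Y : O -> measurableTypeR R) by exact: mY.
pose Yp : {mfun O >-> measurableTypeR R} :=
  HB.pack (Y : O -> measurableTypeR R) (isMeasurableFun.Build _ _ _ _ _ mYr).
pose Z (w : O) : measurableTypeR R * measurableTypeR R := (X w, Y w).
pose Z' (w : O) : measurableTypeR R * measurableTypeR R := (X' w, Y w).
have mZ : measurable_fun setT Z by exact: measurable_fun_pair.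
have mZ' : measurable_fun setT Z' by exact: measurable_fun_pair.
pose Zp : {mfun O >-> (measurableTypeR R * measurableTypeR R)%type} :=
  HB.pack Z (isMeasurableFun.Build _ _ _ _ _ mZ).
pose Zp' : {mfun O >-> (measurableTypeR R * measurableTypeR R)%type} :=
  HB.pack Z' (isMeasurableFun.Build _ _ _ _ _ mZ').
have E1 := @product_measure_unique _ _ _ _ R (normal_prob 0 s) (distribution P Yp) (distribution P Zp).
have E2 := @product_measure_unique _ _ _ _ R (normal_prob 0 s) (distribution P Yp) (distribution P Zp').
have E S : measurable S -> distribution P Zp S = distribution P Zp' S.
  move=> mS; rewrite -E1//; last by move=> A B mA mB; exact: (etrans (XY A B mA mB) (congr1 (fun t => t * P (Y @^-1` B))%E (lX A mA))).
  rewrite -E2//.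
  by move=> A B mA mB; exact: (etrans (X'Y A B mA mB) (congr1 (fun t => t * P (Y @^-1` B))%E (lX' A mA))).
pose g (z : measurableTypeR R * measurableTypeR R) := (z.1 * z.2 : R)%:E.
have mg : measurable_fun setT g.
  by apply/measurable_EFinP; apply: measurable_funM; [exact: measurable_fst|exact: measurable_snd].
have iXY' : P.-integrable setT (g \o Zp').
  rewrite (_ : g \o Zp' = (fun w => (-1)%:E * (X w * Y w)%:E)%E); last first.
    by apply/funext => w; rewrite /g /= -EFinM mulN1r mulNr.
  exact: integrableZl.
have H : (\int[P]_w (X w * Y w)%:E = \int[P]_w ((-1)%:E * (X w * Y w)%:E))%E.
  transitivity (\int[distribution P Zp]_z g z)%E; first by rewrite integral_distribution.
  transitivity (\int[distribution P Zp']_z g z)%E.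
    by apply: eq_measure_integral => S mS _; exact: E.
  rewrite integral_distribution//; apply: eq_integral => w _.
  by rewrite /g /= -EFinM mulN1r mulNr.
move: H; rewrite integralZl//.
have := integrable_fin_num measurableT iXY.
case: (\int[P]_w _)%E => // r _; rewrite -EFinM => -[] h.
by congr (_%:E); lra.
Qed.

End normal_variables.

(** * Calculus of expectation bounds *)

Section expectation_bounds.
Context {R : realType} d {O : measurableType d} (P : probability O R).
Implicit Types (f g : O -> R) (A B c : R).

(** Measurability and sign travel with the bound, so that bounds combine without separate
    integrability conditions. *)
Definition Ebound f B := [/\ measurable_fun setT f, (forall w, 0 <= f w) &
  (\int[P]_w (f w)%:E <= B%:E)%E].

Lemma Ebound_le f g B : measurable_fun setT f -> (forall w, 0 <= f w) ->
  {ae P, forall w, f w <= g w} -> Ebound g B -> Ebound f B.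
Proof.
move=> mf f0 fg [mg g0 gB]; split => //; apply: le_trans gB.
apply: ae_ge0_le_integral => //; [by move=> w _; rewrite lee_fin|exact/measurable_EFinP|
  by move=> w _; rewrite lee_fin|exact/measurable_EFinP|].
by case: fg => N [mN PN sN]; exists N; split => // w /= Hw; apply: sN => /= h; apply: Hw => _; rewrite lee_fin.
Qed.

Lemma Ebound_leT f g B : measurable_fun setT f -> (forall w, 0 <= f w) ->
  (forall w, f w <= g w) -> Ebound g B -> Ebound f B.
Proof. by move=> mf f0 fg; apply: Ebound_le => //; exact: aeW. Qed.

Lemma EboundW f A B : A <= B -> Ebound f A -> Ebound f B.
Proof. by move=> AB [? ? /le_trans fA]; split => //; apply: fA; rewrite lee_fin. Qed.

Lemma EboundD f g A B : Ebound f A -> Ebound g B -> Ebound (fun w => f w + g w) (A + B).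
Proof.
move=> [mf f0 fA] [mg g0 gB]; split; [exact: measurable_funD|by move=> w; rewrite addr_ge0|].
under eq_integral do rewrite EFinD.
rewrite ge0_integralD//; [by rewrite EFinD leeD|by move=> w _; rewrite lee_fin|exact/measurable_EFinP|
  by move=> w _; rewrite lee_fin|exact/measurable_EFinP].
Qed.

Lemma EboundZ c f A : 0 <= c -> Ebound f A -> Ebound (fun w => c * f w) (c * A).
Proof.
move=> c0 [mf f0 fA]; split; [exact: measurable_funM|by move=> w; rewrite mulr_ge0|].
under eq_integral do rewrite EFinM.
rewrite ge0_integralZl_EFin//; [by rewrite EFinM lee_pmul// ?lee_fin//; apply: integral_ge0 => w _; rewrite lee_fin|
  by move=> w _; rewrite lee_fin|exact/measurable_EFinP].
Qed.

Lemma Ebound_cst c : 0 <= c -> Ebound (fun=> c) c.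
Proof.
move=> c0; split => //; rewrite integral_cst//.
by rewrite [X in (_ * X)%E]probability_setT mule1.
Qed.

Lemma Ebound_sum (I : Type) (r : seq I) (f : I -> O -> R) (b : I -> R) :
  (forall i, Ebound (f i) (b i)) -> Ebound (fun w => \sum_(i <- r) f i w) (\sum_(i <- r) b i).
Proof.
move=> H; elim: r => [|i r IH].
  by rewrite big_nil; under eq_fun do rewrite big_nil; exact: Ebound_cst.
by rewrite big_cons; under eq_fun do rewrite big_cons; exact: EboundD.
Qed.

Lemma Ebound_eps f B : (forall e, 0 < e -> Ebound f (B + e)) -> Ebound f B.
Proof.
move=> H; have [mf f0 _] := H 1 ltr01; split => //.
by apply/lee_addgt0Pr => e e0; rewrite -EFinD; have [] := H e e0.
Qed.

Lemma limn_einf_ge0 (u : nat -> \bar R) : (forall n, (0 <= u n)%E) -> (0 <= limn_einf u)%E.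
Proof.
move=> u0; rewrite limn_einf_lim; apply: lime_ge; first exact: is_cvg_einfs.
by apply: nearW => n; apply: le_ereal_inf_tmp => _ [k _ <-].
Qed.

Lemma limn_einf_le (u : nat -> \bar R) (b : \bar R) : (forall n, (u n <= b)%E) -> (limn_einf u <= b)%E.
Proof.
move=> ub; rewrite limn_einf_lim; apply: lime_le; first exact: is_cvg_einfs.
apply: nearW => n; apply: le_trans (ub n).
by apply: ereal_inf_lbound; exists n => //=.
Qed.

Lemma Ebound_fatou (f : nat -> O -> R) g B : (forall n, Ebound (f n) B) ->
  measurable_fun setT g -> (forall w, 0 <= g w) ->
  {ae P, forall w, f n w @[n --> \oo] --> g w} -> Ebound g B.
Proof.
move=> Hf mg g0 fg; split => //.
have mf n : measurable_fun setT (fun w => (f n w)%:E) by apply/measurable_EFinP; have [] := Hf n.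
have f0 n w : (0 <= (f n w)%:E)%E by rewrite lee_fin; have [_ + _] := Hf n; apply.
have H := @fatou _ _ _ P setT measurableT (fun n w => (f n w)%:E) mf (fun n w _ => f0 n w).
have le1 : (\int[P]_w (g w)%:E <= \int[P]_w limn_einf (fun n => (f n w)%:E))%E.
  apply: ae_ge0_le_integral => //.
  - by move=> w _; rewrite lee_fin.
  - exact/measurable_EFinP.
  - move=> w _; apply: limn_einf_ge0 => n; exact: f0.
  - under eq_fun do rewrite -[limn_einf _]oppeK -limn_esupN.
    apply: measurableT_comp => //; apply: measurable_fun_limn_esup => n.
    exact: measurableT_comp.
  - case: fg => N [mN PN sN]; exists N; split => // w /= Hw; apply: sN => /= h; apply: Hw => _.
    have hE : (f n w)%:E @[n --> \oo] --> (g w)%:E by apply: cvg_EFin => //; exact: nearW.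
    by have [-> _] := cvg_limn_einf_sup hE.
apply: (le_trans le1); apply: (le_trans H).
by apply: limn_einf_le => n; have [] := Hf n.
Qed.

End expectation_bounds.

Section orthogonal.
Context {R : realType} d {O : measurableType d} (P : probability O R).
Implicit Types (X Y : O -> R).

Lemma Ebound_integrable X (a : R) : Ebound P X a -> P.-integrable setT (fun w => (X w)%:E).
Proof.
move=> [mX X0 Xa]; apply/integrableP; split; first exact/measurable_EFinP.
under eq_integral do rewrite gee0_abs ?lee_fin//.
by apply: (le_lt_trans Xa); rewrite ltry.
Qed.

Lemma mul_integrable X Y (a b : R) : measurable_fun setT X -> measurable_fun setT Y ->
  Ebound P (fun w => X w ^+ 2) a -> Ebound P (fun w => Y w ^+ 2) b ->
  P.-integrable setT (fun w => (X w * Y w)%:E).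
Proof.
move=> mX mY bX bY.
have iXY := Ebound_integrable (EboundD bX bY).
apply: (le_integrable measurableT _ _ iXY); first by apply/measurable_EFinP/measurable_funM.
move=> w _; rewrite !abse_EFin lee_fin normrM [leRHS]ger0_norm ?addr_ge0 ?sqr_ge0//.
rewrite -(real_normK (num_real (X w))) -(real_normK (num_real (Y w))).
by have := normr_ge0 (X w); have := normr_ge0 (Y w); have := sqr_ge0 (`|X w| - `|Y w|); nra.
Qed.

(** Pythagoras: the cross terms of the expanded square integrate to 0, and v bounds the diagonal
    ones. *)
Lemma orth_sum (I : finType) (X : I -> O -> R) (v : R) (c : I -> R) :
  (forall i, measurable_fun setT (X i)) -> (forall i, Ebound P (fun w => X i w ^+ 2) v) ->
  (forall i j, i != j -> (\int[P]_w (X i w * X j w)%:E = 0)%E) ->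
  Ebound P (fun w => (\sum_i c i * X i w) ^+ 2) (\sum_i c i ^+ 2 * v).
Proof.
move=> mX bX oX; split; last first.
- have iX i j : P.-integrable setT (fun w => (X i w * X j w)%:E) by apply: mul_integrable.
  have -> : (\int[P]_w ((\sum_i c i * X i w) ^+ 2)%:E =
     \int[P]_w (\sum_i \sum_j (c i * c j)%:E * (X i w * X j w)%:E))%E.
    apply: eq_integral => w _; rewrite expr2 big_distrlr /= -sumEFin; apply: eq_bigr => i _.
    by rewrite -sumEFin; apply: eq_bigr => j _; rewrite -EFinM; congr EFin; ring.
  rewrite integral_sum//; last by move=> i; apply: integrable_sum => // j _; exact: integrableZl.
  rewrite -sumEFin; apply: lee_sum => i _.
  rewrite integral_sum//; last by move=> j; exact: integrableZl.
  rewrite (bigD1 i)//= big1 ?adde0; last by move=> j ji; rewrite integralZl// oX ?mule0// eq_sym.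
  rewrite integralZl// -expr2 [leRHS]EFinM lee_wpmul2l ?lee_fin ?sqr_ge0//.
  by have [_ _] := bX i.
- by move=> w; rewrite sqr_ge0.
- by apply: measurable_funX; apply: measurable_sum => i; exact: measurable_funM.
Qed.

End orthogonal.

Section sub_sigma_algebra.
Context {R : realType} d {O : measurableType d} (G : set_system O).

(** Phrased with the generated sigma-algebra, it serves both for [Filt s], which generation leaves
    unchanged, and for the generating events of a process. *)
Definition measurable_wrt (f : O -> R) := forall B, measurable B -> <<s G>> (f @^-1` B).

Lemma measurable_wrtB f g : measurable_wrt f -> measurable_wrt g ->
  measurable_wrt (fun w => f w - g w).
Proof.
move=> mf mg.
have mF : measurable_fun setT (f : g_sigma_algebraType G -> R).
  by move=> _ B mB; rewrite setTI; exact: mf.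
have mG : measurable_fun setT (g : g_sigma_algebraType G -> R).
  by move=> _ B mB; rewrite setTI; exact: mg.
have mB : measurable_fun setT (fun w : g_sigma_algebraType G => f w - g w) by exact: measurable_funB.
by move=> B mB'; have := mB measurableT B mB'; rewrite setTI.
Qed.

End sub_sigma_algebra.

(** * Independence of Wiener increments *)

Section wiener.
Context {R : realType} d {O : measurableType d} (P : probability O R).
Variables (Filt : R -> set_system O) (beta : nat -> R -> O -> R).
Hypotheses (Filt_usual : usual_filtration P Filt)
  (beta_wiener : forall m, standard_wiener P Filt (beta m))
  (beta_independent : independent_processes P beta).

Lemma beta_measurable j (t : R) : 0 <= t -> measurable_fun setT (beta j t).
Proof.
move=> t0 _ B mB; rewrite setTI; have [_ _ ad _ _] := beta_wiener j.
by have [H _ _ _] := Filt_usual; have [_] := H t t0; apply; exact: ad.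
Qed.

Lemma increment_law j (s t : R) : 0 <= s -> s < t ->
  normal_law P (Num.sqrt (t - s)) (increment (beta j) s t).
Proof.
move=> s0 st; split; last by have [_ _ _ H _] := beta_wiener j; exact: H.
by apply: measurable_funB; apply: beta_measurable; lra.
Qed.

Lemma Filt_s t : 0 <= t -> <<s Filt t>> = Filt t.
Proof. by move=> t0; have [H _ _ _] := Filt_usual; have [H1 _] := H t t0; exact: sigma_algebra_id. Qed.

(** The earlier increment is measurable for [Filt s'], of which the later one is independent. *)
Lemma increment_indep_time j (s t s' t' : R) : 0 <= s -> s < t -> t <= s' -> s' < t' ->
  indep2 P (increment (beta j) s' t') (increment (beta j) s t).
Proof.
move=> s0 st ts st' A B mA mB; have [_ _ ad _ H] := beta_wiener j.
have [_ mono _ _] := Filt_usual.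
have w u : 0 <= u -> u <= s' -> measurable_wrt (Filt s') (beta j u).
  move=> u0 us C mC; rewrite Filt_s; last by lra.
  by apply: (mono u s') => //; exact: ad.
have FB : Filt s' (increment (beta j) s t @^-1` B).
  rewrite -Filt_s; last by lra.
  by apply: measurable_wrtB => //; apply: w; lra.
by rewrite setIC muleC; apply: H => //; lra.
Qed.

Lemma increment_indep_index j j' (s t s' t' : R) : j != j' -> 0 <= s -> s < t -> 0 <= s' -> s' < t' ->
  indep2 P (increment (beta j) s t) (increment (beta j') s' t').
Proof.
move=> jj s0 st s0' st' A B mA mB.
have w k u : 0 <= u -> measurable_wrt [set A | exists t B, [/\ 0 <= t, measurable B & A = beta k t @^-1` B] ] (beta k u).
  by move=> u0 C mC; apply: sub_gen_smallest; exists u, C; split.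
have := @beta_independent [:: j; j'] (fun k => if k == j then increment (beta j) s t @^-1` A
   else increment (beta j') s' t' @^-1` B).
rewrite /= inE jj => /(_ isT) H.
have := H _; rewrite !big_cons !big_nil eqxx eq_sym (negbTE jj) setIT mule1; apply.
move=> k; rewrite !inE => /orP[/eqP->|/eqP->].
  by rewrite eqxx; apply: measurable_wrtB => //; apply: w; lra.
by rewrite eq_sym (negbTE jj); apply: measurable_wrtB => //; apply: w; lra.
Qed.

End wiener.

Section finite_sums.
Context {R : realType}.

Lemma sum_cauchy_schwarz (I : Type) (r : seq I) (a b : I -> R) :
  (\sum_(i <- r) a i * b i) ^+ 2 <= (\sum_(i <- r) a i ^+ 2) * (\sum_(i <- r) b i ^+ 2).
Proof.
have A0 : 0 <= \sum_(i <- r) a i ^+ 2 by apply: sumr_ge0 => i _; exact: sqr_ge0.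
have B0 : 0 <= \sum_(i <- r) b i ^+ 2 by apply: sumr_ge0 => i _; exact: sqr_ge0.
have H t : 0 <= \sum_(i <- r) a i ^+ 2 + 2 * t * (\sum_(i <- r) a i * b i) + t ^+ 2 * (\sum_(i <- r) b i ^+ 2).
  have -> : \sum_(i <- r) a i ^+ 2 + 2 * t * (\sum_(i <- r) a i * b i) + t ^+ 2 * (\sum_(i <- r) b i ^+ 2) =
     \sum_(i <- r) (a i + t * b i) ^+ 2.
    by rewrite !mulr_sumr -!big_split; apply: eq_bigr => i _ /=; ring.
  by apply: sumr_ge0 => i _; exact: sqr_ge0.
move: A0 B0 H; set A := \sum_(i <- r) a i ^+ 2; set B := \sum_(i <- r) b i ^+ 2; set C := \sum_(i <- r) _ => A0 B0 H.
move: B0; rewrite le_eqVlt => /predU1P[v0|v0].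
  have [->|uv] := eqVneq C 0; first by rewrite expr0n /= -v0 mulr0.
  have := H (- (A + 1) / (2 * C)); rewrite -v0 mulr0 addr0.
  have -> : 2 * (- (A + 1) / (2 * C)) * C = - (A + 1) by field.
  lra.
have := H (- C / B).
have -> : A + 2 * (- C / B) * C + (- C / B) ^+ 2 * B = (A * B - C ^+ 2) / B by field; rewrite gt_eqF.
by rewrite pmulr_lge0 ?invr_gt0// subr_ge0.
Qed.

(** Against a function constant on blocks of M cells, the fine increments telescope to the block
    increments; this places the scheme on the fine grid. *)
Lemma block_telescope (f w : nat -> R) k M :
  \sum_(l < k * M) f (l %/ M)%N * (w l.+1 - w l) = \sum_(i < k) f i * (w (i.+1 * M)%N - w (i * M)%N).
Proof.
case: (posnP M) => [->|M0].
  rewrite muln0 big_ord0 big1// => i _; by rewrite !muln0 subrr mulr0.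
elim: k => [|k IH]; first by rewrite mul0n !big_ord0.
rewrite big_ord_recr /= -IH mulSn addnC big_split_ord /=; congr (_ + _).
under eq_bigr => l _ do rewrite divnMDl// (divn_small (ltn_ord l)) addn0 -addnS.
rewrite -mulr_sumr; congr (_ * _).
rewrite -(big_mkord xpredT (fun l => w (k * M + l.+1)%N - w (k * M + l)%N)).
by rewrite telescope_sumr// addn0 addnC.
Qed.

Lemma sqrD_le (a b : R) : (a + b) ^+ 2 <= 2 * a ^+ 2 + 2 * b ^+ 2.
Proof. by have := sqr_ge0 (a - b); nra. Qed.

End finite_sums.

Lemma ler0n2 (R : realType) : 0 <= 2 :> R. Proof. by []. Qed.
Arguments ler0n2 {R}.

(** * Ito's isometry for step integrands *)

Section noise.
Context {R : realType} d {O : measurableType d} (P : probability O R).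
Variables (Filt : R -> set_system O) (beta : nat -> R -> O -> R).
Hypotheses (Filt_usual : usual_filtration P Filt)
  (beta_wiener : forall m, standard_wiener P Filt (beta m))
  (beta_independent : independent_processes P beta).
Variables (N : nat) (q : nat -> R) (c : nat -> 'I_N -> R) (wt : 'I_N -> R) (kappa : R).
Hypotheses (q0 : forall j, 0 <= q j) (wt0 : forall m, 0 <= wt m)
  (kappaP : forall J, \sum_m wt m * (\sum_(j < J) q j * c j m ^+ 2) <= kappa).

Local Notation sumsq f := (fun w => \sum_(m < N) (f w m) ^+ 2).

(** In the application [c j m] is the coordinate of [eps j] on the m-th discrete eigenvector, and
    [wt m] is the m-th eigenvalue to the power be - 1. *)
Definition truncated_noise J (t : R) (w : O) (m : 'I_N) : R :=
  \sum_(j < J) Num.sqrt (q j) * c j m * beta j t w.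

Variable W : R -> O -> 'I_N -> R.
Hypotheses (mW : forall t m, 0 <= t -> measurable_fun setT (fun w => W t w m))
  (W_lim : forall t e, 0 <= t -> 0 < e -> exists J0, forall J, (J0 <= J)%N ->
     Ebound P (fun w => \sum_m (truncated_noise J t w m - W t w m) ^+ 2) e).

(** The increments of [beta j] over the cells l are orthogonal over the pairs (l, j): by
    independence in time for equal j, of the processes otherwise. The coefficients factor, so the
    kernel contributes G [wt m], and the weighted sums over j and m are at most kappa. *)
Lemma truncated_noise_sum J (dl G : R) n (g : 'I_N -> nat -> R) : 0 < dl -> 0 <= G ->
  (forall m, dl * (\sum_(l < n) g m l ^+ 2) <= G * wt m) ->
  Ebound P (fun w => \sum_m (\sum_(l < n) g m l *
    (truncated_noise J (l.+1%:R * dl) w m - truncated_noise J (l%:R * dl) w m)) ^+ 2) (8 * G * kappa).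
Proof.
move=> dl0 G0 Hg.
have st (l : nat) : 0 <= l%:R * dl :> R by rewrite mulr_ge0// ltW.
have lt (l : nat) : l%:R * dl < l.+1%:R * dl by rewrite ltr_pM2r// ltr_nat.
pose X (p : 'I_n * 'I_J) := increment (beta p.2) (p.1%:R * dl) (p.1.+1%:R * dl).
have stepE (l : nat) : l.+1%:R * dl - l%:R * dl = dl by rewrite -mulrBl -natr1 addrAC subrr add0r mul1r.
have XL p : normal_law P (Num.sqrt dl) (X p).
  by have := @increment_law _ _ _ _ _ _ Filt_usual beta_wiener p.2 _ _ (st p.1) (lt p.1); rewrite stepE.
have sd0 : 0 < Num.sqrt dl by rewrite sqrtr_gt0.
have mX p : measurable_fun setT (X p) by have [] := XL p.
have EX p : Ebound P (fun w => X p w ^+ 2) (8 * dl).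
  split; [exact: measurable_funX|by move=> w; exact: sqr_ge0|].
  by have := normal_law_moment sd0 (XL p); rewrite sqr_sqrtr// ltW.
have mono (l l' : nat) : (l < l')%N -> l.+1%:R * dl <= l'%:R * dl by move=> ll; rewrite ler_pM2r// ler_nat.
have oX p p' : p != p' -> (\int[P]_w (X p w * X p' w)%:E = 0)%E.
  move=> pp.
  have comm : (\int[P]_w (X p w * X p' w)%:E = \int[P]_w (X p' w * X p w)%:E)%E.
    by apply: eq_integral => w _; rewrite mulrC.
  have I1 : P.-integrable setT (fun w => (X p w * X p' w)%:E) by apply: mul_integrable.
  have I2 : P.-integrable setT (fun w => (X p' w * X p w)%:E) by apply: mul_integrable.
  have [jj|jj] := eqVneq (p.2 : nat) p'.2; last first.
    apply: (indep_normal_mul0 sd0 (XL p)) => //.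
    exact: (increment_indep_index beta_independent jj (st _) (lt _) (st _) (lt _)).
  have : (p.1 : nat) != p'.1.
    apply: contra pp => /eqP h; case: p p' jj h {comm I1 I2} => [x y] [x' y'] /= jj h.
    by rewrite xpair_eqE -!(inj_eq val_inj) /= h jj !eqxx.
  rewrite neq_ltn => /orP[ll|ll].
    rewrite comm; apply: (indep_normal_mul0 sd0 (XL p')) => //.
    by rewrite /X jj; apply: (increment_indep_time Filt_usual beta_wiener) => //; exact: mono.
  apply: (indep_normal_mul0 sd0 (XL p)) => //.
  by rewrite /X jj; apply: (increment_indep_time Filt_usual beta_wiener) => //; exact: mono.
pose co m (p : 'I_n * 'I_J) := g m p.1 * (Num.sqrt (q p.2) * c p.2 m).
have Hm m : Ebound P (fun w => (\sum_p co m p * X p w) ^+ 2) (8 * G * (wt m * \sum_(j < J) q j * c j m ^+ 2)).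
  apply: EboundW (orth_sum (co m) mX EX oX).
  rewrite -mulr_suml (_ : \sum_i co m i ^+ 2 = (\sum_(l < n) g m l ^+ 2) * (\sum_(j < J) q j * c j m ^+ 2)).
    have S0 : 0 <= \sum_(j < J) q j * c j m ^+ 2 by apply: sumr_ge0 => j _; rewrite mulr_ge0// sqr_ge0.
    by have := ler_wpM2r S0 (Hg m); lra.
  rewrite big_distrlr /= pair_big /=; apply: eq_bigr => -[l j] _ /=.
  by rewrite /co /= !exprMn sqr_sqrtr//.
have := Ebound_sum (index_enum 'I_N) Hm; rewrite -mulr_sumr => H.
apply: (@EboundW _ _ _ _ _ (8 * G * \sum_m wt m * (\sum_(j < J) q j * c j m ^+ 2))).
  by apply: ler_wpM2l; [rewrite mulr_ge0|exact: kappaP].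
congr (Ebound P _ _): H; apply/funext => w; apply: eq_bigr => m _; congr (_ ^+ 2).
transitivity (\sum_(l < n) \sum_(j < J) co m (l, j) * X (l, j) w).
  by rewrite pair_big /=; apply: eq_bigr => -[l j] _.
apply: eq_bigr => l _; rewrite /truncated_noise -sumrB mulr_sumr.
by apply: eq_bigr => j _; rewrite /co /X /increment /=; ring.
Qed.

(** W is replaced by a truncation that is accurate at all n + 1 grid points at once. The error of
    the replacement is arbitrarily small, and splitting the square doubles the 8. *)
Lemma noise_sum (dl G : R) n (g : 'I_N -> nat -> R) : 0 < dl -> 0 <= G ->
  (forall m, dl * (\sum_(l < n) g m l ^+ 2) <= G * wt m) ->
  Ebound P (fun w => \sum_m (\sum_(l < n) g m l * (W (l.+1%:R * dl) w m - W (l%:R * dl) w m)) ^+ 2)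
    (16 * G * kappa).
Proof.
move=> dl0 G0 Hg.
have st (l : nat) : 0 <= l%:R * dl :> R by rewrite mulr_ge0// ltW.
pose K := \sum_m \sum_(l < n) g m l ^+ 2.
have K0 : 0 <= K by apply: sumr_ge0 => m _; apply: sumr_ge0 => l _; exact: sqr_ge0.
apply: Ebound_eps => e e0.
(* Chosen so that 4 K n e' <= e / 2; the added 1s keep the denominator away from 0. *)
pose e' := e / (8 * (K + 1) * (n%:R + 1)).
have K1 : 0 < K + 1 by lra.
have n1 : 0 < n%:R + 1 :> R by have := ler0n R n; lra.
have e'0 : 0 < e' by rewrite divr_gt0// !mulr_gt0.
have [J HJ] : exists J, forall l, (l <= n)%N ->
    Ebound P (fun w => \sum_m (truncated_noise J (l%:R * dl) w m - W (l%:R * dl) w m) ^+ 2) e'.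
  have : exists J0, forall l, (l <= n)%N -> forall J, (J0 <= J)%N ->
      Ebound P (fun w => \sum_m (truncated_noise J (l%:R * dl) w m - W (l%:R * dl) w m) ^+ 2) e'.
    move: e' e'0 => e' e'0; clear -e'0 st W_lim; elim: n => [|k [J1 IH]].
      have [J0 H] := W_lim (st 0%N) e'0.
      by exists J0 => l; rewrite leqn0 => /eqP ->; exact: H.
    have [J0 H] := W_lim (st k.+1) e'0.
    exists (maxn J0 J1) => l; rewrite leq_eqVlt => /predU1P[->|]; last first.
      by rewrite ltnS => /IH{}H' J; rewrite geq_max => /andP[_ /H'].
    by move=> J; rewrite geq_max => /andP[/H].
  by move=> [J0 H]; exists J0 => l /H; apply.
have bT := truncated_noise_sum J dl0 G0 Hg.
set T := truncated_noise J in HJ bT.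
pose D l w m := T (l%:R * dl) w m - W (l%:R * dl) w m.
have mT l m : measurable_fun setT (fun w => T (l%:R * dl) w m).
  apply: measurable_sum => j; apply: measurable_funM => //.
  by apply: (beta_measurable Filt_usual beta_wiener).
have mWs l m : measurable_fun setT (fun w => W (l%:R * dl) w m) by exact: mW.
have bD : Ebound P (fun w => K * \sum_(l < n) (2 * \sum_m D l.+1 w m ^+ 2 + 2 * \sum_m D l w m ^+ 2)) (e / 2).
  apply: (@EboundW _ _ _ _ _ (K * \sum_(l < n) (2 * e' + 2 * e'))).
    have n0 := ler0n R n.
    have -> : \sum_(l < n) (2 * e' + 2 * e') = (2 * e' + 2 * e') * n%:R.
      by rewrite sumr_const card_ord mulr_natr.
    have -> : K * ((2 * e' + 2 * e') * n%:R) = e / 2 * (K / (K + 1)) * (n%:R / (n%:R + 1)).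
      by rewrite /e'; field; rewrite !gt_eqF.
    have k1 : K / (K + 1) <= 1 by rewrite ler_pdivrMr//; lra.
    have k2 : n%:R / (n%:R + 1) <= 1 :> R by rewrite ler_pdivrMr//; lra.
    have k3 : 0 <= K / (K + 1) by rewrite divr_ge0// ltW.
    have k4 : 0 <= n%:R / (n%:R + 1) :> R by rewrite divr_ge0// ltW.
    have k5 := ler_pM k3 k4 k1 k2; rewrite -mulrA; have : 0 <= e / 2 by lra.
    by move=> e2; rewrite mulr1 in k5; rewrite ler_piMr.
  apply: EboundZ => //; apply: Ebound_sum => l; apply: EboundD; apply: EboundZ => //; apply: HJ => //.
  exact: ltnW.
have -> : 16 * G * kappa + e = 2 * (8 * G * kappa) + 2 * (e / 2) by field.
apply: Ebound_leT (EboundD (EboundZ ler0n2 bT) (EboundZ ler0n2 bD)).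
- apply: measurable_sum => m; apply: measurable_funX; apply: measurable_sum => l.
  by apply: measurable_funM => //; exact: measurable_funB.
- by move=> w; apply: sumr_ge0 => m _; exact: sqr_ge0.
move=> w; rewrite mulr_sumr.
have -> : K * \sum_(l < n) (2 * \sum_m D l.+1 w m ^+ 2 + 2 * \sum_m D l w m ^+ 2) =
   \sum_m K * \sum_(l < n) (2 * D l.+1 w m ^+ 2 + 2 * D l w m ^+ 2).
  rewrite -mulr_sumr exchange_big /=; congr (_ * _); apply: eq_bigr => l _.
  by rewrite !mulr_sumr -big_split.
rewrite mulr_sumr -big_split /=; apply: ler_sum => m _.
set S1 := \sum_(l < n) g m l * (T _ w m - _).
have -> : \sum_(l < n) g m l * (W (l.+1%:R * dl) w m - W (l%:R * dl) w m) =
    S1 + - \sum_(l < n) g m l * (D l.+1 w m - D l w m).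
  by rewrite /S1 -sumrB; apply: eq_bigr => l _; rewrite /D; ring.
apply: (le_trans (sqrD_le _ _)); rewrite sqrrN lerD2l ler_pM2l//.
apply: (le_trans (sum_cauchy_schwarz _ _ _)).
apply: ler_pM.
- by apply: sumr_ge0 => l _; exact: sqr_ge0.
- by apply: sumr_ge0 => l _; exact: sqr_ge0.
- rewrite /K (bigD1 m)//= lerDl; apply: sumr_ge0 => m' _; apply: sumr_ge0 => l _; exact: sqr_ge0.
apply: ler_sum => l _; have := sqrD_le (D l.+1 w m) (- D l w m); by rewrite sqrrN.
Qed.

Definition ito_sum (lam : 'I_N -> R) (t : R) n w m :=
  \sum_(l < n) expR (- ((t - l%:R / n%:R * t) * lam m)) *
    (W (l.+1%:R / n%:R * t) w m - W (l%:R / n%:R * t) w m).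

Definition ito_limit (lam : 'I_N -> R) (t : R) (I : O -> 'I_N -> R) :=
  (forall m, measurable_fun setT (fun w => I w m)) /\
  forall e, 0 < e -> exists n0, forall n, (n0 <= n)%N ->
    Ebound P (fun w => \sum_m (ito_sum lam t n w m - I w m) ^+ 2) e.

Lemma ito_sum0 lam (t : R) n w m : t = 0 -> ito_sum lam t n w m = 0.
Proof.
move=> t0; rewrite /ito_sum big1// => l _.
have E k : k%:R / n%:R * t = 0 by rewrite t0 mulr0.
by rewrite !E subrr mulr0.
Qed.

(** Along numbers of cells that are multiples of i, the partition of [0, i tau] refines the time
    steps, so that sums with different final times share one grid. *)
Lemma ito_limit_grid lam (tau : R) i I : 0 < tau -> ito_limit lam (i%:R * tau) I ->
  forall e, 0 < e -> exists n0, forall M, (n0 <= M)%N -> (0 < M)%N ->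
    Ebound P (fun w => \sum_m (\sum_(l < i * M) expR (- ((i * M - l)%:R * (tau / M%:R) * lam m)) *
      (W (l.+1%:R * (tau / M%:R)) w m - W (l%:R * (tau / M%:R)) w m) - I w m) ^+ 2) e.
Proof.
move=> t0 [mI HI] e e0; have [n0 H] := HI e e0; exists n0 => M nM M0.
(* At i = 0 both the aligned sum and the sums that define the integral vanish, so any index
   serves. *)
case: i H {HI} => [|i] H.
  have := H n0 (leqnn _); congr (Ebound P _ _); apply/funext => w; apply: eq_bigr => m _.
  by rewrite mul0n big_ord0 ito_sum0// mul0r.
have := H (i.+1 * M)%N (leq_trans nM (leq_pmull _ _)); move=> /(_ isT).
congr (Ebound P _ _); apply/funext => w; apply: eq_bigr => m _; congr ((_ - _) ^+ 2).
have iN : i.+1%:R != 0 :> R by rewrite pnatr_eq0.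
have MN : M%:R != 0 :> R by rewrite pnatr_eq0 -lt0n.
apply: eq_bigr => l _.
have e2 k : k%:R / (i.+1 * M)%:R * (i.+1%:R * tau) = k%:R * (tau / M%:R).
  rewrite natrM; move: iN MN; move: (i.+1%:R : R) (M%:R : R) => u v u0 v0.
  by field; rewrite u0 v0.
have e3 : i.+1%:R * tau - l%:R * (tau / M%:R) = (i.+1 * M - l)%:R * (tau / M%:R).
  rewrite natrB; last exact: ltnW.
  rewrite natrM; move: MN; move: (i.+1%:R : R) (M%:R : R) => u v v0.
  by field.
by rewrite !e2 e3.
Qed.

End noise.

(** * Stochastic convolutions *)

Section ito_estimates.
Context {R : realType} d {O : measurableType d} (P : probability O R).
Variables (N : nat) (W : R -> O -> 'I_N -> R) (lam : 'I_N -> R) (be kappa : R).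

(** Besides measurability, the only property of the noise that the estimates below retain; the
    weight lam^(be - 1) is where the regularity of Q^(1/2) is spent. *)
Definition noise_bound := forall dl G n (g : 'I_N -> nat -> R), 0 < dl -> 0 <= G ->
  (forall m, dl * (\sum_(l < n) g m l ^+ 2) <= G * lam m `^ (be - 1)) ->
  Ebound P (fun w => \sum_m (\sum_(l < n) g m l * (W (l.+1%:R * dl) w m - W (l%:R * dl) w m)) ^+ 2)
    (16 * G * kappa).

Hypotheses (noiseP : noise_bound) (mW : forall t m, 0 <= t -> measurable_fun setT (fun w => W t w m))
  (lam0 : forall m, 0 < lam m) (be01 : 0 <= be <= 1).

(** On a common grid the difference of the two Riemann sums has the kernel of [increment_kernel],
    and the Riemann errors are made arbitrarily small. The constant is 64 = 2 * 16 * 2. *)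
Lemma ito_increment (tau : R) i k I1 I2 : 0 < tau -> (0 < k)%N ->
  ito_limit P W lam (i%:R * tau) I1 -> ito_limit P W lam ((i + k)%:R * tau) I2 ->
  Ebound P (fun w => \sum_m (I2 w m - I1 w m) ^+ 2) (64 * (k%:R * tau) `^ be * kappa).
Proof.
move=> t0 k0 H1 H2; apply: Ebound_eps => e e0.
have e8 : 0 < e / 8 by lra.
have [n1 A1] := ito_limit_grid t0 H1 e8.
have [n2 A2] := ito_limit_grid t0 H2 e8.
pose M := (maxn n1 n2).+1.
have {A1} := A1 M (leqW (leq_maxl _ _)) isT; have {A2} := A2 M (leqW (leq_maxr _ _)) isT.
have [mI1 _] := H1; have [mI2 _] := H2.
set dl := tau / M%:R.
have dl0 : 0 < dl by rewrite divr_gt0// ltr0n.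
have st (l : nat) : 0 <= l%:R * dl by rewrite mulr_ge0// ltW.
pose S2 w m := \sum_(l < (i + k) * M) expR (- (((i + k) * M - l)%:R * dl * lam m)) *
      (W (l.+1%:R * dl) w m - W (l%:R * dl) w m).
pose S1 w m := \sum_(l < i * M) expR (- ((i * M - l)%:R * dl * lam m)) *
      (W (l.+1%:R * dl) w m - W (l%:R * dl) w m).
rewrite -/(Ebound P (fun w => \sum_m (S2 w m - I2 w m) ^+ 2) (e / 8)) => A2.
rewrite -/(Ebound P (fun w => \sum_m (S1 w m - I1 w m) ^+ 2) (e / 8)) => A1.
have kt0 : 0 < k%:R * tau by rewrite mulr_gt0// ltr0n.
have kM : (k * M)%:R * dl = k%:R * tau by rewrite natrM /dl; field; rewrite pnatr_eq0.
pose g (m : 'I_N) l := expR (- (((i + k) * M - l)%:R * dl * lam m))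
     - (l < i * M)%N%:R * expR (- ((i * M - l)%:R * dl * lam m)).
have Hg m : dl * (\sum_(l < (i + k) * M) g m l ^+ 2) <= 2 * (k%:R * tau) `^ be * lam m `^ (be - 1).
  have := increment_kernel (i * M) (k * M) dl0 (lam0 m); rewrite -mulnDl kM => -[h1 h2].
  exact: interpolate.
have G0 : 0 <= 2 * (k%:R * tau) `^ be by rewrite mulr_ge0// powR_ge0.
have := noiseP dl0 G0 Hg.
pose Z w m := \sum_(l < (i + k) * M) g m l * (W (l.+1%:R * dl) w m - W (l%:R * dl) w m).
rewrite -/(Ebound P (fun w => \sum_m Z w m ^+ 2) _) => BZ.
have ZE w m : Z w m = S2 w m - S1 w m.
  rewrite /Z /S2 /S1; under eq_bigr do rewrite /g mulrBl.
  rewrite sumrB; congr (_ - _).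
  have le : (i * M <= (i + k) * M)%N by rewrite leq_mul2r leq_addr orbT.
  rewrite (big_ord_widen _ (fun l => expR (- ((i * M - l)%:R * dl * lam m)) * (W (l.+1%:R * dl) w m - W (l%:R * dl) w m)) le).
  rewrite [RHS]big_mkcond /=; apply: eq_bigr => l _.
  by case: ifP => _; rewrite ?mul1r ?mul0r.
have -> : 64 * (k%:R * tau) `^ be * kappa + e = 2 * (16 * (2 * (k%:R * tau) `^ be) * kappa) + (4 * (e / 8) + 4 * (e / 8)).
  by field.
have e4 : 0 <= 4 :> R by [].
apply: Ebound_leT (EboundD (EboundZ ler0n2 BZ) (EboundD (EboundZ e4 A2) (EboundZ e4 A1))).
- by apply: measurable_sum => m; apply: measurable_funX; exact: measurable_funB.
- by move=> w; apply: sumr_ge0 => m _; exact: sqr_ge0.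
move=> w; rewrite !mulr_sumr -!big_split /=; apply: ler_sum => m _.
rewrite -/(S2 w m) -/(S1 w m) -/(Z w m).
have -> : I2 w m - I1 w m = Z w m + ((I2 w m - S2 w m) + (S1 w m - I1 w m)) by rewrite ZE; ring.
apply: (le_trans (sqrD_le _ _)); rewrite lerD2l.
have := sqrD_le (I2 w m - S2 w m) (S1 w m - I1 w m).
by rewrite (_ : (I2 w m - S2 w m) ^+ 2 = (S2 w m - I2 w m) ^+ 2); [lra|ring].
Qed.

(** [block_telescope] writes the noise of the scheme as a sum over the fine grid; its difference
    with the Riemann sum of I has the kernel of [conv_kernel], and 32 = 2 * 16. *)
Lemma ito_scheme (de M rho tau : R) (a b : 'I_N -> R) k I :
  0 < de <= 1 -> 0 < M -> 0 <= rho < 1 -> M * de <= 1 / 2 -> 0 < tau ->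
  (forall m, scalar_bounds de M rho (tau * lam m) (a m) (b m)) ->
  ito_limit P W lam (k%:R * tau) I ->
  Ebound P (fun w => \sum_m (I w m - \sum_(i < k) a m ^+ (k.-1 - i) * b m *
       (W (i.+1%:R * tau) w m - W (i%:R * tau) w m)) ^+ 2)
    (32 * (conv_cst de M rho * tau `^ be) * kappa).
Proof.
move=> de01 M0 rho01 Mde t0 sb HI; apply: Ebound_eps => e e0.
have e2 : 0 < e / 2 by lra.
have [n1 A1] := ito_limit_grid t0 HI e2.
pose J := n1.+1.
have {A1} := A1 J (leqnSn _) isT.
have [mI _] := HI.
set dl := tau / J%:R.
have dl0 : 0 < dl by rewrite divr_gt0// ltr0n.
have JN : J%:R != 0 :> R by rewrite pnatr_eq0.
pose S1 w m := \sum_(l < k * J) expR (- ((k * J - l)%:R * dl * lam m)) *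
      (W (l.+1%:R * dl) w m - W (l%:R * dl) w m).
rewrite -/(Ebound P (fun w => \sum_m (S1 w m - I w m) ^+ 2) (e / 2)) => A1.
pose g (m : 'I_N) l := expR (- ((k * J - l)%:R * dl * lam m)) - a m ^+ (k.-1 - l %/ J) * b m.
have C0 : 0 <= conv_cst de M rho.
  have c0 : 0 < 1 - rho by lra.
  rewrite /conv_cst !addr_ge0 ?mulr_ge0 ?divr_ge0 ?sqr_ge0 ?addr_ge0 ?mulr_ge0 ?expR_ge0 ?invr_ge0 ?divr_ge0 ?mulr_ge0 ?expR_ge0//; lra.
have Hg m : dl * (\sum_(l < k * J) g m l ^+ 2) <= conv_cst de M rho * tau `^ be * lam m `^ (be - 1).
  have [h1 h2] := conv_kernel de01 M0 rho01 Mde k t0 (lam0 m) (isT : (0 < J)%N) (sb m).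
  exact: interpolate.
have G0 : 0 <= conv_cst de M rho * tau `^ be by rewrite mulr_ge0// powR_ge0.
have := noiseP dl0 G0 Hg.
pose Z w m := \sum_(l < k * J) g m l * (W (l.+1%:R * dl) w m - W (l%:R * dl) w m).
rewrite -/(Ebound P (fun w => \sum_m Z w m ^+ 2) _) => BZ.
have ZE w m : Z w m = S1 w m - \sum_(i < k) a m ^+ (k.-1 - i) * b m *
       (W (i.+1%:R * tau) w m - W (i%:R * tau) w m).
  rewrite /Z /S1; under eq_bigr do rewrite /g mulrBl.
  rewrite sumrB; congr (_ - _).
  rewrite (block_telescope (fun i => a m ^+ (k.-1 - i) * b m) (fun l => W (l%:R * dl) w m)).
  have E i : (i * J)%:R * dl = i%:R * tau by rewrite natrM /dl; field.
  by apply: eq_bigr => i _; rewrite !E.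
have -> : 32 * (conv_cst de M rho * tau `^ be) * kappa + e =
   2 * (16 * (conv_cst de M rho * tau `^ be) * kappa) + 2 * (e / 2) by field.
apply: Ebound_leT (EboundD (EboundZ ler0n2 BZ) (EboundZ ler0n2 A1)).
- apply: measurable_sum => m; apply: measurable_funX; apply: measurable_funB => //.
  apply: measurable_sum => i; apply: measurable_funM => //.
  by apply: measurable_funB; apply: mW; rewrite mulr_ge0// ltW.
- by move=> w; apply: sumr_ge0 => m _; exact: sqr_ge0.
move=> w; rewrite !mulr_sumr -!big_split /=; apply: ler_sum => m _.
rewrite -/(S1 w m) -/(Z w m).
set X := \sum_(i < k) a m ^+ _ * _ * _ in ZE *.
have := sqrD_le (Z w m) (- (S1 w m - I w m)); rewrite sqrrN.
by rewrite (_ : Z w m + _ = I w m - X)// ZE /X; ring.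
Qed.

End ito_estimates.

(** * Riemann sums of continuous functions *)

Section riemann_sums.
Context {R : realType}.
Local Notation cont a b f := {within `[a, b], continuous (f : R -> R)}.

(** Heine's theorem, from compactness in its near-covering form with the radius tending to 0 from
    the right. *)
Lemma cont_uniform (a b : R) (f : R -> R) : cont a b f -> forall e, 0 < e ->
  exists2 r : R, 0 < r & forall x y, a <= x <= b -> a <= y <= b -> `|x - y| < r -> `|f x - f y| <= e.
Proof.
move=> cf e e0; have e2 : 0 < e / 2 by lra.
have pt x : a <= x <= b -> exists2 r : R, 0 < r & forall y, a <= y <= b -> `|x - y| < r -> `|f x - f y| < e / 2.
  move=> xab; have xI : `[a, b]%classic x by rewrite /= in_itv.
  have /subspace_continuousP/(_ x xI) := cf.
  move=> /cvgrPdist_lt/(_ _ e2)/nbhs_ballP[r /= r0 H]; exists r => // y yab yr.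
  by apply: H => //; rewrite /= in_itv.
have K : compact (`[a, b]%classic : set R) by exact: segment_compact.
have /compact_near_coveringP := K.
move=> /(_ R (0^'+) (fun r x => `[a, b]%classic x -> forall y, a <= y <= b -> `|x - y| < r -> `|f x - f y| <= e)).
case.
- move=> x; rewrite /= in_itv /= => /pt[r r0 H].
  have r2 : 0 < r / 2 by lra.
  exists (ball x (r / 2), [set s | s < r / 2]).
    by split; [exact: nbhsx_ballx|exact: nbhs_right_lt].
  move=> [x' s] [/= xx' sr]; rewrite in_itv /= => x'I y yab ys.
  have h1 := H x' x'I; have h2 := H y yab.
  rewrite /ball /= in xx'.
  have h3 : `|x - y| < r.
    by have := ler_normD (x - x') (x' - y); rewrite subrKA; lra.
  have {}h1 : `|f x - f x'| < e / 2 by apply: h1; lra.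
  have {}h2 := h2 h3.
  have := ler_normB (f x - f y) (f x - f x').
  by rewrite opprB addrC addrA subrK; lra.
- move=> r0 /= r0_gt0 H; exists (r0 / 2); first lra.
  move=> x y xab yab xy; have := H (r0 / 2); rewrite /ball /= sub0r normrN gtr0_norm; last lra.
  by move=> /(_ _ _ x); apply => //; lra.
Qed.

Lemma riemann_error (f : R -> R) (t e : R) n : 0 <= t -> (0 < n)%N -> cont 0 t f ->
  (forall x y, 0 <= x <= t -> 0 <= y <= t -> `|x - y| <= t / n%:R -> `|f x - f y| <= e) ->
  `|t / n%:R * (\sum_(i < n) f (i%:R / n%:R * t)) - iint 0 t f| <= e * t.
Proof.
move=> t0 n0 cf He.
have np : 0 < n%:R :> R by rewrite ltr0n.
pose r i : R := i%:R / n%:R * t.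
have r0 : r 0%N = 0 by rewrite /r !mul0r.
have rn : r n = t by rewrite /r divff ?mul1r// gt_eqF.
have rS i : r i.+1 - r i = t / n%:R by rewrite /r -natr1; field; rewrite gt_eqF.
have tn : 0 <= t / n%:R by rewrite divr_ge0// ltW.
have rmono i : r i <= r i.+1 by have := rS i; lra.
have rle i : (i <= n)%N -> 0 <= r i <= t.
  move=> i_n; rewrite /r mulr_ge0 ?divr_ge0 ?(ltW np)//=.
  by rewrite ler_piMl// ler_pdivrMr// mul1r ler_nat.
have split_sum k : (k <= n)%N -> iint 0 (r k) f = \sum_(i < k) iint (r i) (r i.+1) f.
  elim: k => [_|k IH kn].
    by rewrite big_ord0 r0 /iint set_itv1 Rintegral_set1.
  have rk := rle _ kn.
  rewrite big_ord_recr /= -IH; last exact: ltnW.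
  apply: iint_split => //; first by have := rle k (ltnW kn); lra.
  by apply: sub_cont cf; lra.
rewrite -[in iint _ _ _]rn split_sum// mulr_sumr -sumrB.
apply: (le_trans (ler_norm_sum _ _ _)).
have -> : e * t = \sum_(i < n) e * (t / n%:R).
  by rewrite sumr_const card_ord -mulr_natr; field; rewrite gt_eqF.
apply: ler_sum => i _; have iN := ltn_ord i.
have /andP[ri1 ri2] := rle i (ltnW iN); have /andP[rj1 rj2] := rle _ iN.
have cfi : cont (r i) (r i.+1) f by apply: sub_cont cf; lra.
have -> : t / n%:R * f (i%:R / n%:R * t) = iint (r i) (r i.+1) (fun=> f (r i)).
  by rewrite iint_cst// rS mulrC.
rewrite -iintB//; last exact: cont_cst.
rewrite -(rS i); apply: iint_bound => //; first by apply: contB => //; exact: cont_cst.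
move=> x /andP[x1 x2]; apply: He; [lra|lra|].
by have := rS i; rewrite ler_norml; lra.
Qed.

Lemma riemann_sum_cvg (f : R -> R) (t : R) : 0 <= t -> cont 0 t f ->
  t / n%:R * (\sum_(i < n) f (i%:R / n%:R * t)) @[n --> \oo] --> iint 0 t f.
Proof.
move=> t0 cf; apply/cvgrPdist_le => e e0.
have e1 : 0 < e / (t + 1) by rewrite divr_gt0//; lra.
have [r r0 H] := cont_uniform cf e1.
exists (Num.bound (t / r)).+1 => // n /= nb.
have n0 : (0 < n)%N by apply: leq_trans nb.
have np : 0 < n%:R :> R by rewrite ltr0n.
rewrite distrC; apply: (@le_trans _ _ (e / (t + 1) * t)); last first.
  by rewrite mulrAC ler_pdivrMr; lra.
apply: riemann_error => // x y hx hy xy; apply: H => //; apply: (le_lt_trans xy).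
rewrite ltr_pdivrMr// mulrC -ltr_pdivrMr//.
apply: (lt_le_trans (archi_boundP _)); first by rewrite divr_ge0// ltW.
by rewrite ler_nat; apply: leq_trans nb.
Qed.

End riemann_sums.

Section measurable_functional.
Context {R : realType} d {O : measurableType d} (N : nat).

(** Rounding X down to the lattice of mesh 1 / (n + 1) turns phi(X) into a function with countably
    many values, measurable cell by cell; the Lipschitz bound lets n tend to infinity. *)
Lemma lipschitz_functional_measurable (phi : ('I_N -> R) -> R) (K : R) (X : O -> 'I_N -> R) :
  (forall x y, (phi x - phi y) ^+ 2 <= K * \sum_i (x i - y i) ^+ 2) ->
  (forall i, measurable_fun setT (fun w => X w i)) ->
  measurable_fun setT (fun w => phi (X w)).
Proof.
move=> phiK mX.
pose Y n (w : O) : {ffun 'I_N -> int} := [ffun i => Num.floor (n.+1%:R * X w i)].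
pose psi n (g : {ffun 'I_N -> int}) i : R := (g i)%:~R / n.+1%:R.
apply: (@measurable_fun_cvg _ _ _ setT (fun n w => phi (psi n (Y n w)))).
- move=> n _ B mB; rewrite setTI.
  pose S (g : {ffun 'I_N -> int}) := [set w | B (phi (psi n g)) /\
     forall i, (g i)%:~R <= n.+1%:R * X w i < (g i + 1)%:~R].
  (* Lattice points are enumerated by their codes, so the preimage is a countable union of preimages
     of boxes. *)
  have -> : (fun w => phi (psi n (Y n w))) @^-1` B =
     \bigcup_k (if @unpickle {ffun 'I_N -> int} k is Some g then S g else set0).
    apply/seteqP; split => w /=.
      move=> Bw; exists (pickle (Y n w)) => //; rewrite pickleK; split => // i.
      by rewrite ffunE; exact: floor_itv.
    move=> [k _]; case E: (unpickle k) => [g|//] [Bg Hw].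
    suff -> : Y n w = g by [].
    by apply/ffunP => i; rewrite ffunE; apply/eqP; rewrite floor_eq; exact: Hw.
  apply: bigcup_measurable => k _; case E: (unpickle k) => [g|] //.
  have [Bg|NBg] := pselect (B (phi (psi n g))); last first.
    by rewrite (_ : S g = set0)//; apply/seteqP; split => // w [].
  rewrite (_ : S g = \bigcap_(i in [set: 'I_N])
      ((fun w => n.+1%:R * X w i) @^-1` `[(g i)%:~R, (g i + 1)%:~R[%classic)); last first.
    apply/seteqP; split => w.
      by move=> [_ H] i _ /=; rewrite in_itv /=; exact: H.
    by move=> H; split => // i; have := H i I; rewrite /= in_itv.
  apply: fin_bigcap_measurable => //.
  move=> i _; rewrite -[X in measurable X]setTI.
  by apply: (measurable_funM (measurable_cst _) (mX i)) => //; exact: measurable_itv.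
- move=> w _; apply/cvgrPdist_le => e e0.
  pose K' := `|K| * N%:R + 1.
  have K'0 : 0 < K' by have := normr_ge0 K; have := ler0n R N; rewrite /K'; nra.
  exists (Num.bound (K' / e ^+ 2)) => // n /= nb.
  have n1 : 1 <= n.+1%:R :> R by rewrite ler1n.
  have en : K' / e ^+ 2 <= n.+1%:R.
    apply: ltW; apply: (lt_le_trans (archi_boundP _)); first by rewrite divr_ge0 ?sqr_ge0// ltW.
    by rewrite ler_nat; apply: leq_trans nb _.
  have e2 : 0 < e ^+ 2 by rewrite exprn_gt0.
  rewrite -(@ler_pXn2r _ 2)// ?nnegrE ?normr_ge0 ?(ltW e0)// real_normK ?num_real//.
  apply: (le_trans (phiK _ _)).
  have S0 : 0 <= \sum_i (X w i - psi n (Y n w) i) ^+ 2 by apply: sumr_ge0 => i _; exact: sqr_ge0.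
  have S1 : \sum_i (X w i - psi n (Y n w) i) ^+ 2 <= N%:R / n.+1%:R.
    have -> : N%:R / n.+1%:R = \sum_(i < N) n.+1%:R^-1 :> R by rewrite sumr_const card_ord mulr_natl.
    apply: ler_sum => i _; rewrite /psi ffunE.
    have np : 0 < n.+1%:R :> R by [].
    have := floor_itv (n.+1%:R * X w i); set z := Num.floor _; rewrite intrD mulr1z => /andP[z1 z2].
    have -> : (X w i - z%:~R / n.+1%:R) = (n.+1%:R * X w i - z%:~R) / n.+1%:R by field; rewrite gt_eqF.
    set u := n.+1%:R * X w i - z%:~R.
    have u01 : 0 <= u <= 1.
      by move: z1 z2; rewrite /u; move: (n.+1%:R * X w i) (z%:~R : R) => p r' ? ?; apply/andP; split; lra.
    have v1 : (n.+1%:R : R)^-1 <= 1 by rewrite invf_le1.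
    have v0 : 0 < (n.+1%:R : R)^-1 by rewrite invr_gt0.
    have u2 : u ^+ 2 <= 1 by nra.
    rewrite exprMn; apply: (@le_trans _ _ (1 * n.+1%:R^-1 ^+ 2)); first by rewrite ler_wpM2r// sqr_ge0.
    by rewrite mul1r; move: v0 v1; clear; move: (n.+1%:R^-1 : R) => v ? ?; nra.
  apply: (@le_trans _ _ (`|K| * (N%:R / n.+1%:R))).
    apply: (@le_trans _ _ (`|K| * \sum_i (X w i - psi n (Y n w) i) ^+ 2)).
      by rewrite ler_wpM2r// ler_norm.
    by rewrite ler_wpM2l.
  rewrite mulrA ler_pdivrMr//.
  have : K' <= e ^+ 2 * n.+1%:R by rewrite mulrC -ler_pdivrMr.
  by rewrite /K'; lra.
Qed.

End measurable_functional.

(** * Finite elements in L^2 *)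

Section inner_product.
Context {R : realType} {d : nat} {D : set 'rV[R]_d}.
Local Notation H := (L2 D).
Implicit Types (u v w : H) (c : R).

Lemma L2_mul_integrable u v :
  (lebesgueD D).-integrable setT (EFin \o (fun y => u y * v y)).
Proof.
by apply/Lfun1_integrable; apply: Lfun2_mul_Lfun1; exact: LfunP.
Qed.

Lemma dotC u v : dot u v = dot v u.
Proof. by apply: eq_Rintegral => y _; rewrite mulrC. Qed.

Lemma dotDl u v w : dot (u + v) w = dot u w + dot v w.
Proof.
rewrite /dot -RintegralD//; try exact: L2_mul_integrable.
by apply: eq_Rintegral => y _; rewrite -mulrDl.
Qed.

Lemma dotZl c u w : dot (c *: u) w = c * dot u w.
Proof.
rewrite /dot -RintegralZl//; last exact: L2_mul_integrable.
by apply: eq_Rintegral => y _; rewrite mulrA.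
Qed.

Lemma dot_ge0 u : 0 <= dot u u.
Proof. by apply: Rintegral_ge0 => y _; rewrite -expr2 sqr_ge0. Qed.

Lemma dot0l w : dot 0 w = 0. Proof. by rewrite -(scale0r (0 : H)) dotZl mul0r. Qed.

Lemma dotNl u w : dot (- u) w = - dot u w.
Proof. by rewrite -scaleN1r dotZl mulN1r. Qed.

Lemma dotBl u v w : dot (u - v) w = dot u w - dot v w.
Proof. by rewrite dotDl dotNl. Qed.

Lemma dot_suml (I : Type) (r : seq I) (P : pred I) (f : I -> H) w :
  dot (\sum_(i <- r | P i) f i) w = \sum_(i <- r | P i) dot (f i) w.
Proof.
by apply: (big_morph (fun u => dot u w)) => [x y|]; [exact: dotDl|exact: dot0l].
Qed.

Lemma dotDr u v w : dot w (u + v) = dot w u + dot w v.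
Proof. by rewrite dotC dotDl !(dotC w). Qed.

Lemma dotZr c u w : dot w (c *: u) = c * dot w u.
Proof. by rewrite dotC dotZl (dotC w). Qed.

Lemma dotNr u w : dot w (- u) = - dot w u.
Proof. by rewrite dotC dotNl (dotC w). Qed.

Lemma dotBr u v w : dot w (u - v) = dot w u - dot w v.
Proof. by rewrite dotDr dotNr. Qed.

Lemma hnorm_sqr u : hnorm u ^+ 2 = dot u u.
Proof. by rewrite sqr_sqrtr// dot_ge0. Qed.

Lemma hnorm_ge0 u : 0 <= hnorm u. Proof. exact: sqrtr_ge0. Qed.

Lemma cauchy_schwarz u v : dot u v ^+ 2 <= dot u u * dot v v.
Proof.
have H t : 0 <= dot u u + 2 * t * dot u v + t ^+ 2 * dot v v.
  have := dot_ge0 (u + t *: v); rewrite !dotDl !dotDr !dotZl !dotZr (dotC v u); lra.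
have := dot_ge0 v; rewrite le_eqVlt => /predU1P[v0|v0].
  have [->|uv] := eqVneq (dot u v) 0; first by rewrite expr0n /= mulr_ge0 ?dot_ge0.
  have := H (- (dot u u + 1) / (2 * dot u v)); rewrite -v0 mulr0 addr0.
  have -> : 2 * (- (dot u u + 1) / (2 * dot u v)) * dot u v = - (dot u u + 1) by field.
  lra.
have := H (- dot u v / dot v v).
have -> : dot u u + 2 * (- dot u v / dot v v) * dot u v + (- dot u v / dot v v) ^+ 2 * dot v v =
   (dot u u * dot v v - dot u v ^+ 2) / dot v v by field; rewrite gt_eqF.
by rewrite pmulr_lge0 ?invr_gt0// subr_ge0.
Qed.

Lemma eqH_dot u v w : eqH u v -> dot u w = dot v w.
Proof.
move=> uv; apply/eqP; rewrite -subr_eq0 -dotBl -sqrf_eq0 eq_le sqr_ge0 andbT.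
by apply: (le_trans (cauchy_schwarz _ _)); rewrite -hnorm_sqr uv expr0n /= mul0r.
Qed.

Lemma eqH_sqr u v : eqH u v -> dot u u = dot v v.
Proof. by move=> uv; rewrite (eqH_dot _ uv) dotC (eqH_dot _ uv). Qed.

Section orthonormal.
Variables (N : nat) (e : nat -> H).
Hypothesis e_on : forall m n, (m < N)%N -> (n < N)%N -> dot (e m) (e n) = (m == n)%:R.

Lemma dot_comb (c : nat -> R) k : (k < N)%N -> dot (\sum_(m < N) c m *: e m) (e k) = c k.
Proof.
move=> kN; rewrite dot_suml (bigD1 (Ordinal kN))//= dotZl e_on// eqxx mulr1.
rewrite big1 ?addr0// => i ik; rewrite dotZl e_on// -(inj_eq val_inj) in ik *.
by rewrite (negbTE ik) mulr0.
Qed.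

Lemma comb_sqr (c : nat -> R) :
  dot (\sum_(m < N) c m *: e m) (\sum_(m < N) c m *: e m) = \sum_(m < N) c m ^+ 2.
Proof.
rewrite {1}dot_suml; apply: eq_bigr => i _.
by rewrite dotZl (dotC (e i)) dot_comb// expr2.
Qed.

Lemma bessel u : \sum_(m < N) dot u (e m) ^+ 2 <= dot u u.
Proof.
have := dot_ge0 (u - \sum_(m < N) dot u (e m) *: e m).
rewrite dotBl !dotBr (comb_sqr (fun m => dot u (e m))) (dotC u) !dot_suml.
under eq_bigr do rewrite dotZl (dotC _ u) -expr2.
lra.
Qed.

Lemma dot_fcalc (lam : nat -> R) (phi : R -> R) u k : (k < N)%N ->
  dot (fcalc N lam e phi u) (e k) = phi (- lam k) * dot u (e k).
Proof. by move=> kN; rewrite /fcalc (dot_comb (fun m => phi (- lam m) * dot u (e m))). Qed.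

Lemma expansion_sqr u : eqH u (\sum_(m < N) dot u (e m) *: e m) ->
  dot u u = \sum_(m < N) dot u (e m) ^+ 2.
Proof. by move=> /eqH_sqr ->; exact: (comb_sqr (fun m => dot u (e m))). Qed.

Variable V : set H.
Hypotheses (V0 : V 0) (VD : forall u v, V u -> V v -> V (u + v))
  (VZ : forall c u, V u -> V (c *: u)) (Ve : forall m, (m < N)%N -> V (e m))
  (Vexp : forall u, V u -> eqH u (\sum_(m < N) dot u (e m) *: e m)).

Lemma V_comb (c : nat -> R) : V (\sum_(m < N) c m *: e m).
Proof.
by apply: (big_ind V) => //= m _; apply: VZ; exact: Ve.
Qed.

Lemma V_sqr u : V u -> dot u u = \sum_(m < N) dot u (e m) ^+ 2.
Proof. by move=> /Vexp; exact: expansion_sqr. Qed.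

(** The truncated expansion in [e] meets the specification, so the choice made by [hproj] is a
    genuine projection and not the default 0. *)
Lemma hproj_spec u : V (hproj V u) /\ forall w, V w -> dot (u - hproj V u) w = 0.
Proof.
apply: (@xgetPex _ 0 [set p | V p /\ forall w, V w -> dot (u - p) w = 0]).
exists (\sum_(m < N) dot u (e m) *: e m); split; first exact: (V_comb (fun m => dot u (e m))).
move=> w /Vexp Vw; rewrite dotC (eqH_dot _ Vw) dot_suml big1// => i _.
by rewrite dotZl (dotC (e i)) dotBl (dot_comb (fun m => dot u (e m)))// subrr mulr0.
Qed.

Lemma V_hproj u : V (hproj V u). Proof. by have [] := hproj_spec u. Qed.

Lemma dot_hproj u k : (k < N)%N -> dot (hproj V u) (e k) = dot u (e k).
Proof.
move=> kN; have [_ /(_ _ (Ve kN))] := hproj_spec u.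
by rewrite dotBl => /eqP; rewrite subr_eq0 => /eqP.
Qed.

End orthonormal.

End inner_product.

Section fe_subspace.
Context {R : realType} {d : nat} {D : set 'rV[R]_d}.
Variable T : seq 'M[R]_(d.+1, d).
Local Notation V := (fe_space D T).

Lemma euclid_dotDl (g g' x : 'rV[R]_d) : euclid_dot (g + g') x = euclid_dot g x + euclid_dot g' x.
Proof. by rewrite /euclid_dot -big_split; apply: eq_bigr => i _; rewrite mxE mulrDl. Qed.

Lemma euclid_dotZl c (g x : 'rV[R]_d) : euclid_dot (c *: g) x = c * euclid_dot g x.
Proof. by rewrite /euclid_dot mulr_sumr; apply: eq_bigr => i _; rewrite mxE mulrA. Qed.

Lemma fe_space0 : V 0.
Proof.
exists (fun=> 0); last by apply: aeW => x.
split => //; first by move=> x; exact: cvg_cst.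
move=> K _; exists 0, 0 => x _; rewrite /euclid_dot big1 ?addr0// => i _.
by rewrite mxE mul0r.
Qed.

Lemma fe_spaceD u v : V u -> V v -> V (u + v).
Proof.
move=> [f [fc fa fb] uf] [g [gc ga gb] vg]; exists (fun x => f x + g x).
  split.
  - by move=> x; apply: cvgD; [exact: fc|exact: gc].
  - move=> K KT; have [p [c pc]] := fa K KT; have [p' [c' pc']] := ga K KT.
    exists (p + p'), (c + c') => x xK; rewrite pc// pc'// euclid_dotDl; ring.
  - by move=> x xD; rewrite fb// gb// addr0.
apply: negligibleS (negligibleU uf vg) => x /= Hx.
by apply: contrapT => /not_orP[/contrapT h1 /contrapT h2]; apply: Hx; rewrite -h1 -h2.
Qed.

Lemma fe_spaceZ c u : V u -> V (c *: u).
Proof.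
move=> [f [fc fa fb] uf]; exists (fun x => c * f x).
  split.
  - by move=> x; apply: cvgM; [exact: cvg_cst|exact: fc].
  - move=> K KT; have [p [c' pc]] := fa K KT.
    exists (c *: p), (c * c') => x xK; rewrite pc// euclid_dotZl; ring.
  - by move=> x xD; rewrite fb// mulr0.
by apply: negligibleS uf => x /= Hx h1; apply: Hx; rewrite -h1.
Qed.

End fe_subspace.

(** * The semidiscrete equation in coordinates *)

Lemma cvg_sum_real (R : realType) (T : Type) (F : set_system T) (I : Type) (r : seq I)
    (f : I -> T -> R) (l : I -> R) : Filter F ->
  (forall i, f i x @[x --> F] --> l i) -> \sum_(i <- r) f i x @[x --> F] --> \sum_(i <- r) l i.
Proof.
move=> FF fl; elim: r => [|i r IH].
  by rewrite big_nil; under eq_fun do rewrite big_nil; exact: cvg_cst.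
by rewrite big_cons; under eq_fun do rewrite big_cons; exact: cvgD.
Qed.

Section coordinates.
Context {R : realType} d {O : measurableType d} (P : probability O R).

(* The semidiscrete equation in the eigenbasis of the discrete operator: x is the initial value,
   W the noise, Phi the nonlinearity. *)
Record coordinate_mild N (W : R -> O -> 'I_N -> R) (lam : 'I_N -> R) (be kappa KL K0 : R)
    (Phi : ('I_N -> R) -> 'I_N -> R) (sigma : R) (x : 'I_N -> R) (U : R -> O -> 'I_N -> R) : Prop :=
  CoordinateMild {
  cm_noise : noise_bound P W lam be kappa;
  cm_mW : forall t m, 0 <= t -> measurable_fun setT (fun w => W t w m);
  cm_lam : forall m, 0 < lam m;
  cm_be : 0 <= be <= 1;
  cm_kappa : 0 <= kappa;
  cm_KL : 0 <= KL;
  cm_K0 : 0 <= K0;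
  cm_lip : forall u v, \sum_m (Phi u m - Phi v m) ^+ 2 <= KL * \sum_m (u m - v m) ^+ 2;
  cm_Phi0 : \sum_m (Phi (fun=> 0) m) ^+ 2 <= K0;
  cm_mU : forall t m, 0 <= t -> measurable_fun setT (fun w => U t w m);
  cm_cont : {ae P, forall w, forall m, {within `[0, +oo[, continuous (fun t => U t w m)}};
  cm_mild : forall t, 0 <= t -> exists2 I, ito_limit P W lam t I &
    {ae P, forall w, forall m, U t w m = expR (- (t * lam m)) * x m +
      iint 0 t (fun r => expR (- ((t - r) * lam m)) * Phi (U r w) m) + sigma * I w m} }.

Section facts.
Variables (N : nat) (W : R -> O -> 'I_N -> R) (lam : 'I_N -> R) (be kappa KL K0 : R).
Variables (Phi : ('I_N -> R) -> 'I_N -> R) (sigma : R) (x : 'I_N -> R) (U : R -> O -> 'I_N -> R).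
Hypothesis CM : coordinate_mild W lam be kappa KL K0 Phi sigma x U.

Lemma Phi_lip_coord u v m : (Phi u m - Phi v m) ^+ 2 <= KL * \sum_m (u m - v m) ^+ 2.
Proof.
apply: le_trans (cm_lip CM u v); rewrite (bigD1 m)//= lerDl.
by apply: sumr_ge0 => i _; exact: sqr_ge0.
Qed.

Lemma Phi_measurable (X : O -> 'I_N -> R) m : (forall i, measurable_fun setT (fun w => X w i)) ->
  measurable_fun setT (fun w => Phi (X w) m).
Proof.
by apply: (lipschitz_functional_measurable (phi := fun u => Phi u m)) => u v; exact: Phi_lip_coord.
Qed.

Lemma Phi_growth u : \sum_m Phi u m ^+ 2 <= 2 * K0 + 2 * KL * \sum_m u m ^+ 2.
Proof.
have := cm_lip CM u (fun=> 0); have := cm_Phi0 CM => h0.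
under [X in _ <= _ * X]eq_bigr do rewrite subr0.
move=> h1; apply: (@le_trans _ _ (2 * (\sum_m Phi (fun=> 0) m ^+ 2) + 2 * (\sum_m (Phi u m - Phi (fun=> 0) m) ^+ 2))).
  rewrite !mulr_sumr -big_split /=; apply: ler_sum => m _.
  rewrite [X in X ^+ 2 <= _](_ : _ = Phi (fun=> 0) m + (Phi u m - Phi (fun=> 0) m)); last by ring.
  exact: sqrD_le.
lra.
Qed.

Lemma Phi_cont (g : R -> 'I_N -> R) (t : R) m :
  (forall i, {within `[0, +oo[, continuous (fun r => g r i)}) ->
  {within `[0, t], continuous (fun r => Phi (g r) m)}.
Proof.
move=> cg; apply/subspace_continuousP => r /=; rewrite in_itv /= => /andP[r0 rt].
have S0 : (\sum_i (g s i - g r i) ^+ 2) @[s --> within `[0, t] (nbhs r)] --> (\sum_(i < N) (0 : R)).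
  apply: cvg_sum_real => i.
  have : g s i @[s --> within `[0, t] (nbhs r)] --> g r i.
    have : {within `[0, t], continuous (fun r => g r i)}.
      by apply: continuous_subspaceW (cg i) => y /=; rewrite !in_itv /= => /andP[-> _].
    by move/subspace_continuousP; apply; rewrite /= in_itv /= r0.
  move=> gi; have gi0 : (g s i - g r i) @[s --> within `[0, t] (nbhs r)] --> (0 : R).
    by have := cvgB gi (cvg_cst (g r i)); rewrite subrr; exact.
  have H := cvgM gi0 gi0; rewrite mulr0 in H.
  by under eq_fun do rewrite expr2; exact: H.
rewrite big1 // in S0.
apply/cvgrPdist_lt => e e0.
have KL1 : 0 < KL + 1 by have := cm_KL CM; lra.
have d0 : 0 < e ^+ 2 / (KL + 1) by rewrite divr_gt0// exprn_gt0.
move/cvgrPdist_lt : S0 => /(_ _ d0); apply: filterS => s.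
have SS : 0 <= \sum_i (g s i - g r i) ^+ 2 by apply: sumr_ge0 => i _; exact: sqr_ge0.
rewrite sub0r normrN ger0_norm// ltr_pdivlMr// => H.
rewrite -(@ltr_pXn2r _ 2)// ?nnegrE ?normr_ge0 ?(ltW e0)// real_normK ?num_real//.
rewrite -sqrrN opprB; apply: (le_lt_trans (Phi_lip_coord _ _ _)).
by have := cm_KL CM; nra.
Qed.

(** Riemann sum of the drift term of the mild formula at time k tau; [M.+1] cells per step, so that
    no index gives an empty grid. *)
Definition duhamel_sum (tau : R) k M (w : O) m :=
  tau / M.+1%:R * \sum_(l < k * M.+1) expR (- ((k * M.+1 - l)%:R * (tau / M.+1%:R) * lam m)) *
     Phi (U (l%:R * (tau / M.+1%:R)) w) m.

(** Paths are continuous almost surely, and Phi is continuous along them, so the drift integral is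
    the limit of its sums over grids that refine the time steps. *)
Lemma duhamel (tau : R) k : 0 < tau -> exists2 I, ito_limit P W lam (k%:R * tau) I &
  {ae P, forall w, forall m, duhamel_sum tau k M w m @[M --> \oo] -->
     U (k%:R * tau) w m - expR (- (k%:R * tau * lam m)) * x m - sigma * I w m}.
Proof.
move=> tau0; have t0 : 0 <= k%:R * tau by rewrite mulr_ge0// ltW.
have [I HI HU] := cm_mild CM t0; exists I => //.
move: HU (cm_cont CM); apply: filterS2 => w HU cU m.
have -> : U (k%:R * tau) w m - expR (- (k%:R * tau * lam m)) * x m - sigma * I w m =
    iint 0 (k%:R * tau) (fun r => expR (- ((k%:R * tau - r) * lam m)) * Phi (U r w) m).
  by rewrite HU; ring.
case: k t0 {I HI HU} => [|k] t0.
  rewrite mul0r /iint set_itv1 Rintegral_set1.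
  rewrite (_ : (fun M => duhamel_sum tau 0 M w m) = (fun=> 0)); first exact: cvg_cst.
  by apply/funext => M; rewrite /duhamel_sum mul0n big_ord0 mulr0.
set t := k.+1%:R * tau in t0 *.
set f := fun r => _ * _.
have cf : {within `[0, t], continuous f}.
  move=> r; apply: cvgM; last by apply: Phi_cont => i; exact: cU.
  have : continuous (fun r => expR (- ((t - r) * lam m))).
    move=> y; apply: (cvg_comp (fun r => - ((t - r) * lam m)) expR); last exact: continuous_expR.
    by apply: cvgN; apply: cvgMl; apply: cvgB; [exact: cvg_cst|exact: cvg_id].
  by move=> /continuous_subspaceT/(_ r).
have rs := riemann_sum_cvg t0 cf.
have to_oo : (fun M => (k.+1 * M.+1)%N) @ \oo --> \oo.
  move=> A [n _ nA]; exists n => // M /= nM; apply: nA => /=.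
  by apply: (leq_trans nM); rewrite (leq_trans (leqnSn M))// leq_pmull.
have := cvg_comp _ _ to_oo rs; apply: cvg_trans; apply: near_eq_cvg; apply: nearW => M /=.
have kN : k.+1%:R != 0 :> R by rewrite pnatr_eq0.
have MN : M.+1%:R != 0 :> R by rewrite pnatr_eq0.
have tE : t / (k.+1 * M.+1)%:R = tau / M.+1%:R.
  rewrite /t natrM; move: kN MN; move: (k.+1%:R : R) (M.+1%:R : R) => u v u0 v0.
  by field; rewrite u0 v0.
rewrite /duhamel_sum tE; congr (_ * _); apply: eq_bigr => l _.
have lE : l%:R / (k.+1 * M.+1)%:R * t = l%:R * (tau / M.+1%:R).
  by rewrite -tE; ring.
have tl : (k.+1 * M.+1 - l)%:R * (tau / M.+1%:R) = t - l%:R * (tau / M.+1%:R).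
  rewrite natrB; last exact: ltnW.
  rewrite /t natrM; move: MN; move: (k.+1%:R : R) (M.+1%:R : R) => u v v0.
  by field.
by rewrite lE /f tl.
Qed.

End facts.

End coordinates.

Section kernel_bounds.
Context {R : realType} (N : nat).

Lemma kernel_sqr (g : 'I_N -> nat -> R) (f : nat -> 'I_N -> R) n (dl G : R) : 0 <= dl -> 0 <= G ->
  (forall m, dl * (\sum_(l < n) g m l ^+ 2) <= G) ->
  \sum_m (dl * \sum_(l < n) g m l * f l m) ^+ 2 <= G * (dl * \sum_(l < n) \sum_m f l m ^+ 2).
Proof.
move=> dl0 G0 Hg; rewrite exchange_big /= !mulr_sumr; apply: ler_sum => m _.
rewrite exprMn; have := sum_cauchy_schwarz (index_enum 'I_n) (fun l => g m l) (fun l => f l m).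
set A := \sum_(l < n) g m l ^+ 2; set B := \sum_(l < n) f l m ^+ 2 => H.
have B0 : 0 <= B by apply: sumr_ge0 => l _; exact: sqr_ge0.
apply: (@le_trans _ _ (dl ^+ 2 * (A * B))); first by rewrite ler_wpM2l// sqr_ge0.
have dB : 0 <= dl * B by rewrite mulr_ge0.
by have := ler_wpM2r dB (Hg m); rewrite -/A; lra.
Qed.

(** Left sums of an increasing function stay below its integral; the induction uses 1 + mu dl <=
    exp(mu dl). *)
Lemma exp_riemann_le (mu dl : R) n : 0 < mu -> 0 <= dl ->
  dl * (\sum_(l < n) expR (mu * (l%:R * dl))) <= expR (mu * (n%:R * dl)) / mu.
Proof.
move=> mu0 dl0; elim: n => [|n IH].
  by rewrite big_ord0 mulr0 divr_ge0 ?expR_ge0// ltW.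
rewrite big_ord_recr /= mulrDr; apply: (le_trans (lerD IH (lexx _))).
rewrite ler_pdivlMr// mulrDl divfK ?gt_eqF//.
have -> : mu * (n.+1%:R * dl) = mu * (n%:R * dl) + mu * dl by rewrite -natr1; ring.
rewrite expRD; have := expR_ge1Dx (mu * dl); have := expR_ge0 (mu * (n%:R * dl)).
set E := expR _; set E' := expR _; nra.
Qed.

Lemma sqrD3_le (a b c : R) : (a + b + c) ^+ 2 <= 3 * a ^+ 2 + 3 * b ^+ 2 + 3 * c ^+ 2.
Proof. by have := sqr_ge0 (a - b); have := sqr_ge0 (b - c); have := sqr_ge0 (a - c); nra. Qed.

End kernel_bounds.

(** * Second moments of the semidiscrete solution *)

Section convolution_moments.
Context {R : realType} d {O : measurableType d} (P : probability O R) (N : nat).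

Lemma measurable_sum_sqr (X : O -> 'I_N -> R) : (forall m, measurable_fun setT (fun w => X w m)) ->
  measurable_fun setT (fun w => \sum_m X w m ^+ 2).
Proof. by move=> mX; apply: measurable_sum => m; exact: measurable_funX. Qed.

Lemma sum_sqr_ge0 (v : 'I_N -> R) : 0 <= \sum_m v m ^+ 2.
Proof. by apply: sumr_ge0 => m _; exact: sqr_ge0. Qed.

Lemma Ebound_convolution (g : 'I_N -> nat -> R) (f : nat -> O -> 'I_N -> R) (b : nat -> R) n (dl G : R) :
  0 <= dl -> 0 <= G -> (forall l m, measurable_fun setT (fun w => f l w m)) ->
  (forall m, dl * (\sum_(l < n) g m l ^+ 2) <= G) ->
  (forall l, (l < n)%N -> Ebound P (fun w => \sum_m f l w m ^+ 2) (b l)) ->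
  Ebound P (fun w => \sum_m (dl * \sum_(l < n) g m l * f l w m) ^+ 2) (G * (dl * \sum_(l < n) b l)).
Proof.
move=> dl0 G0 mf Hg Hf.
apply: (@Ebound_leT _ _ _ _ _ (fun w => G * (dl * \sum_(l < n) \sum_m f l w m ^+ 2))).
- apply: measurable_sum_sqr => m; apply: measurable_funM; first exact: measurable_cst.
  by apply: measurable_sum => l; apply: measurable_funM; [exact: measurable_cst|exact: mf].
- by move=> w; exact: sum_sqr_ge0.
- by move=> w; exact: (kernel_sqr (fun l m => f l w m) dl0 G0 Hg).
do 2 apply: EboundZ => //.
exact: (@Ebound_sum _ _ _ P _ (index_enum 'I_n) (fun l w => \sum_m f l w m ^+ 2) (fun l => b l) (fun l => Hf l (ltn_ord l))).
Qed.

Lemma Ebound_fatou_sqr (Y : nat -> O -> 'I_N -> R) (Z : O -> 'I_N -> R) (B : R) :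
  (forall M, Ebound P (fun w => \sum_m Y M w m ^+ 2) B) ->
  (forall m, measurable_fun setT (fun w => Z w m)) ->
  {ae P, forall w, forall m, Y M w m @[M --> \oo] --> Z w m} ->
  Ebound P (fun w => \sum_m Z w m ^+ 2) B.
Proof.
move=> HY mZ; move=> H; apply: (Ebound_fatou HY).
- exact: measurable_sum_sqr.
- by move=> w; exact: sum_sqr_ge0.
move: H; apply: filterS => w H; apply: cvg_sum_real => m.
by rewrite expr2; under eq_fun do rewrite expr2; exact: cvgM (H m) (H m).
Qed.

End convolution_moments.

Section moments.
Context {R : realType} d {O : measurableType d} (P : probability O R).
Variables (N : nat) (W : R -> O -> 'I_N -> R) (lam : 'I_N -> R) (be kappa KL K0 : R).
Variables (Phi : ('I_N -> R) -> 'I_N -> R) (sigma : R) (x : 'I_N -> R) (U : R -> O -> 'I_N -> R).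
Hypothesis CM : coordinate_mild P W lam be kappa KL K0 Phi sigma x U.
Variables (T : R).
Hypothesis T0 : 0 < T.

(** [ito_increment] from time 0, where the integral is 0. The case k = 0, excluded there, is settled
    by the vanishing of all the approximating sums. *)
Lemma ito_moment (tau : R) k I : 0 < tau -> ito_limit P W lam (k%:R * tau) I -> k%:R * tau <= T ->
  Ebound P (fun w => \sum_m I w m ^+ 2) (64 * T `^ be * kappa).
Proof.
move=> tau0 HI kT.
have z0 : ito_limit P W lam (0%:R * tau) (fun _ _ => 0).
  split => // e e0; exists 0%N => n _.
  under eq_fun do under eq_bigr do rewrite ito_sum0 ?mul0r// subr0 expr0n.
  under eq_fun do rewrite big1//.
  exact: EboundW (ltW e0) (Ebound_cst _ (lexx 0)).
have kap := cm_kappa CM; have be0 : 0 <= be by have /andP[] := cm_be CM.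
case: k HI kT => [|k] HI kT.
  have [mI H] := HI; apply: (@EboundW _ _ _ _ _ 0); first by rewrite !mulr_ge0// powR_ge0.
  apply: Ebound_eps => e e0; have [n0 /(_ n0 (leqnn _))] := H e e0; rewrite add0r.
  congr (Ebound P _ _); apply/funext => w; apply: eq_bigr => m _.
  by rewrite ito_sum0 ?mul0r// sub0r sqrrN.
have HI' : ito_limit P W lam ((0 + k.+1)%:R * tau) I by rewrite add0n.
have := ito_increment (cm_noise CM) (cm_lam CM) (cm_be CM) tau0 (ltn0Sn k) z0 HI'.
under eq_fun do under eq_bigr do rewrite subr0.
apply: EboundW; apply: ler_wpM2r => //; apply: ler_wpM2l => //.
by apply: ge0_ler_powR => //; rewrite nnegrE ?mulr_ge0// ltW.
Qed.

Variable tau : R.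
Hypothesis tau0 : 0 < tau.

(** All subdivisions of the step at once: a countable set of times, closed under the refinements on
    which the drift is summed. *)
Definition on_grid (t : R) := exists i M : nat, t = i%:R * (tau / M.+1%:R) /\ t <= T.

Lemma on_grid_ge0 t : on_grid t -> 0 <= t.
Proof. by move=> [i [M [-> _]]]; rewrite mulr_ge0// divr_ge0// ltW. Qed.

(** 12 T KL makes 6 T KL divided by this rate at most 1 / 2, the contraction factor of
    [truncated_moment_step]; the added 1 makes the rate positive. *)
Definition growth_rate : R := 12 * T * KL + 1.
(** The constant parts of the three-term splitting of the mild formula: initial value, growth of Phi
    at 0, noise. *)
Definition moment_cst (X2 : R) : R := 3 * X2 + 6 * T ^+ 2 * K0 + 3 * sigma ^+ 2 * (64 * T `^ be * kappa).

Let X2 : R := \sum_m x m ^+ 2.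

Lemma growth_rate_gt0 : 0 < growth_rate.
Proof.
by have := mulr_ge0 (ltW T0) (cm_KL CM); rewrite /growth_rate; lra.
Qed.

Lemma moment_cst_ge0 : 0 <= moment_cst X2.
Proof.
have K00 := cm_K0 CM; have kap := cm_kappa CM.
have s2 := sqr_ge0 sigma; have x2 := sum_sqr_ge0 x; have T2 := sqr_ge0 T.
have Tb := powR_ge0 T be.
have h1 : 0 <= T ^+ 2 * K0 by exact: mulr_ge0.
have h2 : 0 <= T `^ be * kappa by exact: mulr_ge0.
have h3 := mulr_ge0 s2 h2; rewrite /moment_cst; move: (x2 : 0 <= X2) h1 h3.
by move: X2 (T `^ be) => u1 u2; lra.
Qed.

(** One pass through the mild formula: under the weight exp(mu t) the drift returns at most half of
    c. As chi is idempotent it can be moved inside the squares and onto Phi. It may depend on the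
    whole path, because the stochastic integral has a deterministic integrand and is bounded without
    chi. *)
Lemma truncated_moment_step (chi : O -> R) (c : R) : measurable_fun setT chi ->
  (forall w, chi w * chi w = chi w) -> 0 <= c ->
  (forall t, on_grid t -> Ebound P (fun w => chi w * \sum_m U t w m ^+ 2) (c * expR (growth_rate * t))) ->
  forall t, on_grid t -> Ebound P (fun w => chi w * \sum_m U t w m ^+ 2)
     ((moment_cst X2 + c / 2) * expR (growth_rate * t)).
Proof.
move=> mchi chi2 c0 Hc t tg; have t0 := on_grid_ge0 tg.
have chi0 w : 0 <= chi w by rewrite -chi2; exact: sqr_ge0.
have chi1 w : chi w <= 1 by have := chi2 w; have := chi0 w; nra.
have [i [M [tE tT]]] := tg.
have tau'0 : 0 < tau / M.+1%:R by rewrite divr_gt0.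
have [I HI HN] := duhamel CM i tau'0; rewrite -tE in HI HN.
have KL0 := cm_KL CM; have K00 := cm_K0 CM; have kap := cm_kappa CM.
have mu0 := growth_rate_gt0; have mU := cm_mU CM.
pose Z w m := U t w m - expR (- (t * lam m)) * x m - sigma * I w m.
have mI m : measurable_fun setT (fun w => I w m) by have [] := HI.
have mZ m : measurable_fun setT (fun w => Z w m).
  apply: measurable_funB; first by apply: measurable_funB; [exact: mU|exact: measurable_cst].
  by apply: measurable_funM; [exact: measurable_cst|exact: mI].
have HZ : Ebound P (fun w => \sum_m (chi w * Z w m) ^+ 2)
    (T * (2 * K0 * T + 2 * KL * c * (expR (growth_rate * t) / growth_rate))).
  apply: (Ebound_fatou_sqr (Y := fun M' w m => chi w * duhamel_sum lam Phi U (tau / M.+1%:R) i M' w m)).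
  - move=> M'; rewrite /duhamel_sum; set n := (i * M'.+1)%N; set dl := tau / M.+1%:R / M'.+1%:R.
    have dl0 : 0 < dl by rewrite divr_gt0.
    have nt : n%:R * dl = t.
      rewrite tE /n /dl natrM; have : M'.+1%:R != 0 :> R by rewrite pnatr_eq0.
      have : M.+1%:R != 0 :> R by rewrite pnatr_eq0.
      move: (M'.+1%:R : R) (M.+1%:R : R) => u v u0 v0; field.
      by rewrite u0 v0.
    have gl l : (l < n)%N -> on_grid (l%:R * dl).
      (* [on_grid] counts cells by a successor, whence the predecessor of the product. *)
      move=> ln; exists l, (M.+1 * M'.+1).-1; rewrite prednK ?muln_gt0//; split.
        by rewrite /dl natrM invfM; ring.
      by apply: le_trans tT; rewrite -nt ler_wpM2r ?(ltW dl0)// ler_nat ltnW.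
    have gb l : (l < n)%N -> Ebound P (fun w => \sum_m (chi w * Phi (U (l%:R * dl) w) m) ^+ 2)
       (2 * K0 + 2 * KL * c * expR (growth_rate * (l%:R * dl))).
      move=> ln; have := Hc _ (gl l ln) => H.
      have := EboundD (Ebound_cst P (_ : 0 <= 2 * K0)) (EboundZ (_ : 0 <= 2 * KL) H).
      rewrite mulrA; move=> /(_ (mulr_ge0 (ler0n _ _) K00) (mulr_ge0 (ler0n _ _) KL0)).
      apply: Ebound_leT.
      + apply: measurable_sum_sqr => m; apply: measurable_funM => //.
        by apply: (Phi_measurable CM) => j; apply: mU; rewrite mulr_ge0// ltW.
      + by move=> w; exact: sum_sqr_ge0.
      move=> w; under eq_bigr do rewrite exprMn expr2 chi2.
      rewrite -mulr_sumr; have := Phi_growth CM (U (l%:R * dl) w) => H1.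
      apply: (le_trans (ler_wpM2l (chi0 w) H1)).
      have : chi w * (2 * K0) <= 2 * K0 by rewrite ler_piMl// mulr_ge0.
      by set S := \sum_m _; lra.
    have := @Ebound_convolution _ _ _ P N (fun m l => expR (- ((n - l)%:R * dl * lam m)))
      (fun l w m => chi w * Phi (U (l%:R * dl) w) m)
      (fun l => 2 * K0 + 2 * KL * c * expR (growth_rate * (l%:R * dl))) n dl T (ltW dl0) (ltW T0).
    move=> /(_ _ _ gb) H; apply: (@EboundW _ _ _ _ _ (T * (dl * \sum_(l < n) (2 * K0 + 2 * KL * c * expR (growth_rate * (l%:R * dl)))))).
      apply: ler_wpM2l; first exact: ltW.
      rewrite big_split /= sumr_const card_ord -mulr_sumr mulrDr.
      have := exp_riemann_le n mu0 (ltW dl0); rewrite nt => H1.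
      have H2 : dl * ((2 * K0) *+ n) <= 2 * K0 * T.
        have -> : dl * ((2 * K0) *+ n) = 2 * K0 * (n%:R * dl) by rewrite -mulr_natr; ring.
        by rewrite nt; apply: ler_wpM2l => //; rewrite mulr_ge0.
      apply: lerD => //; rewrite mulrCA; apply: ler_wpM2l => //.
      by rewrite !mulr_ge0.
    suff -> : (fun w => \sum_m (chi w * (dl * \sum_(l < n) expR (- ((n - l)%:R * dl * lam m)) *
        Phi (U (l%:R * dl) w) m)) ^+ 2) =
        (fun w => \sum_m (dl * \sum_(l < n) expR (- ((n - l)%:R * dl * lam m)) *
        (chi w * Phi (U (l%:R * dl) w) m)) ^+ 2).
      apply: H.
        move=> l m; apply: measurable_funM => //.
        by apply: (Phi_measurable CM) => j; apply: mU; rewrite mulr_ge0// ltW.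
      move=> m; apply: (@le_trans _ _ (n%:R * dl)); last by rewrite nt.
      rewrite mulrC; apply: ler_wpM2r; first exact: ltW.
      have -> : n%:R = \sum_(l < n) (1 : R) by rewrite sumr_const card_ord.
      apply: ler_sum => l _; rewrite expr_le1 ?expR_ge0// -expR0 ler_expR oppr_le0.
      by rewrite !mulr_ge0// ?ltW// (cm_lam CM).
    apply/funext => w; apply: eq_bigr => m _; congr (_ ^+ 2).
    rewrite mulrCA; congr (_ * _); rewrite mulr_sumr; apply: eq_bigr => l _; ring.
  - by move=> m; exact: measurable_funM.
  - move: HN; apply: filterS => w H m; apply: cvgM; [exact: cvg_cst|exact: H].
have HI2 : Ebound P (fun w => \sum_m I w m ^+ 2) (64 * T `^ be * kappa).
  by apply: (ito_moment tau'0 (k := i)); rewrite -tE.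
have H3 := EboundD (EboundD (Ebound_cst P (_ : 0 <= 3 * X2)) (EboundZ (_ : 0 <= 3) HZ))
   (EboundZ (_ : 0 <= 3 * sigma ^+ 2) HI2).
move: H3 => /(_ (mulr_ge0 (ler0n _ _) (sum_sqr_ge0 _)) (ler0n _ _) (mulr_ge0 (ler0n _ _) (sqr_ge0 _))) H3.
apply: (EboundW _ (Ebound_leT _ _ _ H3)).
- have e1 : 1 <= expR (growth_rate * t) by rewrite -expR0 ler_expR mulr_ge0// ltW.
  have h : 6 * T * KL / growth_rate <= 1 / 2.
    by rewrite ler_pdivrMr// /growth_rate; have := mulr_ge0 (ltW T0) KL0; lra.
  have := moment_cst_ge0; rewrite /moment_cst.
  move: e1 h; set E := expR _ => e1 h h2.
  have ce : 0 <= c * E by rewrite mulr_ge0// expR_ge0.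
  have := ler_wpM2l ce h; move: h2.
  set Q := 64 * _; set g1 := growth_rate^-1 => h2 h3.
  have h4 := ler_wpM2l h2 e1.
  have -> : T * (2 * K0 * T + 2 * KL * c * (E / growth_rate)) = 2 * T^+2 * K0 + (c * E * (6 * T * KL * g1)) / 3.
      by rewrite /g1; field; exact: lt0r_neq0.
  by move: (X2) (growth_rate) (g1) h3 h4 => u1 u2 u3; lra.
- apply: measurable_funM => //; apply: measurable_sum_sqr => m; exact: mU.
- by move=> w; rewrite mulr_ge0// sum_sqr_ge0.
move=> w; apply: (@le_trans _ _ (\sum_m chi w * (3 * x m ^+ 2 + 3 * Z w m ^+ 2 + 3 * (sigma * I w m) ^+ 2))).
  rewrite mulr_sumr; apply: ler_sum => m _; apply: ler_wpM2l => //.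
  have -> : U t w m = expR (- (t * lam m)) * x m + Z w m + sigma * I w m by rewrite /Z; ring.
  apply: (le_trans (sqrD3_le _ _ _)); rewrite !lerD2r ler_wpM2l// exprMn ler_piMl ?sqr_ge0//.
  by rewrite expr_le1 ?expR_ge0// -expR0 ler_expR oppr_le0 mulr_ge0// ltW ?(cm_lam CM).
rewrite /X2 !mulr_sumr -!big_split /=; apply: ler_sum => m _.
have := sqr_ge0 (x m); have := sqr_ge0 (I w m); rewrite !exprMn (expr2 (chi w)) chi2.
set A := x m ^+ 2; set B := Z w m ^+ 2; set D := I w m ^+ 2 => D0 A0.
have a1 : chi w * A <= A by rewrite ler_piMl.
have a2 : chi w * (sigma ^+ 2 * D) <= sigma ^+ 2 * D by rewrite ler_piMl// mulr_ge0// sqr_ge0.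
by move: a1 a2; lra.
Qed.

End moments.

Section moment_bound.
Context {R : realType} d {O : measurableType d} (P : probability O R).
Variables (N : nat) (W : R -> O -> 'I_N -> R) (lam : 'I_N -> R) (be kappa KL K0 : R).
Variables (Phi : ('I_N -> R) -> 'I_N -> R) (sigma : R) (x : 'I_N -> R) (U : R -> O -> 'I_N -> R).
Hypothesis CM : coordinate_mild P W lam be kappa KL K0 Phi sigma x U.
Variables (T tau : R).
Hypotheses (T0 : 0 < T) (tau0 : 0 < tau).

Let X2 : R := \sum_m x m ^+ 2.
Let mc := moment_cst be kappa K0 sigma T X2.
Let mu := growth_rate KL T.
Let S t w := \sum_m U t w m ^+ 2.

Lemma measurable_S t : 0 <= t -> measurable_fun setT (S t).
Proof. by move=> t0; apply: measurable_sum_sqr => m; exact: (cm_mU CM). Qed.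

(** The crude bound r starts the iteration of c to mc + c / 2; its fixed point is 2 mc, and r
    disappears in the limit. *)
Lemma truncated_moment (chi : O -> R) (r : R) : measurable_fun setT chi ->
  (forall w, chi w * chi w = chi w) -> 0 <= r ->
  (forall t w, on_grid T tau t -> chi w * S t w <= r) ->
  forall t, on_grid T tau t -> Ebound P (fun w => chi w * S t w) (2 * mc * expR (mu * t)).
Proof.
move=> mchi chi2 r0 Hr t tg.
have mc0 : 0 <= mc by exact: moment_cst_ge0 CM T.
have mu0 : 0 < mu := growth_rate_gt0 CM T0.
have chi0 w : 0 <= chi w by rewrite -chi2; exact: sqr_ge0.
have H n s : on_grid T tau s ->
    Ebound P (fun w => chi w * S s w) ((2 * mc + r / 2 ^+ n) * expR (mu * s)).
  elim: n s => [|n IH] s sg; have s0 := on_grid_ge0 tau0 sg.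
    have e1 : 1 <= expR (mu * s) by rewrite -expR0 ler_expR mulr_ge0// ltW.
    apply: (Ebound_leT _ _ (fun w => Hr s w sg)).
    - by apply: measurable_funM => //; exact: measurable_S.
    - by move=> w; rewrite mulr_ge0// sum_sqr_ge0.
    apply: (EboundW _ (Ebound_cst P r0)); rewrite expr0 divr1.
    by move: e1; move: (expR _) => E e1; nra.
  have c0 : 0 <= 2 * mc + r / 2 ^+ n.
    by apply: addr_ge0; [rewrite mulr_ge0|rewrite divr_ge0// exprn_ge0].
  have := truncated_moment_step CM T0 tau0 mchi chi2 c0 IH sg.
  congr (Ebound P _ (_ * _)); rewrite -/mc exprS invfM.
  by move: (2 ^- n : R) => v; field.
apply: Ebound_eps => e e0.
have := @cvg_geometric R (r * expR (mu * t)) 2^-1.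
rewrite ger0_norm// invf_lt1// ltr1n => /(_ isT).
move=> /cvgr0Pnorm_lt /(_ e e0)[n _ /(_ n (leqnn n))] /=.
have rE : 0 <= r * expR (mu * t) by rewrite mulr_ge0// expR_ge0.
have v0 : 0 <= (2^-1 : R) ^+ n by rewrite exprn_ge0// invr_ge0.
rewrite ger0_norm ?mulr_ge0// => He.
apply: (EboundW _ (H n t tg)); rewrite mulrDl lerD2l; apply: le_trans (ltW He).
by rewrite exprVn; move: (2 ^- n : R) (expR _) => a b; lra.
Qed.

(** The event that a path stays below n at all grid times up to T is measurable, as these times are
    countable, and it gives the iteration a finite start. Almost every path is continuous, hence
    bounded on [0, T], so the indicators tend to 1 and Fatou removes them. *)
Lemma grid_moment t : on_grid T tau t -> Ebound P (S t) (2 * mc * expR (mu * t)).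
Proof.
move=> tg; have t0 := on_grid_ge0 tau0 tg.
pose good (n : nat) := [set w | forall i M : nat, i%:R * (tau / M.+1%:R) <= T ->
   S (i%:R * (tau / M.+1%:R)) w <= n%:R].
have mgood n : measurable (good n).
  have -> : good n = \bigcap_i \bigcap_M (if i%:R * (tau / M.+1%:R) <= T then
      S (i%:R * (tau / M.+1%:R)) @^-1` `]-oo, n%:R] else setT).
    apply/seteqP; split => [w gw i _ M _|w gw i M iM].
      by case: ifPn => [iM|//]; rewrite /= in_itv /=; exact: gw.
    by have := gw i I M I; rewrite iM /= in_itv.
  apply: bigcap_measurable; first by exists 0%N.
  move=> i _; apply: bigcap_measurable; first by exists 0%N.
  move=> M _; case: ifPn => // _; rewrite -[X in measurable X]setTI.
  apply: measurable_S => //.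
  by rewrite mulr_ge0// divr_ge0// ltW.
apply: (@Ebound_fatou _ _ _ _ (fun n w => \1_(good n) w * S t w)).
- move=> n; apply: (@truncated_moment (\1_(good n)) n%:R) => //.
  + by move=> w; rewrite indicE; case: (_ \in _); rewrite ?mulr1 ?mulr0.
  move=> s w [i [M [-> iT]]]; rewrite indicE.
  case: (boolP (w \in good n)) => [|_]; rewrite ?mul0r// mul1r.
  by rewrite inE => /(_ i M iT).
- exact: measurable_S.
- by move=> w; exact: sum_sqr_ge0.
have := cm_cont CM; apply: filterS => w cU.
have /choice[b Hb] m : exists b, forall s, 0 <= s <= T -> U s w m ^+ 2 <= b.
  have c1 : {within `[0, T], continuous (fun s => U s w m ^+ 2)}.
    have c2 : {within `[0, T], continuous (fun s => U s w m)}.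
      by apply: continuous_subspaceW (cU m) => y /=; rewrite !in_itv /= => /andP[-> _].
    have -> : (fun s => U s w m ^+ 2) = (fun s => U s w m * U s w m).
      by apply/funext => s; rewrite expr2.
    by move=> s; apply: cvgM; exact: c2.
  have [c _ Hc] := EVT_max (ltW T0) c1.
  by exists (U c w m ^+ 2) => s sT; apply: Hc; rewrite in_itv.
pose n0 := (Num.truncn (\sum_m b m)).+1.
have [n Hn] : exists n0 : nat, \sum_m b m <= n0%:R.
  by exists n0; apply: ltW; exact: truncnS_gt.
apply: cvg_near_cst; exists n => // p /= np.
rewrite indicE mem_set ?mul1r// => i M iT.
apply: (@le_trans _ _ n%:R); last by rewrite ler_nat.
apply: le_trans Hn; apply: ler_sum => m _; apply: Hb.
by rewrite iT mulr_ge0// divr_ge0// ltW.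
Qed.

End moment_bound.

(* The factor of [1 + |x|^2] in the bound of the drift. *)
Definition drift_cst {R : realType} (be kappa KL K0 sigma T : R) : R :=
  2 * K0 + 2 * KL * (2 * expR (growth_rate KL T * T)) *
   (3 + (6 * T ^+ 2 * K0 + 3 * sigma ^+ 2 * (64 * T `^ be * kappa))).

Section drift_bound.
Context {R : realType} d {O : measurableType d} (P : probability O R).
Variables (N : nat) (W : R -> O -> 'I_N -> R) (lam : 'I_N -> R) (be kappa KL K0 : R).
Variables (Phi : ('I_N -> R) -> 'I_N -> R) (sigma : R) (x : 'I_N -> R) (U : R -> O -> 'I_N -> R).
Hypothesis CM : coordinate_mild P W lam be kappa KL K0 Phi sigma x U.

Lemma drift_cst_ge0 T : 0 < T -> 0 <= drift_cst be kappa KL K0 sigma T.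
Proof.
move=> T0; have K00 := cm_K0 CM; have kap := cm_kappa CM; have KL0 := cm_KL CM.
rewrite /drift_cst; have e0 := expR_ge0 (growth_rate KL T * T).
have h1 : 0 <= T ^+ 2 * K0 by rewrite mulr_ge0// sqr_ge0.
have h2 : 0 <= T `^ be * kappa by rewrite mulr_ge0// powR_ge0.
have h3 : 0 <= sigma ^+ 2 * (T `^ be * kappa) by rewrite mulr_ge0// sqr_ge0.
apply: addr_ge0; first by rewrite mulr_ge0.
by apply: mulr_ge0; [do 2 rewrite mulr_ge0//|lra].
Qed.

Lemma drift_moment T tau : 0 < T -> 0 < tau -> forall t, on_grid T tau t ->
  Ebound P (fun w => \sum_m Phi (U t w) m ^+ 2)
    (drift_cst be kappa KL K0 sigma T * (1 + \sum_m x m ^+ 2)).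
Proof.
move=> T0 tau0 t tg; have t0 := on_grid_ge0 tau0 tg.
have K00 := cm_K0 CM; have kap := cm_kappa CM; have KL0 := cm_KL CM.
have tT : t <= T by have [i [M []]] := tg.
have mu0 := growth_rate_gt0 CM T0.
apply: (Ebound_leT _ _ (fun w => Phi_growth CM (U t w))).
- by apply: measurable_sum_sqr => m; apply: (Phi_measurable CM) => i; exact: (cm_mU CM).
- by move=> w; exact: sum_sqr_ge0.
have KL2 : 0 <= 2 * KL by rewrite mulr_ge0.
have K02 : 0 <= 2 * K0 by rewrite mulr_ge0.
have := EboundD (Ebound_cst P K02) (EboundZ KL2 (grid_moment CM T0 tau0 tg)).
apply: EboundW; rewrite /drift_cst /moment_cst.
have X0 := sum_sqr_ge0 x; move: X0; set X2 := \sum_m _ => X0.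
have e1 : expR (growth_rate KL T * t) <= expR (growth_rate KL T * T).
  by rewrite ler_expR ler_wpM2l// ltW.
have h1 : 0 <= T ^+ 2 * K0 by rewrite mulr_ge0// sqr_ge0.
have h2 : 0 <= T `^ be * kappa by rewrite mulr_ge0// powR_ge0.
have h3 : 0 <= sigma ^+ 2 * (T `^ be * kappa) by rewrite mulr_ge0// sqr_ge0.
have e0 := expR_ge0 (growth_rate KL T * t).
have -> : 6 * T ^+ 2 * K0 = 6 * (T ^+ 2 * K0) by ring.
have -> : 3 * sigma ^+ 2 * (64 * T `^ be * kappa) = 192 * (sigma ^+ 2 * (T `^ be * kappa)) by ring.
move: h1 h3; move: (T ^+ 2 * K0) (sigma ^+ 2 * _) => p q p0 q0.
move: e0 e1; move: (expR _) (expR _) => E' E E0 EE'.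
have s1 : 3 * X2 + 6 * p + 192 * q <= (3 + (6 * p + 192 * q)) * (1 + X2).
  have := mulr_ge0 p0 X0; have := mulr_ge0 q0 X0; lra.
have s0 : 0 <= 3 * X2 + 6 * p + 192 * q by lra.
have s2 : (3 * X2 + 6 * p + 192 * q) * E <= (3 + (6 * p + 192 * q)) * (1 + X2) * E'.
  by apply: ler_pM.
have s3 := ler_wpM2l KL2 s2; have s4 := mulr_ge0 K02 X0; lra.
Qed.

End drift_bound.

(** * Time increments of the semidiscrete solution *)

Section path_increments.
Context {R : realType} d {O : measurableType d} (P : probability O R).
Variables (N : nat) (W : R -> O -> 'I_N -> R) (lam : 'I_N -> R) (be kappa KL K0 : R).
Variables (Phi : ('I_N -> R) -> 'I_N -> R) (sigma : R) (x : 'I_N -> R) (U : R -> O -> 'I_N -> R).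
Hypothesis CM : coordinate_mild P W lam be kappa KL K0 Phi sigma x U.

(** With r = exp(-y), (k + 1) r^k (1 - r) is at most 1 - r times a geometric sum, hence at most 1.
    The bound is summable over k, so an initial value without regularity is admissible. *)
Lemma semigroup_increment_le (y z : R) k : 0 <= y -> 0 <= z <= y ->
  (expR (- (k%:R * y + z)) - expR (- (k%:R * y))) ^+ 2 <= (k.+1%:R ^+ 2)^-1.
Proof.
move=> y0 /andP[z0 zy]; set r := expR (- y).
have r0 : 0 <= r by exact: expR_ge0.
have r1 : r <= 1 by rewrite -expR0 ler_expR oppr_le0.
have rz : r <= expR (- z) by rewrite ler_expR lerN2.
have z1 : expR (- z) <= 1 by rewrite -expR0 ler_expR oppr_le0.
have E : expR (- (k%:R * y)) = r ^+ k by rewrite -expRM_natl mulrN.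
rewrite opprD expRD E.
have H n : n.+1%:R * (r ^+ n * (1 - r)) <= 1.
  have G : (\sum_(i < n.+1) r ^+ i) * (1 - r) <= 1.
    have := subrX1 r n.+1; have : 0 <= r ^+ n.+1 by rewrite exprn_ge0.
    set s := \sum_(i < n.+1) _; set q := _ ^+ _ => h1 h2; lra.
  apply: le_trans G; rewrite mulrA; apply: ler_wpM2r; first by rewrite subr_ge0.
  have -> : n.+1%:R * r ^+ n = \sum_(i < n.+1) r ^+ n by rewrite sumr_const card_ord mulr_natl.
  apply: ler_sum => i _; apply: ler_wiXn2l => //.
  by rewrite -ltnS.
have kp : 0 < k.+1%:R :> R by [].
have rk : 0 <= r ^+ k by rewrite exprn_ge0.
rewrite -exprVn -[X in X <= _]sqrrN ler_pXn2r ?nnegrE ?invr_ge0//; last first.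
  by rewrite opprB subr_ge0; rewrite ler_piMr.
rewrite -[X in _ <= X]mul1r ler_pdivlMr// mulrC; apply: le_trans (H k).
apply: ler_wpM2l; first exact: ltW.
have := ler_wpM2l rk rz; move: (r ^+ k) (expR (- z)) => s t; lra.
Qed.

(** The terms are the increments of the semigroup on x, of the drift and of the noise. Both
    convolutions have the kernel of [increment_kernel], whose first bound serves the drift and whose
    interpolation serves the noise; 192 = 3 * 64. *)
Lemma path_increment (T tau : R) k p M : 0 < T -> 0 < tau -> (p <= M.+1)%N ->
  (k * M.+1 + p)%:R * (tau / M.+1%:R) <= T ->
  Ebound P (fun w => \sum_m (U ((k * M.+1 + p)%:R * (tau / M.+1%:R)) w m - U (k%:R * tau) w m) ^+ 2)
    (3 * ((\sum_m x m ^+ 2) / k.+1%:R ^+ 2) +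
     6 * T * (drift_cst be kappa KL K0 sigma T * (1 + \sum_m x m ^+ 2)) * tau +
     192 * sigma ^+ 2 * kappa * tau `^ be).
Proof.
move=> T0 tau0 pM tT.
set X2 := \sum_m x m ^+ 2; have X20 : 0 <= X2 by exact: sum_sqr_ge0.
set DC := drift_cst _ _ _ _ _ _ * _.
have DC0 : 0 <= DC by rewrite mulr_ge0 ?(drift_cst_ge0 CM T0)// addr_ge0.
have kap := cm_kappa CM; have be0 : 0 <= be by have /andP[] := cm_be CM.
set dl := tau / M.+1%:R in tT *.
have Mp : 0 < M.+1%:R :> R by [].
have dl0 : 0 < dl by rewrite divr_gt0.
have kE : k%:R * tau = (k * M.+1)%:R * dl by rewrite natrM /dl; field; rewrite gt_eqF.
have pd : p%:R * dl <= tau.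
  apply: (@le_trans _ _ (M.+1%:R * dl)); first by rewrite ler_wpM2r ?(ltW dl0)// ler_nat.
  by rewrite /dl mulrC divfK ?gt_eqF.
have T0' := ltW T0; have tau0' := ltW tau0.
(* [ito_increment] asks for a positive number of cells, so p = 0 is treated apart. *)
rewrite kE; case: p pM tT pd => [|p] pM tT pd.
  rewrite addn0; under eq_fun do under eq_bigr do rewrite subrr expr0n.
  under eq_fun do rewrite big1//.
  apply: (EboundW _ (Ebound_cst P (lexx 0))).
  have h1 : 0 <= X2 / k.+1%:R ^+ 2 by rewrite divr_ge0// exprn_ge0.
  have h2 : 0 <= T * DC * tau := mulr_ge0 (mulr_ge0 T0' DC0) tau0'.
  have h3 : 0 <= sigma ^+ 2 * kappa * tau `^ be.
    by apply: mulr_ge0; [exact: mulr_ge0 (sqr_ge0 _) kap|exact: powR_ge0].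
  move: h1 h2 h3; move: (X2 / _) (tau `^ be) => u v h1 h2 h3; lra.
set q := p.+1 in pM tT pd *.
have [I1 HI1 HN1] := duhamel CM (k * M.+1) dl0.
have [I2 HI2 HN2] := duhamel CM (k * M.+1 + q) dl0.
have HI := ito_increment (cm_noise CM) (cm_lam CM) (cm_be CM) dl0 (isT : (0 < q)%N) HI1 HI2.
have mU := cm_mU CM; have dl0' := ltW dl0.
set i := (k * M.+1)%N in HI1 HI2 HN1 HN2 HI tT *.
have s0 (n : nat) : 0 <= n%:R * dl by rewrite mulr_ge0.
have mI1 m : measurable_fun setT (fun w => I1 w m) by have [] := HI1.
have mI2 m : measurable_fun setT (fun w => I2 w m) by have [] := HI2.
pose Z1 w m := U (i%:R * dl) w m - expR (- (i%:R * dl * lam m)) * x m - sigma * I1 w m.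
pose Z2 w m := U ((i + q)%:R * dl) w m - expR (- ((i + q)%:R * dl * lam m)) * x m - sigma * I2 w m.
have mZ1 m : measurable_fun setT (fun w => Z1 w m).
  apply: measurable_funB; last by apply: measurable_funM; [exact: measurable_cst|exact: mI1].
  by apply: measurable_funB; [exact: mU|exact: measurable_cst].
have mZ2 m : measurable_fun setT (fun w => Z2 w m).
  apply: measurable_funB; last by apply: measurable_funM; [exact: measurable_cst|exact: mI2].
  by apply: measurable_funB; [exact: mU|exact: measurable_cst].
have HZ : Ebound P (fun w => \sum_m (Z2 w m - Z1 w m) ^+ 2) (2 * tau * (T * DC)).
  apply: (Ebound_fatou_sqr (Y := fun M' w m =>
     duhamel_sum lam Phi U dl (i + q) M' w m - duhamel_sum lam Phi U dl i M' w m)).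
  - move=> J; rewrite /duhamel_sum; set del := dl / J.+1%:R.
    have Jp : 0 < J.+1%:R :> R by [].
    have del0 : 0 < del by rewrite divr_gt0.
    have JE (n : nat) : (n * J.+1)%:R * del = n%:R * dl.
      by rewrite natrM /del; field; rewrite gt_eqF.
    pose g (m : 'I_N) l := expR (- (((i + q) * J.+1 - l)%:R * del * lam m))
      - (l < i * J.+1)%N%:R * expR (- ((i * J.+1 - l)%:R * del * lam m)).
    have Hg m : del * (\sum_(l < (i + q) * J.+1) g m l ^+ 2) <= 2 * tau.
      have [h _] := increment_kernel (i * J.+1) (q * J.+1) del0 (cm_lam CM m).
      rewrite -mulnDl JE in h; apply: (le_trans h); exact: ler_wpM2l.
    have Hf l : (l < (i + q) * J.+1)%N -> Ebound P (fun w => \sum_m Phi (U (l%:R * del) w) m ^+ 2) DC.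
      move=> ln; apply: (drift_moment CM T0 dl0); exists l, J; split => //.
      by apply: le_trans tT; rewrite -JE ler_wpM2r ?(ltW del0)// ler_nat ltnW.
    have tau2 : 0 <= 2 * tau by rewrite mulr_ge0.
    have := Ebound_convolution (ltW del0) tau2 _ Hg Hf.
    move=> /(_ _) H; apply: (@EboundW _ _ _ _ _ (2 * tau * (del * \sum_(l < (i + q) * J.+1) DC))).
      apply: ler_wpM2l => //; rewrite sumr_const card_ord -mulr_natr mulrCA mulrC.
      apply: ler_wpM2r => //; first by rewrite mulrC JE.
    suff -> : (fun w => \sum_m (del * (\sum_(l < (i + q) * J.+1)
         expR (- (((i + q) * J.+1 - l)%:R * del * lam m)) * Phi (U (l%:R * del) w) m) -
        del * (\sum_(l < i * J.+1)
         expR (- ((i * J.+1 - l)%:R * del * lam m)) * Phi (U (l%:R * del) w) m)) ^+ 2) =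
       (fun w => \sum_m (del * (\sum_(l < (i + q) * J.+1) g m l * Phi (U (l%:R * del) w) m)) ^+ 2).
      apply: H => l m; apply: (Phi_measurable CM) => j; apply: mU.
      by rewrite mulr_ge0// ltW.
    apply/funext => w; apply: eq_bigr => m _; congr (_ ^+ 2); rewrite -mulrBr; congr (_ * _).
    rewrite /g [in RHS](eq_bigr _ (fun l _ => mulrBl _ _ _)) sumrB; congr (_ - _).
    have le : (i * J.+1 <= (i + q) * J.+1)%N by rewrite leq_mul2r leq_addr orbT.
    rewrite (big_ord_widen _ (fun l => expR (- ((i * J.+1 - l)%:R * del * lam m)) * Phi (U (l%:R * del) w) m) le).
    rewrite [LHS]big_mkcond /=; apply: eq_bigr => l _.
    by case: ifP => _; rewrite ?mul1r ?mul0r.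
  - by move=> m; exact: measurable_funB.
  - by move: HN1 HN2; apply: filterS2 => w h1 h2 m; apply: cvgB; [exact: h2|exact: h1].
have h3s : 0 <= 3 * sigma ^+ 2 by rewrite mulr_ge0// sqr_ge0.
have hx : 0 <= 3 * (X2 / k.+1%:R ^+ 2) by rewrite mulr_ge0// divr_ge0// exprn_ge0.
have HH := EboundD (EboundD (Ebound_cst P hx) (EboundZ (ler0n R 3) HZ)) (EboundZ h3s HI).
apply: (EboundW _ (Ebound_leT _ _ _ HH)).
- have p1 : (q%:R * dl) `^ be <= tau `^ be by apply: ge0_ler_powR; rewrite ?nnegrE.
  have := ler_wpM2l kap p1 => p2; have := ler_wpM2l (sqr_ge0 sigma) p2.
  move: (3 * (X2 / _)) (_ `^ be) (tau `^ be) => u v v' h; lra.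
- by apply: measurable_sum_sqr => m; apply: measurable_funB; exact: mU.
- by move=> w; exact: sum_sqr_ge0.
move=> w; apply: (@le_trans _ _ (\sum_m (3 * (x m ^+ 2 / k.+1%:R ^+ 2) + 3 * (Z2 w m - Z1 w m) ^+ 2 +
     3 * sigma ^+ 2 * (I2 w m - I1 w m) ^+ 2))).
  apply: ler_sum => m _.
  have -> : U ((i + q)%:R * dl) w m - U (i%:R * dl) w m =
     (expR (- ((i + q)%:R * dl * lam m)) - expR (- (i%:R * dl * lam m))) * x m + (Z2 w m - Z1 w m) +
     sigma * (I2 w m - I1 w m) by rewrite /Z1 /Z2; ring.
  apply: (le_trans (sqrD3_le _ _ _)).
  have lm := cm_lam CM m.
  have := @semigroup_increment_le (tau * lam m) (q%:R * dl * lam m) k.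
  have -> : k%:R * (tau * lam m) + q%:R * dl * lam m = (i + q)%:R * dl * lam m.
    by rewrite natrD mulrA kE -!mulrDl.
  have -> : k%:R * (tau * lam m) = i%:R * dl * lam m by rewrite mulrA kE.
  have c1 : 0 <= tau * lam m by rewrite mulr_ge0// ltW.
  have c2 : 0 <= q%:R * dl * lam m <= tau * lam m.
    by rewrite ler_wpM2r ?(ltW lm)// andbT mulr_ge0// ltW.
  move=> /(_ c1 c2) h; have h' := ler_wpM2r (sqr_ge0 (x m)) h.
  by rewrite !exprMn [3 * (sigma ^+ 2 * _)]mulrA !lerD2r ler_wpM2l// [x m ^+ 2 / _]mulrC.
rewrite !big_split /= -!mulr_sumr -mulr_suml -/X2; exact: lexx.
Qed.

End path_increments.

(** * The error of the scheme *)

Section gronwall.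
Context {R : realType}.

(* The bound is a supersolution of the recursion: the sum of the geometric part telescopes. *)
Lemma discrete_gronwall (f : nat -> R -> Prop) (A : nat -> R) (q : R) n : 0 <= q ->
  (forall i, 0 <= A i) -> (forall k b c, b <= c -> f k b -> f k c) ->
  (forall k B, (k <= n)%N -> (forall i, (i < k)%N -> f i (B i)) ->
     f k (A k + q * \sum_(i < k) B i)) ->
  forall k, (k <= n)%N -> f k (A k + q * (\sum_(i < n) A i) * (1 + q) ^+ k).
Proof.
move=> q0 A0 fW step k; elim/ltn_ind: k => k IH kn.
pose G := q * (\sum_(i < n) A i).
pose B i := A i + G * (1 + q) ^+ i.
apply: (fW k (A k + q * \sum_(i < k) B i)); last first.
  by apply: step => // i ik; apply: IH => //; exact: leq_trans (ltnW ik) kn.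
rewrite lerD2l big_split /= -mulr_sumr mulrDr.
have Gk : q * (\sum_(i < k) A i) <= G.
  apply: ler_wpM2l => //; rewrite (big_ord_widen n (fun i => A i) kn) big_mkcond /=.
  by apply: ler_sum => i _; case: ifP.
have := subrX1 (1 + q) k; rewrite [1 + q - 1]addrC addKr => E.
have -> : q * (G * \sum_(i < k) (1 + q) ^+ i) = G * ((1 + q) ^+ k - 1) by rewrite E; ring.
by rewrite -/G mulrBr mulr1; move: Gk; set g := \sum_(i < k) _; lra.
Qed.

(** The induction runs on the sharper bound 2 - 1 / (n + 1) for n + 1 terms. *)
Lemma sum_inv_sqr n : \sum_(i < n) (i.+1%:R ^+ 2)^-1 <= 2 :> R.
Proof.
have H : \sum_(i < n.+1) (i.+1%:R ^+ 2)^-1 <= 2 - n.+1%:R^-1 :> R.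
  elim: n => [|n IH]; first by rewrite big_ord_recl big_ord0 addr0 /= expr1n invr1; lra.
  rewrite big_ord_recr /=; apply: (le_trans (lerD IH (lexx _))).
  have p : 0 < n.+1%:R :> R by [].
  have -> : n.+2%:R = n.+1%:R + 1 :> R by rewrite -natr1.
  move: p; move: (n.+1%:R : R) => u u0; rewrite -subr_ge0.
  have -> : 2 - (u + 1)^-1 - (2 - u^-1 + ((u + 1) ^+ 2)^-1) = (u * (u + 1) ^+ 2)^-1.
    by field; rewrite !gt_eqF//; lra.
  by rewrite invr_ge0 mulr_ge0 ?sqr_ge0// ltW.
have h : \sum_(i < n) (i.+1%:R ^+ 2)^-1 <= \sum_(i < n.+1) (i.+1%:R ^+ 2)^-1 :> R.
  by rewrite big_ord_recr /= lerDl invr_ge0 sqr_ge0.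
by apply: (le_trans h); apply: (le_trans H); rewrite gerBl invr_ge0.
Qed.

Lemma sum_inv_sqr0 n : \sum_(i < n) (i%:R ^-1) ^+ 2 <= 2 :> R.
Proof.
case: n => [|n]; first by rewrite big_ord0.
(* The inverse of 0 is 0, so the term i = 0 vanishes. *)
rewrite big_ord_recl /= invr0 expr0n add0r.
by under eq_bigr do rewrite exprVn; exact: sum_inv_sqr.
Qed.

Lemma sum_blocks (f : nat -> R) k M (tau : R) :
  tau / M.+1%:R * \sum_(l < k * M.+1) f (l %/ M.+1)%N = tau * \sum_(i < k) f i.
Proof.
have := block_telescope f (fun l => l%:R * (tau / M.+1%:R)) k M.+1.
have E l : l.+1%:R * (tau / M.+1%:R) - l%:R * (tau / M.+1%:R) = tau / M.+1%:R.
  by rewrite -natr1 mulrDl mul1r [_ + tau / _]addrC addrK.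
under eq_bigr do rewrite E; rewrite -mulr_suml [_ * (tau / _)]mulrC => ->.
rewrite mulr_sumr; apply: eq_bigr => i _; rewrite mulrC; congr (_ * _).
have : M.+1%:R != 0 :> R by rewrite pnatr_eq0.
rewrite !natrM -natr1; move: (M.+1%:R : R) => u u0; by field.
Qed.

Lemma conv_cst_ge0 (de M rho : R) : 0 < de <= 1 -> 0 < M -> 0 <= rho < 1 -> 0 <= conv_cst de M rho.
Proof.
move=> /andP[de0 _] M0 /andP[_ rho1]; rewrite /conv_cst.
have e0 := expR_ge0 (2 * (1 - rho)); have r1 : 0 <= 1 - rho by lra.
have q : 0 <= M * expR (2 * (1 - rho)) / (1 - rho) by rewrite divr_ge0// mulr_ge0// ltW.
have q' : 0 <= (1 + M * expR (2 * (1 - rho)) / (1 - rho)) / de by rewrite divr_ge0 ?ltW// ltr_wpDr.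
by have := sqr_ge0 (20 * (1 + M)); move: q q'; move: (_ / (1 - rho)) (_ / de) => u v; lra.
Qed.

(** For x < de, |b| <= 1 + M de <= 3 / 2, whence 9 / 4; for x >= de the decay bound gives M. *)
Lemma scalar_bounds_b (de M rho x a b : R) : M * de <= 1 / 2 -> 0 < M -> 0 < x ->
  scalar_bounds de M rho x a b -> b ^+ 2 <= 9 / 4 + M.
Proof.
move=> Mde M0 x0 [_ h1 h2]; case: (ltP x de) => xde.
  have [_ hb] := h1 xde.
  have : M * x <= 1 / 2 by apply: le_trans Mde; rewrite ler_wpM2l// ltW.
  move: hb; rewrite ler_norml => /andP[u v] w.
  by have b1 : -1 <= b by [lra]; nra.
have [_ hb] := h2 xde; apply: (@le_trans _ _ M); last lra.
by apply: le_trans hb; have := sqr_ge0 b; nra.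
Qed.

End gronwall.

(** * The error recursion in coordinates *)

Section coordinate_error.
Context {R : realType} d {O : measurableType d} (P : probability O R).
Variables (de M rho : R).
Hypotheses (de01 : 0 < de <= 1) (M0 : 0 < M) (rho01 : 0 <= rho < 1) (Mde : M * de <= 1 / 2).
Variables (be kappa KL K0 sigma T : R).
Hypothesis T0 : 0 < T.

Let Lc := lin_cst de M rho.
Let cc := conv_cst de M rho.
Let Mb := 9 / 4 + M.
Let DC (X2 : R) := drift_cst be kappa KL K0 sigma T * (1 + X2).

Definition increment_cst (X2 tau : R) : R :=
  6 * T * DC X2 * tau + 192 * sigma ^+ 2 * kappa * tau `^ be.

(** What the recursion contains besides the linear part and the earlier errors: the kernel error on
    the drift, the path increments within a step, the noise. The 9s come from two nested uses of
    [sqrD3_le], the 6 from 3 times the 2 of [sum_inv_sqr], and 96 = 3 * 32. *)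
Definition residual_cst (X2 tau : R) : R :=
  9 * (cc * tau * (T * DC X2)) + 9 * (T * Mb * (KL * (6 * X2 * tau + T * increment_cst X2 tau)))
  + 96 * sigma ^+ 2 * cc * kappa * tau `^ be.

(** [residual_cst] expanded in (1 + X2) tau, X2 tau and tau^be, with 54 = 9 * 6 and 1728 = 9 * 192.
    Neither N nor tau remains. *)
Definition resid_coef : R :=
  9 * (cc * T * drift_cst be kappa KL K0 sigma T) + 54 * (T * Mb * KL) +
  54 * (T * Mb * KL * (T * T * drift_cst be kappa KL K0 sigma T)) +
  1728 * (T * Mb * KL * T * (sigma ^+ 2 * kappa)) + 96 * (sigma ^+ 2 * kappa * cc).

(** The linear part of the last step, the residual with its Gronwall amplification, and the
    amplified linear parts of the earlier steps; the exponential bounds (1 + Q tau)^n for Q = 9 T Mb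
    KL. *)
Definition error_cst : R := 3 * Lc ^+ 2 +
  (1 + 9 * T * Mb * KL * expR (9 * T * Mb * KL * T) * T) * resid_coef +
  6 * (9 * T * Mb * KL * expR (9 * T * Mb * KL * T)) * Lc ^+ 2.

Variables (N : nat) (W : R -> O -> 'I_N -> R) (lam : 'I_N -> R).
Variables (Phi : ('I_N -> R) -> 'I_N -> R) (x : 'I_N -> R) (U : R -> O -> 'I_N -> R).
Hypothesis CM : coordinate_mild P W lam be kappa KL K0 Phi sigma x U.
Variables (tau : R) (a b : 'I_N -> R) (v : nat -> O -> 'I_N -> R).
Hypotheses (tau0 : 0 < tau) (sb : forall m, scalar_bounds de M rho (tau * lam m) (a m) (b m)).
Hypothesis v_init : forall w m, v 0 w m = x m.
Hypothesis v_next : forall k w m, v k.+1 w m =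
  a m * v k w m + b m * (tau * Phi (v k w) m + sigma * (W (k.+1%:R * tau) w m - W (k%:R * tau) w m)).

Let X2 : R := \sum_m x m ^+ 2.

Lemma scheme_measurable k m : measurable_fun setT (fun w => v k w m).
Proof.
elim: k m => [|k IH] m; first by under eq_fun do rewrite v_init; exact: measurable_cst.
have t0 i : 0 <= i%:R * tau by rewrite mulr_ge0// ltW.
under eq_fun do rewrite v_next.
apply: measurable_funD; first by apply: measurable_funM; [exact: measurable_cst|exact: IH].
apply: measurable_funM; first exact: measurable_cst.
apply: measurable_funD; apply: measurable_funM; try exact: measurable_cst.
  by apply: (Phi_measurable CM) => i; exact: IH.
by apply: measurable_funB; apply: (cm_mW CM).
Qed.

(** Discrete variation of constants: what step i adds is multiplied by a in each of the k - 1 - i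
    later steps. *)
Lemma scheme_unroll k w m : v k w m = a m ^+ k * x m +
  (tau * (\sum_(i < k) a m ^+ (k.-1 - i) * b m * Phi (v i w) m) +
   sigma * \sum_(i < k) a m ^+ (k.-1 - i) * b m * (W (i.+1%:R * tau) w m - W (i%:R * tau) w m)).
Proof.
elim: k => [|k IH]; first by rewrite v_init !big_ord0 !mulr0 expr0 mul1r !addr0.
have E (g : nat -> R) : \sum_(i < k.+1) a m ^+ (k.+1.-1 - i) * b m * g i =
    a m * (\sum_(i < k) a m ^+ (k.-1 - i) * b m * g i) + b m * g k.
  rewrite big_ord_recr /= subnn expr0 mul1r; congr (_ + _); rewrite mulr_sumr; apply: eq_bigr => i _.
  have -> : (k - i = (k.-1 - i).+1)%N by have := ltn_ord i; lia.
  by rewrite exprS !mulrA.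
rewrite v_next IH (E (fun i => Phi (v i w) m)) (E (fun i => W (i.+1%:R * tau) w m - W (i%:R * tau) w m)).
by rewrite exprS; ring.
Qed.

Lemma increment_cst_ge0 : 0 <= increment_cst X2 tau.
Proof.
have DC0 : 0 <= DC X2 by rewrite mulr_ge0 ?(drift_cst_ge0 CM T0)// addr_ge0// sum_sqr_ge0.
have h1 : 0 <= T * DC X2 * tau := mulr_ge0 (mulr_ge0 (ltW T0) DC0) (ltW tau0).
have h2 : 0 <= sigma ^+ 2 * kappa * tau `^ be.
  by apply: mulr_ge0; [exact: mulr_ge0 (sqr_ge0 _) (cm_kappa CM)|exact: powR_ge0].
by rewrite /increment_cst; move: (tau `^ be) (DC X2) h1 h2 => p q h1 h2; lra.
Qed.

(** The error is the sum of a linear part, the drift part [Z - V] and the noise part. On a fine grid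
    the drift is compared in three stages: exact against discrete kernel acting on Phi(U), Phi(U)
    against its value at the last time step, and that value against Phi(v). Only the third involves
    the earlier errors B. *)
Lemma error_step k (B : nat -> R) : k%:R * tau <= T ->
  (forall i, (i < k)%N -> Ebound P (fun w => \sum_m (U (i%:R * tau) w m - v i w m) ^+ 2) (B i)) ->
  Ebound P (fun w => \sum_m (U (k%:R * tau) w m - v k w m) ^+ 2)
    (3 * X2 * Lc ^+ 2 * (k%:R^-1) ^+ 2 + residual_cst X2 tau + 9 * T * Mb * KL * tau * \sum_(i < k) B i).
Proof.
move=> kT HB.
have T0' := ltW T0; have tau0' := ltW tau0; have kap := cm_kappa CM; have KL0 := cm_KL CM.
have X20 : 0 <= X2 by exact: sum_sqr_ge0.
have DC0 : 0 <= DC X2 by rewrite mulr_ge0 ?(drift_cst_ge0 CM T0)// addr_ge0.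
have cc0 : 0 <= cc by exact: conv_cst_ge0.
have Mb0 : 0 <= Mb by rewrite /Mb; have := M0; lra.
have mU := cm_mU CM; have mv := scheme_measurable.
have b2 m : b m ^+ 2 <= Mb.
  by apply: (scalar_bounds_b Mde M0 _ (sb m)); rewrite mulr_gt0// (cm_lam CM).
have a1 m : `|a m| <= 1 by have [] := sb m.
have [I HI HN] := duhamel CM k tau0.
have HS := ito_scheme (cm_noise CM) (cm_mW CM) (cm_lam CM) (cm_be CM) de01 M0 rho01 Mde tau0 sb HI.
have mI m : measurable_fun setT (fun w => I w m) by have [] := HI.
have kt0 : 0 <= k%:R * tau by rewrite mulr_ge0.
have mPhi t m : 0 <= t -> measurable_fun setT (fun w => Phi (U t w) m).
  by move=> t0; apply: (Phi_measurable CM) => j; exact: mU.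
have mPhiv i m : measurable_fun setT (fun w => Phi (v i w) m).
  by apply: (Phi_measurable CM) => j; exact: mv.
pose Z w m := U (k%:R * tau) w m - expR (- (k%:R * tau * lam m)) * x m - sigma * I w m.
have mZ m : measurable_fun setT (fun w => Z w m).
  apply: measurable_funB; last by apply: measurable_funM; [exact: measurable_cst|exact: mI].
  by apply: measurable_funB; [exact: mU|exact: measurable_cst].
pose V w m := tau * (\sum_(i < k) a m ^+ (k.-1 - i) * b m * Phi (v i w) m).
have mV m : measurable_fun setT (fun w => V w m).
  apply: measurable_funM; first exact: measurable_cst.
  by apply: measurable_sum => i; apply: measurable_funM; [exact: measurable_cst|exact: mPhiv].
pose Q1 := cc * tau * (T * DC X2).
pose Q2 := T * Mb * (KL * (6 * X2 * tau + T * increment_cst X2 tau)).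
pose Q3 := T * Mb * (KL * (tau * \sum_(i < k) B i)).
have HQ : Ebound P (fun w => \sum_m (Z w m - V w m) ^+ 2) (3 * Q1 + 3 * Q2 + 3 * Q3).
  apply: (Ebound_fatou_sqr (Y := fun J w m => duhamel_sum lam Phi U tau k J w m - V w m)).
  - move=> J; rewrite /duhamel_sum; set del := tau / J.+1%:R.
    have Jp : 0 < J.+1%:R :> R by [].
    have del0 : 0 < del by rewrite divr_gt0.
    have del0' := ltW del0.
    have l0 (l : nat) : 0 <= l%:R * del by rewrite mulr_ge0.
    have i0 (l : nat) : 0 <= l%:R * tau by rewrite mulr_ge0.
    have JE (n : nat) : (n * J.+1)%:R * del = n%:R * tau.
      by rewrite natrM /del; field; rewrite gt_eqF.
    pose g1 (m : 'I_N) l := expR (- ((k * J.+1 - l)%:R * del * lam m)) -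
       (* [g1] is the kernel error; [g2] below is the kernel of the scheme itself, for which |a| <=
          1 and b^2 <= Mb suffice. *)
       a m ^+ (k.-1 - l %/ J.+1) * b m.
    pose g2 (m : 'I_N) l := a m ^+ (k.-1 - l %/ J.+1) * b m.
    have Hg1 m : del * (\sum_(l < k * J.+1) g1 m l ^+ 2) <= cc * tau.
      by have [] := conv_kernel de01 M0 rho01 Mde k tau0 (cm_lam CM m) (isT : (0 < J.+1)%N) (sb m).
    have Hg2 m : del * (\sum_(l < k * J.+1) g2 m l ^+ 2) <= T * Mb.
      apply: (@le_trans _ _ (del * \sum_(l < k * J.+1) Mb)).
        apply: ler_wpM2l => //; apply: ler_sum => l _; rewrite /g2 exprMn -[leRHS]mul1r.
        apply: ler_pM; rewrite ?sqr_ge0//.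
        by rewrite -exprM mulnC exprM -[a m ^+ 2]real_normK ?num_real// -exprM exprn_ile1.
      rewrite sumr_const card_ord -mulr_natr mulrCA mulrC; apply: ler_wpM2r => //.
      by rewrite mulrC JE.
    have lt l : (l < k * J.+1)%N -> l%:R * del <= T.
      by move=> lk; apply: le_trans kT; rewrite -JE ler_wpM2r// ler_nat ltnW.
    have f1 l : (l < k * J.+1)%N -> Ebound P (fun w => \sum_m Phi (U (l%:R * del) w) m ^+ 2) (DC X2).
      move=> lk; apply: (drift_moment CM T0 tau0); exists l, J; split => //; exact: lt.
    have f2 l : (l < k * J.+1)%N -> Ebound P (fun w => \sum_m
        (Phi (U (l%:R * del) w) m - Phi (U ((l %/ J.+1)%:R * tau) w) m) ^+ 2)
        (KL * (3 * (X2 / (l %/ J.+1).+1%:R ^+ 2) + increment_cst X2 tau)).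
      move=> lk; have := @path_increment _ _ _ _ _ _ _ _ _ _ _ _ _ _ _ CM T tau (l %/ J.+1) (l %% J.+1) J T0 tau0.
      rewrite -divn_eq -/del => /(_ (ltnW (ltn_pmod l (isT : (0 < J.+1)%N))) (lt l lk)) H.
      rewrite /increment_cst addrA; apply: (Ebound_leT _ _ _ (EboundZ KL0 H)).
      + by apply: measurable_sum_sqr => m; apply: measurable_funB; exact: mPhi.
      + by move=> w; exact: sum_sqr_ge0.
      by move=> w; exact: (cm_lip CM).
    have f3 l : (l < k * J.+1)%N -> Ebound P (fun w => \sum_m
        (Phi (U ((l %/ J.+1)%:R * tau) w) m - Phi (v (l %/ J.+1) w) m) ^+ 2) (KL * B (l %/ J.+1)%N).
      move=> lk; have ik : (l %/ J.+1 < k)%N by rewrite ltn_divLR.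
      apply: (Ebound_leT _ _ _ (EboundZ KL0 (HB _ ik))).
      + by apply: measurable_sum_sqr => m; apply: measurable_funB; [exact: mPhi|exact: mPhiv].
      + by move=> w; exact: sum_sqr_ge0.
      by move=> w; exact: (cm_lip CM).
    have ct0 : 0 <= cc * tau by rewrite mulr_ge0.
    have TM0 : 0 <= T * Mb by rewrite mulr_ge0.
    have E1 := Ebound_convolution del0' ct0 (fun l m => mPhi _ m (l0 l)) Hg1 f1.
    have E2 := Ebound_convolution del0' TM0 (fun l m => measurable_funB (mPhi _ m (l0 l)) (mPhi _ m (i0 _))) Hg2 f2.
    have E3 := Ebound_convolution del0' TM0 (fun l m => measurable_funB (mPhi _ m (i0 _)) (mPhiv _ m)) Hg2 f3.
    have r3 : 0 <= 3 :> R by [].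
    apply: (EboundW _ (Ebound_leT _ _ _ (EboundD (EboundD (EboundZ r3 E1) (EboundZ r3 E2)) (EboundZ r3 E3)))).
    + apply: lerD; first apply: lerD.
      * apply: ler_wpM2l => //; apply: ler_wpM2l => //.
        rewrite sumr_const card_ord -mulr_natr mulrCA mulrC; apply: ler_wpM2r => //.
        by rewrite mulrC JE.
      * apply: ler_wpM2l => //; apply: ler_wpM2l => //.
        rewrite (sum_blocks (fun i => KL * (3 * (X2 / i.+1%:R ^+ 2) + increment_cst X2 tau))).
        rewrite -mulr_sumr mulrCA; apply: ler_wpM2l => //.
        rewrite big_split /= -mulr_sumr -mulr_sumr sumr_const card_ord -[increment_cst _ _ *+ k]mulr_natr mulrDr; apply: lerD.
          have := ler_wpM2l (mulr_ge0 X20 tau0') (sum_inv_sqr k).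
          by move: (\sum_(i < k) _) => s; lra.
        rewrite mulrCA mulrC; apply: ler_wpM2r; first exact: increment_cst_ge0.
        by rewrite mulrC.
      * apply: ler_wpM2l => //; apply: ler_wpM2l => //.
        by rewrite (sum_blocks (fun i => KL * B i)) -mulr_sumr mulrCA.
    + apply: measurable_sum_sqr => m; apply: measurable_funB => //.
      apply: measurable_funM; first exact: measurable_cst.
      by apply: measurable_sum => l; apply: measurable_funM; [exact: measurable_cst|exact: mPhi].
    + by move=> w; exact: sum_sqr_ge0.
    move=> w; rewrite !mulr_sumr -!big_split /=; apply: ler_sum => m _.
    apply: le_trans (sqrD3_le _ _ _); rewrite le_eqVlt; apply/orP; left; apply/eqP; congr (_ ^+ 2).
    have -> : V w m = del * \sum_(l < k * J.+1) g2 m l * Phi (v (l %/ J.+1)%N w) m.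
      by rewrite /V /g2 (sum_blocks (fun i => a m ^+ (k.-1 - i) * b m * Phi (v i w) m)).
    rewrite -!mulrDr -mulrBr; congr (_ * _); rewrite -sumrB -!big_split /=; apply: eq_bigr => l _.
    by rewrite /g1 /g2; ring.
  - by move=> m; exact: measurable_funB.
  - move: HN; apply: filterS => w h m; apply: cvgB; [exact: h|exact: cvg_cst].
have h3s : 0 <= 3 * sigma ^+ 2 by rewrite mulr_ge0// sqr_ge0.
have hx : 0 <= 3 * X2 * Lc ^+ 2 * k%:R^-1 ^+ 2.
  exact: mulr_ge0 (mulr_ge0 (mulr_ge0 (ler0n _ _) X20) (sqr_ge0 _)) (sqr_ge0 _).
have HH := EboundD (EboundD (Ebound_cst P hx) (EboundZ (ler0n R 3) HQ)) (EboundZ h3s HS).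
apply: (EboundW _ (Ebound_leT _ _ _ HH)).
- rewrite /Q1 /Q2 /Q3 /residual_cst -/cc; move: (3 * X2 * _ * _) (tau `^ be) (increment_cst _ _) (DC X2).
  move=> u1 u2 u3 u4; move: Mb cc (\sum_(i < k) B i) => u5 u6 u7; lra.
- by apply: measurable_sum_sqr => m; apply: measurable_funB; [exact: mU|exact: mv].
- by move=> w; exact: sum_sqr_ge0.
move=> w; pose Y m := I w m - \sum_(i < k) a m ^+ (k.-1 - i) * b m *
       (W (i.+1%:R * tau) w m - W (i%:R * tau) w m).
apply: (@le_trans _ _ (\sum_m (3 * (Lc ^+ 2 * k%:R^-1 ^+ 2 * x m ^+ 2) + 3 * (Z w m - V w m) ^+ 2 +
     3 * sigma ^+ 2 * Y m ^+ 2))).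
  apply: ler_sum => m _.
  have -> : U (k%:R * tau) w m - v k w m =
     (expR (- (k%:R * tau * lam m)) - a m ^+ k) * x m + (Z w m - V w m) + sigma * Y m.
    by rewrite scheme_unroll /Z /V /Y; ring.
  apply: (le_trans (sqrD3_le _ _ _)).
  rewrite !exprMn [3 * (sigma ^+ 2 * _)]mulrA !lerD2r ler_wpM2l// ler_wpM2r ?sqr_ge0//.
  (* At k = 0 both propagators equal 1, and the inverse of 0 is 0. *)
  case: k {HB kT HI HN HS kt0 Z mZ V mV Q3 HQ hx HH Y} => [|k].
    by rewrite !mul0r oppr0 expR0 expr0 subrr expr0n mulr_ge0// sqr_ge0.
  have := lin_bound de01 M0 rho01 Mde (sb m) (mulr_gt0 tau0 (cm_lam CM m)) (isT : (0 < k.+1)%N).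
  rewrite mulrA -/Lc -exprMn => h; rewrite -[leLHS]real_normK ?num_real//.
  by apply: lerXn2r => //; rewrite nnegrE ?normr_ge0// (le_trans _ h).
rewrite !big_split /= -!mulr_sumr -/X2 /Y !lerD2r.
by rewrite le_eqVlt; apply/orP; left; apply/eqP; ring.
Qed.

Lemma residual_cst_ge0 : 0 <= residual_cst X2 tau.
Proof.
have T0' := ltW T0; have tau0' := ltW tau0; have kap := cm_kappa CM; have KL0 := cm_KL CM.
have X20 : 0 <= X2 by exact: sum_sqr_ge0.
have cc0 : 0 <= cc by exact: conv_cst_ge0.
have Mb0 : 0 <= Mb by rewrite /Mb; have := M0; lra.
have DC0 : 0 <= DC X2 by rewrite mulr_ge0 ?(drift_cst_ge0 CM T0)// addr_ge0.
have h1 : 0 <= cc * tau * (T * DC X2) := mulr_ge0 (mulr_ge0 cc0 tau0') (mulr_ge0 T0' DC0).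
have h2 : 0 <= 6 * X2 * tau + T * increment_cst X2 tau.
  apply: addr_ge0; first exact: mulr_ge0 (mulr_ge0 (ler0n _ _) X20) tau0'.
  exact: mulr_ge0 T0' increment_cst_ge0.
have h3 := mulr_ge0 (mulr_ge0 T0' Mb0) (mulr_ge0 KL0 h2).
have h4 : 0 <= sigma ^+ 2 * cc * kappa * tau `^ be.
  by apply: mulr_ge0 (powR_ge0 _ _); apply: mulr_ge0 kap; exact: mulr_ge0 (sqr_ge0 _) cc0.
rewrite /residual_cst; move: (_ * (KL * _)) (cc * tau * _) h1 h3 => u1 u2 h1 h3.
by move: (tau `^ be) h4 => p h4; lra.
Qed.

Lemma resid_coef_ge0 : 0 <= resid_coef.
Proof.
have T0' := ltW T0; have kap := cm_kappa CM; have KL0 := cm_KL CM.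
have dc0 := drift_cst_ge0 CM T0; have cc0 : 0 <= cc by exact: conv_cst_ge0.
have Mb0 : 0 <= Mb by rewrite /Mb; have := M0; lra.
have a1 : 0 <= T * Mb * KL by rewrite !mulr_ge0.
have a2 := mulr_ge0 (mulr_ge0 cc0 T0') dc0.
have a3 := mulr_ge0 a1 (mulr_ge0 (mulr_ge0 T0' T0') dc0).
have a4 : 0 <= sigma ^+ 2 * kappa by rewrite mulr_ge0// sqr_ge0.
have a5 := mulr_ge0 a4 cc0.
have a6 := mulr_ge0 (mulr_ge0 a1 T0') a4.
rewrite /resid_coef; move: (drift_cst _ _ _ _ _ _) a1 a2 a3 a5 a6 => dc; lra.
Qed.

Lemma residual_cst_le : residual_cst X2 tau <= resid_coef * ((1 + X2) * tau + tau `^ be).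
Proof.
have T0' := ltW T0; have tau0' := ltW tau0; have kap := cm_kappa CM; have KL0 := cm_KL CM.
have X20 : 0 <= X2 by exact: sum_sqr_ge0.
have dc0 := drift_cst_ge0 CM T0; have cc0 : 0 <= cc by exact: conv_cst_ge0.
have Mb0 : 0 <= Mb by rewrite /Mb; have := M0; lra.
have p0 := powR_ge0 tau be.
rewrite /residual_cst /increment_cst /resid_coef /DC; move: dc0 p0; set dc := drift_cst _ _ _ _ _ _.
have Y0 : 0 <= (1 + X2) * tau by rewrite mulr_ge0// addr_ge0.
have Yx : X2 * tau <= (1 + X2) * tau by rewrite ler_wpM2r// lerDr.
move: (tau `^ be) => p dc0 p0.
set Y := (1 + X2) * tau in Y0 Yx *.
have a1 : 0 <= T * Mb * KL by rewrite !mulr_ge0.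
have a2 : 0 <= cc * T * dc by rewrite !mulr_ge0.
have a3 : 0 <= T * Mb * KL * (T * T * dc) by rewrite !mulr_ge0.
have a4 : 0 <= sigma ^+ 2 * kappa by rewrite mulr_ge0// sqr_ge0.
have a5 : 0 <= sigma ^+ 2 * kappa * cc by rewrite mulr_ge0.
have a6 : 0 <= T * Mb * KL * T * (sigma ^+ 2 * kappa) := mulr_ge0 (mulr_ge0 a1 T0') a4.
have -> : 9 * (cc * tau * (T * (dc * (1 + X2)))) +
     9 * (T * Mb * (KL * (6 * X2 * tau + T * (6 * T * (dc * (1 + X2)) * tau + 192 * sigma ^+ 2 * kappa * p)))) +
     96 * sigma ^+ 2 * cc * kappa * p =
   9 * (cc * T * dc) * Y + 54 * (T * Mb * KL) * (X2 * tau) +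
   54 * (T * Mb * KL * (T * T * dc)) * Y + 1728 * (T * Mb * KL * T * (sigma ^+ 2 * kappa)) * p +
   96 * (sigma ^+ 2 * kappa * cc) * p by rewrite /Y; ring.
move: a1 a2 a3 a5 a6.
set A1 := T * Mb * KL; set A2 := cc * T * dc; set A3 := A1 * _; set A5 := _ * cc; set A6 := _ * (_ * kappa).
move=> a1 a2 a3 a5 a6; move: (X2 * tau) Y A1 A2 A3 A5 A6 Y0 Yx a1 a2 a3 a5 a6.
move=> y Y' A1' A2' A3' A5' A6' Y0 Yx a1 a2 a3 a5 a6.
have := ler_wpM2l a1 Yx; have := mulr_ge0 a1 p0; have := mulr_ge0 a2 p0; have := mulr_ge0 a3 p0.
have := mulr_ge0 a5 Y0; have := mulr_ge0 a6 Y0; lra.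
Qed.

Theorem coordinate_error n : n%:R * tau <= T ->
  Ebound P (fun w => \sum_m (U (n%:R * tau) w m - v n w m) ^+ 2)
    (error_cst * (X2 * (n%:R^-1) ^+ 2 + (1 + X2) * tau + tau `^ be)).
Proof.
move=> nT; have T0' := ltW T0; have tau0' := ltW tau0; have KL0 := cm_KL CM.
have X20 : 0 <= X2 by exact: sum_sqr_ge0.
have Mb0 : 0 <= Mb by rewrite /Mb; have := M0; lra.
pose Q := 9 * T * Mb * KL.
have Q0 : 0 <= Q by rewrite !mulr_ge0.
have al0 : 0 <= 3 * X2 * Lc ^+ 2 by exact: mulr_ge0 (mulr_ge0 (ler0n _ _) X20) (sqr_ge0 _).
have r0 := residual_cst_ge0; have r1 := residual_cst_le.
set r := residual_cst X2 tau in r0 r1.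
pose A (i : nat) := 3 * X2 * Lc ^+ 2 * (i%:R^-1) ^+ 2 + r.
have A0 i : 0 <= A i by rewrite addr_ge0// mulr_ge0// sqr_ge0.
have q0 : 0 <= Q * tau by rewrite mulr_ge0.
have step k (B : nat -> R) : (k <= n)%N ->
    (forall i, (i < k)%N -> Ebound P (fun w => \sum_m (U (i%:R * tau) w m - v i w m) ^+ 2) (B i)) ->
    Ebound P (fun w => \sum_m (U (k%:R * tau) w m - v k w m) ^+ 2) (A k + Q * tau * \sum_(i < k) B i).
  by move=> kn; apply: error_step; apply: le_trans nT; rewrite ler_wpM2r// ler_nat.
have fW k b1 c1 : b1 <= c1 -> Ebound P (fun w => \sum_m (U (k%:R * tau) w m - v k w m) ^+ 2) b1 ->
    Ebound P (fun w => \sum_m (U (k%:R * tau) w m - v k w m) ^+ 2) c1 by exact: EboundW.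
have := discrete_gronwall q0 A0 fW step (leqnn n); apply: EboundW.
set E := expR (9 * T * Mb * KL * T).
have E0 : 0 <= E by exact: expR_ge0.
(* (1 + Q tau)^n <= exp(Q n tau) <= exp(Q T), because n tau <= T. *)
have qE : (1 + Q * tau) ^+ n <= E.
  apply: (@le_trans _ _ (expR (Q * tau) ^+ n)).
    by apply: lerXn2r; rewrite ?nnegrE ?addr_ge0// ?expR_ge0// expR_ge1Dx.
  rewrite -expRM_natl ler_expR -/Q [Q * tau]mulrC mulrA [Q * T]mulrC.
  exact: ler_wpM2r.
(* The factor tau of the recursion turns the sum of the 1 / i^2 into O(tau) and n copies of r into
   at most T r. *)
have sA : tau * (\sum_(i < n) A i) <= 6 * X2 * Lc ^+ 2 * tau + T * r.
  rewrite big_split /= -mulr_sumr sumr_const card_ord -[r *+ n]mulr_natr mulrDr.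
  apply: lerD.
    have := ler_wpM2l (mulr_ge0 al0 tau0') (sum_inv_sqr0 n).
    by move: (\sum_(i < n) _) (Lc ^+ 2) => s l; lra.
  by rewrite mulrCA [r * _]mulrC; apply: ler_wpM2r => //; rewrite mulrC.
have Q1 : Q * tau * (\sum_(i < n) A i) * (1 + Q * tau) ^+ n <= Q * (6 * X2 * Lc ^+ 2 * tau + T * r) * E.
  apply: ler_pM => //; last by rewrite -mulrA; apply: ler_wpM2l.
    by rewrite mulr_ge0// sumr_ge0.
  by rewrite exprn_ge0// addr_ge0.
rewrite /error_cst -/Q -/E; apply: (le_trans (lerD (lexx _) Q1)); rewrite /A.
set l2 := Lc ^+ 2; have l20 : 0 <= l2 by exact: sqr_ge0.
set y := X2 * n%:R^-1 ^+ 2; have y0 : 0 <= y by rewrite mulr_ge0// sqr_ge0.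
have -> : 3 * X2 * l2 * n%:R^-1 ^+ 2 = 3 * l2 * y by rewrite /y; ring.
have p0 := powR_ge0 tau be; move: r1.
set p := tau `^ be in p0 *; set Y := (1 + X2) * tau => r1.
have Yx : X2 * tau <= Y by rewrite ler_wpM2r// lerDr.
have Yx0 : 0 <= X2 * tau by rewrite mulr_ge0.
have -> : Q * (6 * X2 * l2 * tau + T * r) * E = 6 * (Q * E) * l2 * (X2 * tau) + Q * E * T * r by ring.
have QE : 0 <= Q * E by rewrite mulr_ge0.
have QET : 0 <= 1 + Q * E * T by rewrite addr_ge0// mulr_ge0.
have c0 := resid_coef_ge0.
have g1 := ler_wpM2l QET r1.
have QL : 0 <= Q * E * l2 by rewrite mulr_ge0.
have g2 := ler_wpM2l QL Yx; have g3 := mulr_ge0 (mulr_ge0 QET c0) y0.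
have g4 := mulr_ge0 l20 p0; have g5 := mulr_ge0 QL y0; have g6 := mulr_ge0 QL p0.
have g7 := mulr_ge0 l20 (le_trans Yx0 Yx).
rewrite [leLHS](_ : _ = 3 * l2 * y + (1 + Q * E * T) * r + 6 * (Q * E * l2) * (X2 * tau)); last by ring.
rewrite [leRHS](_ : _ = (3 * l2 + (1 + Q * E * T) * resid_coef + 6 * (Q * E * l2)) * (y + Y + p)); last by ring.
move: (resid_coef) (Q * E * l2) (1 + Q * E * T) (X2 * tau) g1 g2 g3 g4 g5 g6 g7 => c g D z g1 g2 g3 g4 g5 g6 g7.
by lra.
Qed.

End coordinate_error.

(** * Reduction of the equation in L^2 to coordinates *)

Section galerkin.
Context {R : realType} {d : nat} {D : set 'rV[R]_d}.
Local Notation H := (L2 D).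
Variables (V : set H) (N : nat) (e : nat -> H).
Hypotheses (V0 : V 0) (VD : forall u v, V u -> V v -> V (u + v)) (VZ : forall c u, V u -> V (c *: u)).
Hypotheses (Ve : forall m, (m < N)%N -> V (e m))
  (e_on : forall m n, (m < N)%N -> (n < N)%N -> dot (e m) (e n) = (m == n)%:R)
  (Vexp : forall u, V u -> eqH u (\sum_(m < N) dot u (e m) *: e m)).

Definition coordinates (u : H) (m : 'I_N) : R := dot u (e m).

Definition reconstruct (c : 'I_N -> R) : H := \sum_(m < N) c m *: e m.

(** Extends a family on ['I_N] by 0 to all indices, the form in which the lemmas on orthonormal
    families are stated. *)
Lemma reconstructE c : exists c' : nat -> R, (forall m : 'I_N, c' m = c m) /\
  reconstruct c = \sum_(m < N) c' m *: e m.
Proof.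
exists (fun k => oapp c 0 (insub k)); split; first by move=> m; rewrite valK.
by apply: eq_bigr => m _; rewrite valK.
Qed.

Lemma reconstruct_sqr c : dot (reconstruct c) (reconstruct c) = \sum_m c m ^+ 2.
Proof.
have [c' [cc ->]] := reconstructE c; rewrite (comb_sqr e_on c').
by apply: eq_bigr => m _; rewrite cc.
Qed.

Lemma reconstructB c c' : reconstruct c - reconstruct c' = reconstruct (fun m => c m - c' m).
Proof. by rewrite /reconstruct -sumrB; apply: eq_bigr => m _; rewrite scalerBl. Qed.

Lemma eqH_reconstruct u : V u -> eqH u (reconstruct (coordinates u)).
Proof. exact: Vexp. Qed.

Lemma VN u : V u -> V (- u).
Proof. by rewrite -scaleN1r; exact: VZ. Qed.

Lemma hnorm_coordinates u : V u -> hnorm u ^+ 2 = \sum_m coordinates u m ^+ 2.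
Proof. by move=> Vu; rewrite hnorm_sqr (V_sqr e_on Vexp Vu). Qed.

Lemma bessel_coordinates u : \sum_m coordinates u m ^+ 2 <= hnorm u ^+ 2.
Proof. by rewrite hnorm_sqr; exact: bessel. Qed.

Lemma coordinatesB u v m : coordinates (u - v) m = coordinates u m - coordinates v m.
Proof. exact: dotBl. Qed.

Lemma coordinates_hproj u m : coordinates (hproj V u) m = coordinates u m.
Proof. exact: (dot_hproj e_on V0 VD VZ Ve Vexp). Qed.

Section drift.
Variables (F : H -> H) (K : R).
Hypothesis F_lip : forall u v, hnorm (F u - F v) <= K * hnorm (u - v).

(** The projection of F leaves no trace here, since a vector and its projection have the same
    coordinates. *)
Definition galerkin_drift (c : 'I_N -> R) : 'I_N -> R := coordinates (F (reconstruct c)).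

Lemma lipschitz_sqr u v : hnorm (F u - F v) ^+ 2 <= K ^+ 2 * hnorm (u - v) ^+ 2.
Proof.
have h := F_lip u v; rewrite -exprMn; apply: lerXn2r => //; rewrite nnegrE ?hnorm_ge0//.
by apply: le_trans h; exact: hnorm_ge0.
Qed.

Lemma galerkin_drift_lip c c' :
  \sum_m (galerkin_drift c m - galerkin_drift c' m) ^+ 2 <= K ^+ 2 * \sum_m (c m - c' m) ^+ 2.
Proof.
under eq_bigr do rewrite -coordinatesB.
apply: (le_trans (bessel_coordinates _)); apply: (le_trans (lipschitz_sqr _ _)).
by rewrite reconstructB hnorm_sqr reconstruct_sqr.
Qed.

Lemma galerkin_drift0 : \sum_m galerkin_drift (fun=> 0) m ^+ 2 <= hnorm (F 0) ^+ 2.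
Proof.
rewrite /galerkin_drift (_ : reconstruct _ = 0); first exact: bessel_coordinates.
by rewrite /reconstruct big1// => m _; rewrite scale0r.
Qed.

(** A vector of V and its reconstruction agree only up to [eqH]; the Lipschitz bound carries this
    over to their images under F. *)
Lemma galerkin_driftE u m : V u -> galerkin_drift (coordinates u) m = dot (F u) (e m).
Proof.
move=> Vu; rewrite /galerkin_drift /coordinates; apply/esym/eqH_dot.
have h0 : hnorm (u - reconstruct (coordinates u)) = 0 by exact: eqH_reconstruct.
apply/eqP; rewrite eq_le hnorm_ge0 andbT.
by have := F_lip u (reconstruct (coordinates u)); rewrite h0 mulr0.
Qed.

End drift.

Section mean_square.
Context {dO : measure_display} {O : measurableType dO} (P : probability O R).

Lemma L2_cvg_coordinates (X : nat -> O -> H) (Y : O -> H) :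
  (forall n w, V (X n w)) -> (forall w, V (Y w)) ->
  (forall n m, measurable_fun setT (fun w => coordinates (X n w) m)) ->
  (forall m, measurable_fun setT (fun w => coordinates (Y w) m)) ->
  L2_cvg P X Y -> forall eta, 0 < eta -> exists n0, forall n, (n0 <= n)%N ->
    Ebound P (fun w => \sum_m (coordinates (X n w) m - coordinates (Y w) m) ^+ 2) eta.
Proof.
move=> VX VY mX mY XY eta eta0.
have E n w : hnorm (X n w - Y w) ^+ 2 = \sum_m (coordinates (X n w) m - coordinates (Y w) m) ^+ 2.
  rewrite hnorm_coordinates; last by apply: VD => //; exact: VN.
  by under eq_bigr do rewrite coordinatesB.
have : nbhs (0%E : \bar R) [set y | (y < eta%:E)%E].
  by apply: open_nbhs_nbhs; split; [exact: open_ereal_lt_ereal|rewrite /= lte_fin].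
move=> /XY[n0 _ Hn0]; exists n0 => n n0n; have := Hn0 n n0n; rewrite /= unlock => h.
have {}h : (\int[P]_w (\sum_m (coordinates (X n w) m - coordinates (Y w) m) ^+ 2)%:E < eta%:E)%E.
  by under eq_integral do rewrite -E; exact: h.
split; last exact: ltW h.
  by apply: measurable_sum => m; apply: measurable_funX; exact: measurable_funB.
by move=> w; apply: sumr_ge0 => m _; exact: sqr_ge0.
Qed.

End mean_square.

Section noise.
Context {dO : measure_display} {O : measurableType dO} (P : probability O R).
Variables (Filt : R -> set_system O) (beta : nat -> R -> O -> R).
Hypotheses (Filt_usual : usual_filtration P Filt)
  (beta_wiener : forall m, standard_wiener P Filt (beta m))
  (beta_independent : independent_processes P beta).
Variables (eps : nat -> H) (q : nat -> R) (W : R -> O -> H) (lam : nat -> R) (be kappa : R).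
Hypotheses (q0 : forall j, 0 <= q j) (W_noise : projected_noise P V eps q beta W)
  (kappaP : forall J, \sum_(m < N) lam m `^ (be - 1) * (\sum_(j < J) q j * coordinates (eps j) m ^+ 2) <= kappa).

Lemma coordinates_measurable (X : O -> H) m : V_random_variable V X ->
  measurable_fun setT (fun w => coordinates (X w) m).
Proof. by move=> [_ mX]; exact: mX. Qed.

Lemma projected_noise_bound :
  noise_bound P (fun t w m => coordinates (W t w) m) (fun m : 'I_N => lam m) be kappa.
Proof.
move=> dl G n g dl0 G0 Hg.
have cE J t w m : coordinates (\sum_(j < J) (Num.sqrt (q j) * beta j t w) *: hproj V (eps j)) m =
    truncated_noise beta q (fun j m => coordinates (eps j) m) J t w m.
  rewrite /coordinates dot_suml; apply: eq_bigr => j _.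
  by rewrite dotZl -[dot (hproj _ _) _]/(coordinates (hproj V (eps j)) m) coordinates_hproj mulrAC.
apply: (@noise_sum _ _ _ _ _ _ Filt_usual beta_wiener beta_independent N q
  (fun j m => coordinates (eps j) m) (fun m => lam m `^ (be - 1)) kappa q0 kappaP
  (fun t w m => coordinates (W t w) m) _ _ dl G n g dl0 G0 Hg).
- by move=> t m t0; apply: coordinates_measurable; have [] := W_noise t0.
move=> t eta t0 eta0; have [HW HL] := W_noise t0.
have [] := L2_cvg_coordinates _ _ _ _ HL eta0.
- move=> J w; apply: (big_ind V) => //= j _; apply: VZ.
  exact: (V_hproj e_on V0 VD VZ Ve Vexp).
- by move=> w; have [] := HW.
- move=> J m; under eq_fun do rewrite cE.
  apply: measurable_sum => j; apply: measurable_funM; first exact: measurable_cst.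
  exact: (beta_measurable Filt_usual beta_wiener).
- by move=> m; exact: coordinates_measurable.
move=> J0 HJ; exists J0 => J JJ; have := HJ J JJ.
by under eq_fun do under eq_bigr do rewrite cE.
Qed.

Variables (F : H -> H) (K sigma : R) (u0 : H) (uh : R -> O -> H).
Hypotheses (F_lip : forall u v, hnorm (F u - F v) <= K * hnorm (u - v))
  (lam0 : forall m, (m < N)%N -> 0 < lam m) (be01 : 0 <= be <= 1) (kappa0 : 0 <= kappa)
  (uh_mild : mild_solution P Filt V N e lam F sigma W u0 uh).

Lemma galerkin_coordinate_mild :
  coordinate_mild P (fun t w m => coordinates (W t w) m) (fun m : 'I_N => lam m) be kappa
    (K ^+ 2) (hnorm (F 0) ^+ 2) (galerkin_drift F) sigma (coordinates u0)
    (fun t w m => coordinates (uh t w) m).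
Proof.
have [uV u_ad u_cont u_mild] := uh_mild.
have mW t m : 0 <= t -> measurable_fun setT (fun w => coordinates (W t w) m).
  by move=> t0; apply: coordinates_measurable; have [] := W_noise t0.
split.
- exact: projected_noise_bound.
- exact: mW.
- by move=> m; exact: lam0.
- exact: be01.
- exact: kappa0.
- exact: sqr_ge0.
- exact: sqr_ge0.
- exact: galerkin_drift_lip.
- exact: galerkin_drift0.
- move=> t m t0 _ Y mY; rewrite setTI.
  have [_ sF _ _] := Filt_usual; have [FF _ _ _] := Filt_usual.
  by have [_ Fm] := FF t t0; apply: Fm; exact: (u_ad (e m) t t0 Y mY).
- by move: u_cont; apply: filterS => w cw m; exact: cw.
move=> t t0; have [I [[VI mI] HI] HU] := u_mild t t0.
have sE k r u (m : 'I_N) : coordinates (semigroup N e lam (k - r) u) m =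
    expR (- ((k - r) * lam m)) * coordinates u m.
  by rewrite /coordinates (dot_fcalc e_on) ?ltn_ord// mulrN.
exists (fun w m => coordinates (I w) m).
  split=> [m|eta eta0]; first exact: mI.
  pose X n w := \sum_(i < n) semigroup N e lam (t - i%:R / n%:R * t)
     (W (i.+1%:R / n%:R * t) w - W (i%:R / n%:R * t) w).
  have XE n w m : coordinates (X n w) m = ito_sum (fun t w m => coordinates (W t w) m) (fun m : 'I_N => lam m) t n w m.
    rewrite /X {1}/coordinates dot_suml; apply: eq_bigr => i _.
    by rewrite -[dot _ _]/(coordinates _ m) sE coordinatesB.
  have [] := L2_cvg_coordinates (X := X) _ VI _ (fun m => mI (e m)) HI eta0.
  - move=> n w; apply: (big_ind V) => //= i _; exact: (V_comb V0 VD VZ Ve (fun m => expR ((t - i%:R / n%:R * t) * - lam m) * dot (W (i.+1%:R / n%:R * t) w - W (i%:R / n%:R * t) w) (e m))).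
  - move=> n m; under eq_fun do rewrite XE.
    apply: measurable_sum => i; apply: measurable_funM; first exact: measurable_cst.
    by apply: measurable_funB; apply: mW; rewrite mulr_ge0// divr_ge0.
  move=> n0 Hn; exists n0 => n nn; have := Hn n nn.
  by under eq_fun do under eq_bigr do rewrite XE.
move: HU; apply: filterS => w Hw m.
rewrite [LHS](eqH_dot (e m) Hw) !dotDl dotZl.
have := sE t 0 (hproj V u0) m; rewrite subr0 /coordinates => ->.
rewrite -[dot (hproj V u0) _]/(coordinates (hproj V u0) m) coordinates_hproj; congr (_ + _ + _).
pose c k := \int[lebesgue_measure]_(r in `[0, t]) dot (semigroup N e lam (t - r) (hproj V (F (uh r w)))) (e k).
rewrite /time_integral (dot_comb e_on c)//; apply: eq_Rintegral => r.
rewrite inE /= in_itv /= => /andP[r0 rt].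
rewrite -[dot _ _]/(coordinates _ m) sE coordinates_hproj; congr (_ * _).
exact: esym (galerkin_driftE F_lip m (uV r w r0)).
Qed.

End noise.

Section scheme.
Context {dO : measure_display} {O : measurableType dO}.
Variables (F : H -> H) (K sigma : R) (W : R -> O -> H) (u0 : H) (tau : R) (lam : nat -> R) (phiA phiB : R -> R).
Hypotheses (F_lip : forall u v, hnorm (F u - F v) <= K * hnorm (u - v)).

Let un := scheme V F sigma W u0 tau (fcalc N lam e phiA) (fcalc N lam e phiB).

Lemma V_fcalc phi u : V (fcalc N lam e phi u).
Proof. exact: (V_comb V0 VD VZ Ve (fun m => phi (- lam m) * dot u (e m))). Qed.

Lemma V_scheme k w : V (un k w).
Proof.
case: k => [|k] /=; first exact: (V_hproj e_on V0 VD VZ Ve Vexp).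
by apply: VD; exact: V_fcalc.
Qed.

Lemma coordinates_scheme k w m : coordinates (un k.+1 w) m =
  phiA (- lam m) * coordinates (un k w) m +
  phiB (- lam m) * (tau * galerkin_drift F (coordinates (un k w)) m +
    sigma * (coordinates (W (k.+1%:R * tau) w) m - coordinates (W (k%:R * tau) w) m)).
Proof.
rewrite (galerkin_driftE F_lip _ (V_scheme k w)) {1}/coordinates /= dotDl.
rewrite !(dot_fcalc e_on)// dotDl !dotZl dotBl.
by rewrite -[dot (hproj V _) _]/(coordinates (hproj V (F (un k w))) m) coordinates_hproj.
Qed.

End scheme.

(** * Regularity of the projected noise *)

Section noise_trace.
Variables (lam : nat -> R) (e' : nat -> H) (lam' : nat -> R) (eps : nat -> H) (q : nat -> R).
Variables (be C : R).
Hypotheses (lam0 : forall m, (m < N)%N -> 0 < lam m) (q0 : forall j, 0 <= q j)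
  (eps_on : forall m n, dot (eps m) (eps n) = (m == n)%:R)
  (regular : noise_regular e' lam' eps q be) (C0 : 0 < C)
  (proj_bound : forall u, frac_dom e' lam' ((be - 1) / 2) u ->
     hnorm (fcalc N lam e (fun z => (- z) `^ ((be - 1) / 2)) (hproj V u)) <=
     C * hnorm (frac_pow e' lam' ((be - 1) / 2) u)).

Lemma hnormN (u : H) : hnorm (- u) = hnorm u.
Proof. by rewrite /hnorm dotNl dotNr opprK. Qed.

(** The partial sums are constant from j + 1 on, but [hsum] picks some limit, which is determined
    only up to norm 0. *)
Lemma Qhalf_basis j : eqH (Qhalf eps q (eps j)) (Num.sqrt (q j) *: eps j).
Proof.
pose x m := (Num.sqrt (q m) * dot (eps j) (eps m)) *: eps m.
have S n : (j < n)%N -> \sum_(m < n) x m = Num.sqrt (q j) *: eps j.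
  move=> jn; rewrite (bigD1 (Ordinal jn))//= /x eps_on eqxx mulr1 big1 ?addr0// => i ij.
  have /negbTE := ij; rewrite -(inj_eq val_inj) /= eps_on [(j == _)]eq_sym => ->.
  by rewrite mulr0 scale0r.
have h0 : hnorm (0 : H) = 0 by rewrite /hnorm dot0l sqrtr0.
have hx : is_hsum x (Num.sqrt (q j) *: eps j).
  apply: cvg_near_cst; exists j.+1 => // n /= jn.
  by rewrite S// subrr h0.
have hs : is_hsum x (hsum x) by apply: (@xgetPex _ 0 (is_hsum x)); exists (Num.sqrt (q j) *: eps j).
have lc : hnorm (\sum_(m < n) x m - hsum x) @[n --> \oo] --> hnorm (Num.sqrt (q j) *: eps j - hsum x).
  by apply: cvg_near_cst; exists j.+1; [exact: I|move=> n jn; rewrite (S n jn)].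
have E := cvg_lim (@Rhausdorff R) lc; rewrite (cvg_lim (@Rhausdorff R) hs) in E.
rewrite /eqH /Qhalf -/x.
have -> : hsum x - Num.sqrt (q j) *: eps j = - (Num.sqrt (q j) *: eps j - hsum x) by rewrite opprB.
by rewrite hnormN -E.
Qed.

(** The squared Hilbert-Schmidt norm as a real number; [regular] makes the series finite, so [fine]
    loses nothing. *)
Definition noise_trace : R :=
  fine (\sum_(m <oo) ((hnorm (frac_pow e' lam' ((be - 1) / 2) (Qhalf eps q (eps m)))) ^+ 2)%:E)%E.

Lemma noise_trace_partial J :
  \sum_(j < J) hnorm (frac_pow e' lam' ((be - 1) / 2) (Qhalf eps q (eps j))) ^+ 2 <= noise_trace.
Proof.
have [_] := regular; rewrite /hs_norm /noise_trace; set S := (\sum_(m <oo) _)%E => hS.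
pose f j := (hnorm (frac_pow e' lam' ((be - 1) / 2) (Qhalf eps q (eps j))) ^+ 2)%:E.
have f0 j : (0 <= f j)%E by rewrite lee_fin sqr_ge0.
have S0 : (0 <= S)%E by apply: nneseries_ge0 => j _ _; exact: f0.
have Sfin : S \is a fin_num.
  rewrite ge0_fin_numE//; move: hS; case: (S) S0 => [s _ _|_|//]; first exact: ltry.
  by rewrite poweRyr// invr_eq0 pnatr_eq0.
rewrite -lee_fin fineK// -sumEFin -(big_mkord xpredT f).
by apply: nneseries_lim_ge => j _ _; exact: f0.
Qed.

(** For each j the weighted sum over m is the squared norm of (-Lambda_h)^((be - 1) / 2) P_h Q^(1/2)
    eps_j, which [proj_bound] compares with the operator before discretization. The bound is uniform
    in J, and in the mesh as soon as C is. *)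
Lemma noise_kappa J :
  \sum_(m < N) lam m `^ (be - 1) * (\sum_(j < J) q j * coordinates (eps j) m ^+ 2) <= C ^+ 2 * noise_trace.
Proof.
have [dom _] := regular.
apply: (@le_trans _ _ (\sum_(j < J) C ^+ 2 * hnorm (frac_pow e' lam' ((be - 1) / 2) (Qhalf eps q (eps j))) ^+ 2)); last first.
  by rewrite -mulr_sumr ler_wpM2l ?sqr_ge0//; exact: noise_trace_partial.
under eq_bigr do rewrite mulr_sumr.
rewrite exchange_big /=; apply: ler_sum => j _.
apply: (@le_trans _ _ (hnorm (fcalc N lam e (fun z => (- z) `^ ((be - 1) / 2)) (hproj V (Qhalf eps q (eps j)))) ^+ 2)); last first.
  rewrite -exprMn; apply: lerXn2r; rewrite ?nnegrE ?hnorm_ge0//.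
    by rewrite mulr_ge0 ?hnorm_ge0// ltW.
  exact/proj_bound/dom.
rewrite hnorm_coordinates; last exact: V_fcalc.
rewrite le_eqVlt; apply/orP; left; apply/eqP; apply: eq_bigr => m _.
rewrite [in RHS]/coordinates (dot_fcalc e_on)// opprK.
rewrite -[dot (hproj V _) _]/(coordinates (hproj V (Qhalf eps q (eps j))) m) coordinates_hproj.
rewrite {2}/coordinates (eqH_dot (e m) (Qhalf_basis j)) dotZl !exprMn sqr_sqrtr//; congr (_ * _).
by rewrite -powR_mulrn ?powR_ge0// -powRrM; congr (_ `^ _); field.
Qed.

End noise_trace.

End galerkin.

(** * Rate of convergence and conclusion *)

Section rate.
Context {R : realType}.

(** With t = n tau, the linear part uses n^-2 <= n^-al = tau^al / t^al; the powers tau and tau^be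
    are at most tau^al as tau <= 1; the term X2 tau uses 1 <= T^al / t^al, whence T^al in the
    factor. The square on the right dominates (1 + u^2 / t^al) tau^al. *)
Lemma rate_bound (al be T tau X2 u : R) n : 0 <= al -> al < be -> be <= 1 -> 0 < T ->
  0 < tau <= 1 -> (1 <= n)%N -> n%:R * tau <= T -> 0 <= u -> 0 <= X2 <= u ^+ 2 ->
  X2 * (n%:R^-1) ^+ 2 + (1 + X2) * tau + tau `^ be <=
  (2 + T `^ al) * ((1 + u * (n%:R * tau) `^ (- (al / 2))) * tau `^ (al / 2)) ^+ 2.
Proof.
move=> al0 albe be1 T0 /andP[tau0 tau1] n1 nT u0 /andP[X0 Xu].
have np : 0 < n%:R :> R by rewrite ltr0n.
have np1 : 1 <= n%:R :> R by rewrite ler1n.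
have t0 : 0 < n%:R * tau by rewrite mulr_gt0.
have sq (y z : R) : (y `^ (z / 2)) ^+ 2 = y `^ z.
  by rewrite -powR_mulrn ?powR_ge0// -powRrM; congr (_ `^ _); field.
set t := n%:R * tau in nT t0 *.
have tauw : tau <= tau `^ al by rewrite -[leLHS]powRr1 ?(ltW tau0)// ger_powR ?tau0//; lra.
have tauv : tau `^ be <= tau `^ al by rewrite ger_powR ?tau0// ltW.
have tT : t `^ al <= T `^ al by apply: ge0_ler_powR; rewrite ?nnegrE// ltW.
have tp : 0 < t `^ al by exact: powR_gt0.
have sE : (t `^ (- (al / 2))) ^+ 2 = (t `^ al)^-1.
  by rewrite -mulNr sq powRN.
have wp : 0 < tau `^ al by exact: powR_gt0.
have nE : (n%:R^-1) ^+ 2 <= tau `^ al / t `^ al.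
  rewrite /t powRM ?(ltW np) ?(ltW tau0)// invfM mulrCA divff ?mulr1 ?gt_eqF//.
  rewrite exprVn lef_pV2 ?posrE ?exprn_gt0 ?powR_gt0//.
  apply: (@le_trans _ _ n%:R); last by rewrite expr2 ler_peMl// (ltW np).
  by rewrite -[leRHS]powRr1 ?(ltW np)// ler_powR//; lra.
rewrite exprMn sq; move: (t `^ (- (al / 2))) sE (powR_ge0 t (- (al / 2))) => p sE p0.
have p1 : 1 + u ^+ 2 * (t `^ al)^-1 <= (1 + u * p) ^+ 2.
  by rewrite -sE; have := mulr_ge0 u0 p0; nra.
move: tp tT nE p1; move: (t `^ al) => s s0 sT nE p1.
have g : X2 * (n%:R^-1) ^+ 2 <= u ^+ 2 * (tau `^ al / s).
  by apply: ler_pM => //; exact: sqr_ge0.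
have g2 : X2 * tau <= u ^+ 2 / s * (T `^ al) * tau `^ al.
  have h : X2 <= u ^+ 2 / s * T `^ al.
    apply: (le_trans Xu); rewrite -[leLHS]mulr1 -mulrA ler_wpM2l ?sqr_ge0//.
    by rewrite mulrC ler_pdivlMr// mul1r.
  by apply: ler_pM => //; exact: ltW.
have Tp : 0 <= T `^ al by exact: powR_ge0.
apply: (@le_trans _ _ ((2 + T `^ al) * ((1 + u ^+ 2 / s) * tau `^ al))); last first.
  by rewrite ler_wpM2l ?addr_ge0// ler_wpM2r// ltW.
have us : 0 <= u ^+ 2 / s by rewrite divr_ge0 ?sqr_ge0// ltW.
have q1 := mulr_ge0 us (ltW wp); have q2 := mulr_ge0 Tp (ltW wp).
move: g g2 us q1; have -> : u ^+ 2 * (tau `^ al / s) = u ^+ 2 / s * tau `^ al by ring.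
move: (u ^+ 2 / s) (T `^ al) (tau `^ al) (tau `^ be) (n%:R^-1 ^+ 2) tauw tauv q2 wp Tp.
move=> a b c e f h1 h2 h3 h4 h5 h6 h7 h8 h9; lra.
Qed.

End rate.

Theorem theorem3p4 (R : realType) (d : nat) (D : set 'rV[R]_d)
    (a : 'rV[R]_d -> R) (e : nat -> L2 D) (lam : nat -> R)
    (F : L2 D -> L2 D)
    (eps : nat -> L2 D) (q : nat -> R)
    (dO : measure_display) (O : measurableType dO) (P : probability O R)
    (Filt : R -> set_system O) (beta : nat -> R -> O -> R) (sigma : R)
    (Th : R -> seq 'M[R]_(d.+1, d))
    (N : R -> nat) (eh : R -> nat -> L2 D) (lamh : R -> nat -> R)
    (Wh : R -> R -> O -> L2 D)
    (A B : nat -> R[i] -> R[i]) (L : nat -> \bar R)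
    (d_range : (1 <= d <= 3)%N)
    (D_domain : convex_polyhedral_domain D)
    (a_coef : diffusion_coefficient D a)
    (Lambda_eigen : eigensystem a e lam)
    (F_lipschitz : globally_lipschitz F)
    (eps_basis : complete_orthonormal eps)
    (q_bounded : exists M : R, forall m, 0 <= q m <= M)
    (Filt_usual : usual_filtration P Filt)
    (beta_wiener : forall m, standard_wiener P Filt (beta m))
    (beta_independent : independent_processes P beta)
    (Q_regular : exists2 al : R, 0 < al & noise_regular e lam eps q al)
    (sigma_gt0 : 0 < sigma)
    (Th_triangulation : forall h : R, 0 < h <= 1 -> triangulation D (Th h))
    (Th_quasi_uniform : quasi_uniform Th)
    (Lambda_h_eigen : forall h : R, 0 < h <= 1 ->
       discrete_eigensystem a (fe_space D (Th h)) (N h) (eh h) (lamh h))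
    (assumption_i :
       norm_equivalence e lam (fun h => fe_space D (Th h)) N eh lamh)
    (assumption_ii : projection_error e lam (fun h => fe_space D (Th h)))
    (Wh_noise : forall h : R, 0 < h <= 1 ->
       projected_noise P (fe_space D (Th h)) eps q beta (Wh h))
    (AB_admissible : admissible_integrator A B L) :
  forall al T : R, 0 <= al < alphabar e lam eps q -> 0 < T ->
  exists2 C : R, 0 < C &
    forall (u0 : L2 D) (h tau : R) (s : nat),
      0 < h <= 1 -> 0 < tau <= 1 -> (1 <= s)%N ->
      ((0 < N h)%N -> ((tau * lamh h (N h).-1)%:E <= L s)%E) ->
    forall uh : R -> O -> L2 D,
      mild_solution P Filt (fe_space D (Th h)) (N h) (eh h) (lamh h)
        F sigma (Wh h) u0 uh ->
    let Ah := fcalc (N h) (lamh h) (eh h)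
                (fun z => restrict_real (A s) (tau * z)) in
    let Bh := fcalc (N h) (lamh h) (eh h)
                (fun z => restrict_real (B s) (tau * z)) in
    let un := scheme (fe_space D (Th h)) F sigma (Wh h) u0 tau Ah Bh in
    forall n : nat, (1 <= n)%N -> n%:R * tau <= T ->
      (('E_P[fun w => (hnorm (uh (n%:R * tau) w - un n w) ^+ 2)%R] `^ 2^-1)%E
       <= (C * (1 + hnorm u0 * (n%:R * tau) `^ (- (al / 2)))
             * tau `^ (al / 2))%:E)%E.
Proof.
move=> al T /andP[al0 alS] T0.
(* Some admissible exponent exceeds al because the supremum does. The set is nonempty: the supremum
   of the empty set is 0 by default and cannot exceed al >= 0. *)
have [be [/andP[be0 be1] reg] albe] : exists2 be : R, 0 <= be <= 1 /\ noise_regular e lam eps q be & al < be.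
  apply: (sup_gt _ alS); apply/set0P/negP => /eqP S0.
  by move: alS; rewrite /alphabar S0 sup0 ltNge al0.
have [de [M [rho [[hde hM hrho hMde] sbnd]]]] := integrator_bounds AB_admissible.
have [K FK] := F_lipschitz.
(* The exponent lies in [-1/2, 0], inside the range of the norm equivalence. *)
have hal : - (1 / 2) <= (be - 1) / 2 <= 1 / 2 by apply/andP; split; lra.
have [C1 C10 HC1] := assumption_i _ hal.
have [Mq q0M] := q_bounded.
have q0 j : 0 <= q j by have /andP[] := q0M j.
have [eps_on _] := eps_basis.
pose kappa := C1 ^+ 2 * noise_trace e lam eps q be.
(* The absolute value and the added 1 make the constant positive; neither h, tau, s nor u0 enters
   it. *)
pose EC := `|error_cst de M rho be kappa (K ^+ 2) (hnorm (F 0) ^+ 2) sigma T| + 1.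
have EC0 : 0 < EC by rewrite ltr_wpDl.
have TT0 : 0 < 2 + T `^ al by rewrite ltr_wpDr// powR_ge0.
exists (Num.sqrt (EC * (2 + T `^ al))); first by rewrite sqrtr_gt0 mulr_gt0.
move=> u0 h tau s h01 tau01 s1 stab uh mild Ah Bh un n n1 nT.
have /andP[tau0 tau1] := tau01.
set V := fe_space D (Th h) in mild un *.
have V0 : V 0 by exact: fe_space0.
have VD u v : V u -> V v -> V (u + v) by exact: fe_spaceD.
have VZ c u : V u -> V (c *: u) by exact: fe_spaceZ.
have [Ve e_on Vexp _ [lam0 lam_mono]] := Lambda_h_eigen h h01.
have [_ proj] := HC1 h h01.
have kap := noise_kappa V0 VD VZ Ve e_on Vexp q0 eps_on reg C10 proj.
have kappa0 : 0 <= kappa.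
  rewrite mulr_ge0 ?sqr_ge0//; apply: le_trans (noise_trace_partial reg 0).
  by rewrite big_ord0.
have CM := galerkin_coordinate_mild V0 VD VZ Ve e_on Vexp Filt_usual beta_wiener beta_independent
  q0 (Wh_noise h h01) kap FK lam0 (introT andP (conj be0 be1)) kappa0 mild.
have unV k w : V (un k w) by exact: V_scheme.
pose a' (m : 'I_(N h)) := restrict_real (A s) (tau * - lamh h m).
pose b' (m : 'I_(N h)) := restrict_real (B s) (tau * - lamh h m).
have sb (m : 'I_(N h)) : scalar_bounds de M rho (tau * lamh h m) (a' m) (b' m).
  rewrite /a' /b' mulrN; apply: sbnd => //; first by rewrite mulr_gt0// lam0.
  (* An index m forces N h > 0, and by monotonicity the stability condition on the largest
     eigenvalue covers all of them. *)
  have N0 : (0 < N h)%N by apply: leq_ltn_trans (ltn_ord m).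
  apply: le_trans (stab N0); rewrite lee_fin ler_pM2l//; apply: lam_mono.
    by rewrite -ltnS prednK.
  by rewrite prednK.
have vi w (m : 'I_(N h)) : coordinates (eh h) (un 0%N w) m = coordinates (eh h) u0 m by exact: coordinates_hproj.
have vn k w (m : 'I_(N h)) := coordinates_scheme V0 VD VZ Ve e_on Vexp sigma (Wh h) u0 tau (lamh h)
  (fun z => restrict_real (A s) (tau * z)) (fun z => restrict_real (B s) (tau * z)) FK k w m.
have := coordinate_error hde hM hrho hMde T0 CM tau0 sb vi vn nT.
set X2 := \sum_m _; set err := (error_cst _ _ _ _ _ _ _ _ _) => HE.
have X20 : 0 <= X2 by exact: sum_sqr_ge0.
have X2u : X2 <= hnorm u0 ^+ 2 by exact: bessel_coordinates.
have rb := rate_bound al0 albe be1 T0 tau01 n1 nT (hnorm_ge0 u0) (introT andP (conj X20 X2u)).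
set Z := (1 + hnorm u0 * _) * _ in rb.
have Z0 : 0 <= Z by rewrite mulr_ge0 ?powR_ge0// addr_ge0// mulr_ge0 ?hnorm_ge0 ?powR_ge0.
have [_ _ HE2] := HE.
have Ysum : 0 <= X2 * n%:R^-1 ^+ 2 + (1 + X2) * tau + tau `^ be.
  by rewrite !addr_ge0 ?powR_ge0// mulr_ge0 ?sqr_ge0 ?addr_ge0// ltW.
have B1 : err * (X2 * n%:R^-1 ^+ 2 + (1 + X2) * tau + tau `^ be) <= (Num.sqrt (EC * (2 + T `^ al)) * Z) ^+ 2.
  rewrite exprMn sqr_sqrtr ?mulr_ge0 ?(ltW EC0) ?(ltW TT0)// -mulrA.
  apply: (@le_trans _ _ (EC * (X2 * n%:R^-1 ^+ 2 + (1 + X2) * tau + tau `^ be))).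
    by apply: ler_wpM2r => //; rewrite /EC; have := ler_norm err; lra.
  by apply: ler_wpM2l => //; exact: ltW.
have C0 : 0 <= Num.sqrt (EC * (2 + T `^ al)) * Z by rewrite mulr_ge0 ?sqrtr_ge0.
have nt0 : 0 <= n%:R * tau by rewrite mulr_ge0// ltW.
have [uV _ _ _] := mild.
have E1 : ('E_P[fun w => (hnorm (uh (n%:R * tau) w - un n w) ^+ 2)%R] <=
    ((Num.sqrt (EC * (2 + T `^ al)) * Z) ^+ 2)%:E)%E.
  rewrite unlock; apply: le_trans (le_trans HE2 _); last by rewrite lee_fin.
  rewrite le_eqVlt; apply/orP; left; apply/eqP; apply: eq_integral => w _; congr (_%:E).
  rewrite (hnorm_coordinates e_on Vexp); last by apply: VD; [exact: uV|exact: (VN VZ (unV n w))].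
  by apply: eq_bigr => m _; rewrite coordinatesB.
have E0 : (0 <= 'E_P[fun w => (hnorm (uh (n%:R * tau) w - un n w) ^+ 2)%R])%E.
  by rewrite unlock; apply: integral_ge0 => w _; rewrite lee_fin sqr_ge0.
have i2 : 0 <= 2^-1 :> R by rewrite invr_ge0.
(* The square root is taken in the extended reals, by monotonicity of the power 1/2. *)
have := @gt0_ler_poweR R 2^-1 i2 _ _ _ _ E1.
rewrite !in_itv /= !leey !andbT => /(_ E0); rewrite lee_fin sqr_ge0 => /(_ isT).
move=> H; apply: (le_trans H); rewrite lee_fin -mulrA -/Z.
by rewrite -powR_mulrn// -powRrM divff// powRr1.
Qed.
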